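(* Let $n\ge 1$ and $p>0$. Let $u:\mathbb{R}^n\to(-\infty,+\infty]$ be a convex function whose effective domain $\operatorname{dom}u=\{x: u(x)<+\infty\}$ is compact, such that $u$ is Lipschitz on $\operatorname{int}(\operatorname{dom}u)$, and such that $u$ is of class $C^2_+$ in $\operatorname{int}(\operatorname{dom}u)$. Let $\omega:\mathbb{R}^{n+1}\to\mathbb{R}$ be continuous and positive. Then there exists a constant $\delta_{p,n}$, depending only on $n$ and $p$, such that \[ \lim_{m\to+\infty} m^{\frac{2p}{n}}\,\triangle_p(u,P^c_{(m)},\omega)=\frac{\delta_{p,n}}{2^p}\left(\int_{\operatorname{dom}u}(\det D^2u(x))^{\frac{p}{n+2p}}\,\omega(x,u(x))^{\frac{n}{n+2p}}\,\mathrm{d}x\right)^{\frac{n+2p}{n}}. \]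
   Context: $C^2_+$ means twice continuously differentiable with positive definite Hessian $D^2u$. $P^c_{(m)}=P^c_{(m)}(u)$ is the class of functions $l_m:\mathbb{R}^n\to\mathbb{R}$ of the form $l_m(x)=\max_{1\le j\le m}\psi_j(x)$ for at most $m$ affine functions $\psi_j:\mathbb{R}^n\to\mathbb{R}$, satisfying $l_m(x)\le u(x)$ for all $x\in\operatorname{dom}u$. For $m$ sufficiently large, \[ \triangle_p(u,P^c_{(m)},\omega)=\inf\Big\{\int_{\operatorname{dom}u}(u(x)-l_m(x))^p\,\omega(x,u(x))\,\mathrm{d}x:\ l_m\in P^c_{(m)}\Big\}. \] (The constant $\delta_{p,n}$ is the one arising from Zador's quantization theorem: for every Jordan measurable compact $J\subset\mathbb{R}^n$ of positive volume, $\lim_{m\to\infty}m^{2p/n}\inf_{S\subset J,\#S=m}\int_J\min_{s\in S}\|x-s\|^{2p}\,\mathrm{d}x=\delta_{p,n}V_n(J)^{(n+2p)/n}$.) *)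

(* Defs.v *)
From HB Require Import structures.
From mathcomp Require Import all_boot all_order all_algebra.
From mathcomp Require Import all_classical all_reals all_analysis.
Set Implicit Arguments. Unset Strict Implicit. Unset Printing Implicit Defensive.
Import Order.TTheory GRing.Theory Num.Theory.
Import numFieldNormedType.Exports.
Local Open Scope classical_set_scope.
Local Open Scope ring_scope.

Section Defs.
Variable R : realType.

(* Lebesgue integral over R^n of a nonnegative extended-real function,
   computed as the iterated one-dimensional Lebesgue integral (Tonelli).
   R^0 is a point of mass 1. *)
Fixpoint iint (n : nat) : ('rV[R]_n -> \bar R) -> \bar R :=
  match n return ('rV[R]_n -> \bar R) -> \bar R with
  | 0 => fun f => f 0
  | n'.+1 => fun f =>
      (\int[@lebesgue_measure R]_t
         iint (fun y : 'rV[R]_n' => f (row_mx (const_mx t : 'rV[R]_1) y)))%E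
  end.

Definition iint_on n (D : set 'rV[R]_n) (f : 'rV[R]_n -> \bar R) : \bar R :=
  iint (fun x => if `[< D x >] then f x else 0%E).

Definition vol n (D : set 'rV[R]_n) : \bar R := iint_on D (fun _ => 1%E).

Definition dotr n (x y : 'rV[R]_n) : R := \sum_(i < n) x 0 i * y 0 i.
Definition enorm n (x : 'rV[R]_n) : R := Num.sqrt (dotr x x).

Definition jordan_compact n (J : set 'rV[R]_n) : Prop :=
  compact J /\ vol (closure J `\` interior J) = 0%E.

Definition quant_err n (p : R) (J : set 'rV[R]_n) (m : nat) : \bar R :=
  ereal_inf [set e | exists S : 'I_m.+1 -> 'rV[R]_n,
     injective S /\ (forall i, J (S i)) /\
     e = iint_on J (fun x => (\big[Num.min/enorm (x - S ord0) `^ (2 * p)]_(i < m.+1)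
                               (enorm (x - S i) `^ (2 * p)))%:E)].

Definition zador_constant n (p delta : R) : Prop :=
  forall J : set 'rV[R]_n, jordan_compact J -> (0 < vol J)%E ->
    ((fun m : nat => ((m.+1)%:R `^ (2 * p / n%:R))%:E * quant_err p J m) @ \oo
       --> (delta * fine (vol J) `^ ((n%:R + 2 * p) / n%:R))%:E)%E.

Definition dom n (u : 'rV[R]_n -> \bar R) : set 'rV[R]_n := [set x | (u x < +oo)%E].

(* convexity of an extended-real valued function with values in (-oo,+oo] *)
Definition convex_ext n (u : 'rV[R]_n -> \bar R) : Prop :=
  forall (x y : 'rV[R]_n) (t : R), 0 < t < 1 ->
    (u ((t *: x + (1 - t) *: y)%R) <= t%:E * u x + (1 - t)%:E * u y)%E.

Definition lip_on n (f : 'rV[R]_n -> R) (A : set 'rV[R]_n) : Prop :=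
  exists L : R, forall x y, A x -> A y -> `|f x - f y| <= L * `|x - y|.

Definition ebase n (i : 'I_n) : 'rV[R]_n := delta_mx 0 i.

Definition pderiv n (f : 'rV[R]_n -> R) (i : 'I_n) : 'rV[R]_n -> R :=
  fun x => derive f x (ebase i).
Definition hessian n (f : 'rV[R]_n -> R) (x : 'rV[R]_n) : 'M[R]_n :=
  \matrix_(i, j) pderiv (pderiv f j) i x.

Definition C2_on n (f : 'rV[R]_n -> R) (O : set 'rV[R]_n) : Prop :=
  open O /\
  (forall i x, O x -> derivable f x (ebase i)) /\
  (forall i, {in O, continuous (pderiv f i)}) /\
  (forall i j x, O x -> derivable (pderiv f j) x (ebase i)) /\
  (forall i j, {in O, continuous (pderiv (pderiv f j) i)}).

Definition posdef n (A : 'M[R]_n) : Prop :=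
  forall v : 'rV[R]_n, v != 0 -> 0 < (v *m A *m v^T) 0 0.

Definition C2plus_on n (f : 'rV[R]_n -> R) (O : set 'rV[R]_n) : Prop :=
  C2_on f O /\ forall x, O x -> posdef (hessian f x).

Definition maxaff n k (a : 'I_k.+1 -> 'rV[R]_n) (b : 'I_k.+1 -> R) (x : 'rV[R]_n) : R :=
  \big[Num.max/(dotr (a ord0) x + b ord0)]_(i < k.+1) (dotr (a i) x + b i).

Definition Pc n (u : 'rV[R]_n -> \bar R) (m : nat) : set ('rV[R]_n -> R) :=
  [set l | exists k (a : 'I_k.+1 -> 'rV[R]_n) (b : 'I_k.+1 -> R),
     (k.+1 <= m)%N /\ l = maxaff a b /\
     forall x, dom u x -> ((l x)%:E <= u x)%E].

Definition tri n (p : R) (u : 'rV[R]_n -> \bar R) (m : nat)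
  (omega : 'rV[R]_n * R -> R) : \bar R :=
  ereal_inf [set e | exists l, Pc u m l /\
     e = iint_on (dom u)
           (fun x => ((fine (u x) - l x) `^ p * omega (x, fine (u x)))%:E)].

End Defs.

(* Main.v *)
Require Import Defs.
From HB Require Import structures.
From mathcomp Require Import all_boot all_order all_algebra.
From mathcomp Require Import all_classical all_reals all_analysis.
From mathcomp Require Import measurable_realfun ring lra.
Set Implicit Arguments. Unset Strict Implicit. Unset Printing Implicit Defensive.
Import Order.TTheory GRing.Theory Num.Theory.
Import numFieldNormedType.Exports.
Import HBNNSimple.
Local Open Scope classical_set_scope.
Local Open Scope ring_scope.

(** A family of "pieces" with error functions [e q] is given, and the error of a finite family at a
    point is the smallest [e q x]. If near each [x0] the best error of [k] pieces on a small cube [Q] is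
    about [w x0 * |Q|^(1+r) * k^(-r)], if a single piece cannot be good on two disjoint cubes, and if [k]
    pieces always achieve a uniform error [O(k^(-r))], then distributing [m] pieces optimally among the
    cubes of a packing (proportionally to [w^(1/(1+r)) |Q|]) shows that [m^r] times the best error
    converges to [(\int w^(1/(1+r)))^(1+r)]. This principle is used twice.

    First, the pieces are points and [e s x = |x - s|^(2p)]: self-similarity of the cube makes
    [m^r * error] converge to its infimum [delta] there, and Zador's theorem follows for Jordan sets.
    Secondly, the pieces are affine minorants [psi] of [u], with [e psi x = (u x - psi x)^p omega(x, u x)].
    Near [x0] write [D^2 u(x0) = B B^T]: a tangent at [z] misses [u] by about [|(x - z) B|^2 / 2], and
    any minorant misses it at least by about that much for [z] the minimizer of [u - psi] on [Q], so
    that the local hypothesis is Zador's theorem on the parallelepiped [Q B]. Separation is strict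
    convexity; the uniform bound is obtained from tangents at the points of a net for
    [z |-> z + grad u z], as [u x - tangent_z x <= (grad u x - grad u z).(x - z)]. *)

(** * Lebesgue measure on row vectors as iterated integration *)

(** The density $w=\frac{\delta}{2^p}(\det D^2u)^{p/n}\omega$ is not known in advance to be bounded
    or integrable, since the Hessian may blow up at the boundary of the domain. Hence the lower
    estimate is proved through truncations of $w$, and finiteness of the integral is then read off
    from the uniform bound $O(k^{-r})$. That bound must not depend on second derivatives either:
    this is why the net is taken for $z\mapsto z+\nabla u(z)$, whose range is bounded because the
    domain is bounded and $u$ is Lipschitz. In the lower estimate the difficulty is that a piece is
    a global object and could serve several cubes. Separation assigns each piece to at most one
    cube, and the pieces that are bad on a cube are replaced there by one fixed net, whose size does
    not grow with $m$. With $r=2p/n$ one has $1/(1+r)=n/(n+2p)$, which gives the exponents of the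
    theorem. Finally, $u$ is uncontrolled on the boundary of its domain, where it need not even be
    measurable; iterated integrals are therefore compared off the boundary of a convex set without
    any measurability. *)

Definition mx_display : measure_display.
Proof. exact: default_measure_display. Qed.

Section borel_mx.
Context {R : realType} {m n : nat}.
HB.instance Definition _ := @isMeasurable.Build mx_display 'M[R]_(m, n)
  <<s @open 'M[R]_(m, n) >> (@sigma_algebra0 _ _ _) (@sigma_algebraC _ _)
  (@sigma_algebra_bigcup _ _ _).
End borel_mx.

Section borel_mx_theory.
Context {R : realType}.
Implicit Types (m n : nat).

Lemma open_measurable_mx m n (U : set 'M[R]_(m, n)) : open U -> measurable U.
Proof. exact: sub_sigma_algebra. Qed.

Lemma closed_measurable_mx m n (U : set 'M[R]_(m, n)) : closed U -> measurable U.
Proof.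
move=> cU; rewrite -(setCK U); apply: measurableC; apply: open_measurable_mx.
exact: closed_openC.
Qed.

Lemma mx_norm_ltP m n (x : 'M[R]_(m, n)) (e : R) : 0 < e ->
  (`|x| < e) <-> (forall i j, `|x i j| < e).
Proof.
move=> e0; have -> : (`|x| < e) <-> ball (0 : 'M[R]_(m,n)) e x.
  by rewrite -ball_normE /= sub0r normrN.
rewrite /ball /= /mx_ball; split => [[_ h] i j|h].
  by have := h i j; rewrite /ball /= mxE sub0r normrN.
split=> // i j; have := h i j.
  by rewrite /ball /= mxE sub0r normrN.
Qed.

Lemma mx_norm_leP m n (x : 'M[R]_(m, n)) (e : R) : 0 <= e ->
  (`|x| <= e) <-> (forall i j, `|x i j| <= e).
Proof.
move=> e0; split=> [xe i j|h].
  apply/ler_addgt0Pr => d d0; apply/ltW.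
  have /(mx_norm_ltP x (ltr_wpDl e0 d0)) : `|x| < e + d by rewrite (le_lt_trans xe)// ltrDl.
  exact.
apply/ler_addgt0Pr => d d0; apply/ltW/(mx_norm_ltP x (ltr_wpDl e0 d0)) => i j.
by rewrite (le_lt_trans (h i j))// ltrDl.
Qed.

Lemma coord_le_norm m n (x : 'M[R]_(m, n)) i j : `|x i j| <= `|x|.
Proof. by have /(mx_norm_leP x (normr_ge0 _)) : `|x| <= `|x| by []; apply. Qed.

Lemma invSn_gt0 k : 0 < k.+1%:R^-1 :> R.
Proof. by rewrite invr_gt0. Qed.

Lemma rat_approx_mx m n (x : 'M[R]_(m, n)) (e : R) : 0 < e ->
  exists c : 'M[rat]_(m, n), `|x - map_mx ratr c| < e.
Proof.
move=> e0.
have /choice[f fP] : forall ij : 'I_m * 'I_n, exists q : rat, `|x ij.1 ij.2 - ratr q| < e.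
  move=> [i j] /=.
  have /rat_in_itvoo[q] : x i j - e < x i j + e by lra.
  by rewrite in_itv/= => /andP[q1 q2]; exists q; rewrite ltr_norml; apply/andP; split; lra.
exists (\matrix_(i, j) f (i, j)); apply/(mx_norm_ltP _ e0) => i j.
by rewrite !mxE; exact: (fP (i, j)).
Qed.

(** An open set is a countable union of sup-norm balls with rational centre and radius $1/(k+1)$,
    and membership in such a ball is a finite conjunction of conditions on single entries. *)
Lemma measurable_fun_mx d (T : measurableType d) m n (g : T -> 'M[R]_(m, n)) :
  (forall i j, measurable_fun setT (fun x => g x i j)) -> measurable_fun setT g.
Proof.
move=> mg; apply: (measurability (@open 'M[R]_(m, n))) => //.
move=> _ [U oU <-]; rewrite setTI.
pose b (ck : 'M[rat]_(m, n) * nat) : set 'M[R]_(m, n) :=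
  [set x | `|x - map_mx ratr ck.1| < ck.2.+1%:R^-1].
have -> : g @^-1` U = \bigcup_ck (if `[< b ck `<=` U >] then g @^-1` b ck else set0).
  apply/seteqP; split=> [t /= Ut|t [ck _]]; last first.
    by case: ifPn => // /asboolP h; exact: h.
  have [e /= e0 eU] : exists2 e : R, 0 < e & forall y, `|g t - y| < e -> U y.
    have /nbhs_ballP[e /= e0 eU] : nbhs (g t) U by exact: open_nbhs_nbhs.
    by exists e => // y ty; apply: eU; rewrite -ball_normE.
  have [k ke] : exists k, k.+1%:R^-1 < e / 2.
    have := @near_infty_natSinv_lt R (PosNum (divr_gt0 e0 (ltr0n _ 2))).
    by case=> N _ /(_ N (leqnn _)) /= h; exists N.
  have [c tc] := @rat_approx_mx m n (g t) (k.+1%:R^-1) (invSn_gt0 _).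
  exists (c, k) => //; case: ifPn => // /asboolP[] x; rewrite /b /= => xc; apply: eU.
  rewrite (_ : _ - _ = (g t - map_mx ratr c) - (x - map_mx ratr c)); last first.
    by rewrite opprB addrA subrK.
  by rewrite (le_lt_trans (ler_normB _ _))// (splitr e) ltrD// (lt_trans _ ke).
apply: countable_bigcupT_measurable; first exact: countableP.
move=> ck; case: ifPn => _; last exact: measurable0.
have -> : g @^-1` b ck = ~` (\bigcup_(ij : 'I_m * 'I_n)
   ~` ((fun x => g x ij.1 ij.2) @^-1` [set r | `|r - ratr (ck.1 ij.1 ij.2)| < ck.2.+1%:R^-1])).
  rewrite setC_bigcup; apply/seteqP; split=> [t|t] /=.
    move=> /(mx_norm_ltP _ (invSn_gt0 _)) h [i j] _.
    by rewrite setCK; have := h i j; rewrite !mxE.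
  move=> h; apply/(mx_norm_ltP _ (invSn_gt0 _)) => i j.
  by have := h (i, j) I; rewrite setCK !mxE.
apply: measurableC; apply: countable_bigcupT_measurable; first exact: countableP.
move=> [i j]; apply: measurableC => /=; rewrite -[X in measurable X]setTI.
apply: mg => //.
rewrite (_ : mkset _ = ball (ratr (ck.1 i j) : R) (ck.2.+1%:R^-1 : R)); first exact: measurable_ball.
by apply/seteqP; split => r; rewrite /ball /= distrC.
Qed.

Lemma measurable_fun_cont m n (f : 'M[R]_(m, n) -> R)
    (O : set 'M[R]_(m, n)) : open O -> {in O, continuous f} ->
  measurable_fun O f.
Proof.
move=> oO fc; apply: (measurability _ (RGenOpens.measurableE R)).
move=> _ [_ [a [b ->] <-]]; apply: open_measurable_mx.
rewrite openE => x [Ox Ux]; apply: filterI; first exact: open_nbhs_nbhs.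
apply: (fc x); first by rewrite inE.
by apply: open_nbhs_nbhs; split => //; exact: itv_open.
Qed.

Lemma measurable_row_mx n : measurable_fun setT
  (fun z : R * 'rV[R]_n => row_mx (const_mx z.1 : 'rV[R]_1) z.2 : 'rV[R]_n.+1).
Proof.
apply: measurable_fun_mx => i j; rewrite (ord1 i).
have mc k : measurable_fun setT (fun z : 'rV[R]_n => z 0 k).
  apply: (@measurable_fun_cont 1 n) => [|x _]; first exact: openT.
  exact: coord_continuous.
under eq_fun do rewrite mxE.
case: splitP => k jk.
  by under eq_fun do rewrite mxE; exact: measurable_fst.
by apply: (measurableT_comp (mc k)); exact: measurable_snd.
Qed.

Local Notation leb := (@lebesgue_measure R).

Lemma iint_ge0 n (f : 'rV[R]_n -> \bar R) : (forall x, 0 <= f x)%E -> (0 <= iint f)%E.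
Proof.
elim: n f => [f f0|n IH f f0] /=; first exact: f0.
by apply: integral_ge0 => t _; apply: IH.
Qed.

(** No measurability is asked: the integral of a nonnegative function is a supremum over the simple
    functions below it. This is what later allows arbitrary values of $u$ on the boundary of its
    domain. *)
Lemma le_integralT (f g : R -> \bar R) : (forall x, 0 <= f x)%E ->
  (forall x, f x <= g x)%E -> (\int[leb]_x f x <= \int[leb]_x g x)%E.
Proof.
move=> f0 fg; rewrite !ge0_integralTE//; last by move=> x; exact: le_trans (fg x).
apply: ereal_sup_le => _ [h hf <-]; exists h => // x.
exact: le_trans (hf x) (fg x).
Qed.

Lemma le_iint n (f g : 'rV[R]_n -> \bar R) : (forall x, 0 <= f x)%E ->
  (forall x, f x <= g x)%E -> (iint f <= iint g)%E.
Proof.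
elim: n f g => [f g f0 fg|n IH f g f0 fg] /=; first exact: fg.
apply: le_integralT => t; first exact: iint_ge0.
by apply: IH.
Qed.

(** The parameter space is generalized because the induction enlarges it: the outermost integration
    variable joins the parameters, the inner iterated integral is measurable in both, and Tonelli
    integrates that variable out. *)
Lemma measurable_iint n : forall d (T : measurableType d) (f : T * 'rV[R]_n -> \bar R),
  measurable_fun setT f -> (forall z, 0 <= f z)%E ->
  measurable_fun setT (fun x => iint (fun y => f (x, y))).
Proof.
elim: n => [|n IH] d T f mf f0 /=.
  apply: (measurableT_comp mf).
  exact: measurable_fun_pair.
pose h (z : T * R) := iint (fun y => f (z.1, row_mx (const_mx z.2 : 'rV[R]_1) y)).
apply: (@measurable_fun_fubini_tonelli_F _ _ _ _ R leb h).
  apply: (IH _ (T * R)%type (fun w => f (w.1.1, row_mx (const_mx w.1.2 : 'rV[R]_1) w.2))) => //.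
  apply: (measurableT_comp mf); apply: measurable_fun_pair.
    by apply: measurableT_comp; exact: measurable_fst.
  have mp : measurable_fun setT (fun w : (T * R) * 'rV[R]_n => (w.1.2, w.2)).
    apply: measurable_fun_pair; last exact: measurable_snd.
    by apply: (measurableT_comp measurable_snd); exact: measurable_fst.
  exact: (measurableT_comp (@measurable_row_mx n) mp).
by move=> z; exact: iint_ge0.
Qed.

Lemma measurable_section n (f : 'rV[R]_n.+1 -> \bar R) (t : R) :
  measurable_fun setT f ->
  measurable_fun setT (fun y : 'rV[R]_n => f (row_mx (const_mx t : 'rV[R]_1) y)).
Proof.
move=> mf; apply: (measurableT_comp mf).
have mp : measurable_fun setT (fun y : 'rV[R]_n => (t, y)) by exact: measurable_fun_pair.
exact: (measurableT_comp (@measurable_row_mx n) mp).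
Qed.

Lemma measurable_iint_section n (f : 'rV[R]_n.+1 -> \bar R) :
  measurable_fun setT f -> (forall z, 0 <= f z)%E ->
  measurable_fun setT (fun t : R => iint (fun y : 'rV[R]_n => f (row_mx (const_mx t : 'rV[R]_1) y))).
Proof.
move=> mf f0.
apply: (@measurable_iint n _ R (fun w => f (row_mx (const_mx w.1 : 'rV[R]_1) w.2))) => //.
apply: (measurableT_comp mf); exact: measurable_row_mx.
Qed.

Lemma iintD n (f g : 'rV[R]_n -> \bar R) :
  measurable_fun setT f -> measurable_fun setT g ->
  (forall z, 0 <= f z)%E -> (forall z, 0 <= g z)%E ->
  iint (fun x => f x + g x)%E = (iint f + iint g)%E.
Proof.
elim: n f g => [|n IH] f g mf mg f0 g0 //=.
rewrite -ge0_integralD//; last 4 first.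
  by move=> x _; exact: iint_ge0.
  exact: measurable_iint_section.
  by move=> x _; exact: iint_ge0.
  exact: measurable_iint_section.
by apply: eq_integral => t _; rewrite IH//; exact: measurable_section.
Qed.

Lemma iintZl n (c : R) (f : 'rV[R]_n -> \bar R) : 0 <= c ->
  measurable_fun setT f -> (forall z, 0 <= f z)%E ->
  iint (fun x => c%:E * f x)%E = (c%:E * iint f)%E.
Proof.
move=> c0; elim: n f => [|n IH] f mf f0 //=.
rewrite -ge0_integralZl//; last 2 first.
  exact: measurable_iint_section.
  by move=> x _; exact: iint_ge0.
by apply: eq_integral => t _; rewrite IH//; exact: measurable_section.
Qed.

Lemma iint0 n : iint (fun _ : 'rV[R]_n => 0%E) = 0%E :> \bar R.
Proof. by elim: n => //= n IH; apply: integral0_eq => t _. Qed.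

Lemma iint_sum n I (s : seq I) (f : I -> 'rV[R]_n -> \bar R) :
  (forall i, measurable_fun setT (f i)) -> (forall i z, 0 <= f i z)%E ->
  iint (fun x => \sum_(i <- s) f i x)%E = (\sum_(i <- s) iint (f i))%E.
Proof.
move=> mf f0; elim: s => [|i s IH].
  by rewrite big_nil -[RHS](iint0 n); congr iint; apply/funext => x; rewrite big_nil.
rewrite big_cons -IH -iintD//.
- by congr iint; apply/funext => x; rewrite big_cons.
- exact: emeasurable_sum.
- by move=> z; exact: sume_ge0.
Qed.

Lemma iint_cvg n (g : nat -> 'rV[R]_n -> \bar R) (f : 'rV[R]_n -> \bar R) :
  (forall k, measurable_fun setT (g k)) -> (forall k x, 0 <= g k x)%E ->
  (forall x, {homo g ^~ x : a b / (a <= b)%N >-> (a <= b)%E}) ->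
  (forall x, g k x @[k --> \oo] --> f x) ->
  iint (g k) @[k --> \oo] --> iint f.
Proof.
elim: n g f => [|n IH] g f mg g0 ndg gf /=; first exact: gf.
have Hf t : iint (fun y : 'rV[R]_n => f (row_mx (const_mx t : 'rV[R]_1) y)) =
   limn (fun k => iint (fun y : 'rV[R]_n => g k (row_mx (const_mx t : 'rV[R]_1) y))).
  apply/esym/cvg_lim => //; apply: IH => // k; exact: measurable_section.
under [X in _ --> X]eq_integral do rewrite Hf.
apply: cvg_monotone_convergence => //.
- by move=> k; exact: measurable_iint_section.
- by move=> k x _; exact: iint_ge0.
- by move=> x _ a b ab; apply: le_iint => // y; exact: ndg.
Qed.

(** On Borel sets this is countably additive, by [iint_cvg] applied to partial sums. It turns the
    elementary iterated integral into a measure to which integration theory applies. *)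
Definition leb_mx n (A : set 'rV[R]_n) : \bar R := iint (fun x => (\1_A x)%:E).

Lemma measurable_EFin_indic n (A : set 'rV[R]_n) : measurable A ->
  measurable_fun setT (fun x => (\1_A x)%:E : \bar R).
Proof. by move=> mA; apply/measurable_EFinP; exact: measurable_indic. Qed.

Section leb_mx_measure.
Variable n : nat.

Let leb_mx0 : @leb_mx n set0 = 0%E.
Proof.
by rewrite /leb_mx -[RHS](iint0 n); congr iint; apply/funext => x; rewrite indic0.
Qed.

Let leb_mx_ge0 (A : set 'rV[R]_n) : (0 <= leb_mx A)%E.
Proof. by apply: iint_ge0 => x; rewrite lee_fin. Qed.

Let leb_mx_sigma_additive : semi_sigma_additive (@leb_mx n).
Proof.
move=> F mF tF mUF; rewrite /leb_mx.
rewrite (_ : (fun _ => _) = (fun k => iint (fun x => \sum_(0 <= i < k) (\1_(F i) x)%:E)%E)); last first.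
  apply/funext => k; rewrite iint_sum// => i; first exact: measurable_EFin_indic.
apply: iint_cvg.
- by move=> k; apply: emeasurable_sum => i; exact: measurable_EFin_indic.
- by move=> k x; apply: sume_ge0 => i _; rewrite lee_fin.
- move=> x a b ab; apply: lee_sum_nneg_natr => // k _ _; by rewrite lee_fin.
- move=> x; rewrite indic_bigcup//; apply: is_cvg_nneseries => i _ _.
  by rewrite lee_fin.
Qed.

HB.instance Definition _ := isMeasure.Build _ _ _ (@leb_mx n)
  leb_mx0 leb_mx_ge0 leb_mx_sigma_additive.

End leb_mx_measure.

Lemma iint_nnsfun n (h : {nnsfun 'rV[R]_n >-> R}) :
  iint (fun x => (h x)%:E) = sintegral (@leb_mx n) h.
Proof.
rewrite sintegralE.
transitivity (iint (fun x => \sum_(r \in range h) (`|r|%:E * (\1_(h @^-1` [set r]) x)%:E))%E).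
  congr iint; apply/funext => x; rewrite fsumEFin// [in LHS](fimfunE h).
  congr EFin; apply: eq_fsbigr => r; rewrite inE => -[y _ <-].
  by rewrite ger0_norm.
rewrite fsbig_finite//=.
under eq_fun do rewrite fsbig_finite//=.
rewrite iint_sum.
- rewrite big_seq [RHS]big_seq; apply: eq_bigr => r.
  rewrite in_fset_set// inE => -[y _ <-].
  rewrite iintZl//; first by rewrite ger0_norm.
  by apply: measurable_EFin_indic; exact: measurable_sfunP.
- by move=> r; apply: measurable_funeM; apply: measurable_EFin_indic; exact: measurable_sfunP.
- by move=> r z; rewrite mule_ge0// lee_fin.
Qed.

(** Both functionals agree on simple functions, and both pass to monotone limits of them. *)
Lemma iintE n (f : 'rV[R]_n -> \bar R) : measurable_fun setT f ->
  (forall x, 0 <= f x)%E -> iint f = (\int[@leb_mx n]_x f x)%E.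
Proof.
move=> mf f0.
pose g := nnsfun_approx measurableT mf.
have gf x : (g k x)%:E @[k --> \oo] --> f x by exact: cvg_nnsfun_approx.
have ndg x : {homo (fun k => (g k x)%:E) : a b / (a <= b)%N >-> (a <= b)%E}.
  by move=> a b ab; rewrite lee_fin; exact/lefP/nd_nnsfun_approx.
have mg k : measurable_fun setT (fun x => (g k x)%:E).
  by apply/measurable_EFinP.
have h1 : iint (fun x => (g k x)%:E) @[k --> \oo] --> iint f.
  by apply: iint_cvg => // k x; rewrite lee_fin.
have h2 : (\int[@leb_mx n]_x (g k x)%:E)%E @[k --> \oo] --> (\int[@leb_mx n]_x f x)%E.
  rewrite [X in _ --> X](_ : _ = \int[@leb_mx n]_x limn (fun k => (g k x)%:E))%E; last first.
    by apply: eq_integral => x _; apply/esym/cvg_lim => //; exact: gf.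
  apply: cvg_monotone_convergence => //.
  + by move=> k x _; rewrite lee_fin.
have E k : iint (fun x => (g k x)%:E) = (\int[@leb_mx n]_x (g k x)%:E)%E.
  by rewrite integralT_nnsfun -iint_nnsfun.
by move: h1; rewrite (funext E) => h1; exact: cvg_unique h1 h2.
Qed.

Lemma iint_onE n (D : set 'rV[R]_n) (f : 'rV[R]_n -> \bar R) : measurable D ->
  measurable_fun D f -> (forall x, D x -> 0 <= f x)%E ->
  iint_on D f = (\int[@leb_mx n]_(x in D) f x)%E.
Proof.
move=> mD mf f0; rewrite /iint_on [RHS]integral_mkcond.
have E : (fun x => if `[< D x >] then f x else 0%E) = f \_ D.
  by apply/funext => x; rewrite /patch; case: asboolP => Dx; [rewrite mem_set|rewrite memNset].
rewrite E iintE//; first exact/(measurable_restrictT _ mD).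
by move=> x; rewrite /patch; case: ifPn => //; rewrite inE => /f0.
Qed.

Lemma volE n (D : set 'rV[R]_n) : measurable D -> vol D = leb_mx D.
Proof.
move=> mD; rewrite /vol iint_onE//; first by rewrite integral_cst// mul1e.
Qed.

End borel_mx_theory.

(** * Linear changes of variables and the Cholesky factorization *)

Definition affine_map {R : realType} (b c : R) (t : R) : measurableTypeR R := b * t + c.

Section change_of_variables.
Context {R : realType}.
Local Notation leb := (@lebesgue_measure R).

Lemma measurable_affine_map (b c : R) : measurable_fun setT (affine_map b c).
Proof.
have : measurable_fun setT (fun t : R => b * t + c).
  by apply: measurable_funD => //; exact: measurable_funM.
by [].
Qed.

(** A measure that gives half-open intervals their length is Lebesgue measure; the preimage of
    $]x,y]$ has length $(y-x)/b$, which the factor $b$ restores. *)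
Lemma lebesgue_measure_affine (b c : R) (A : set R) (b0 : 0 < b) : measurable A ->
  pushforward (mscale (NngNum (ltW b0)) leb) (affine_map b c) A = leb A.
Proof.
move=> mA; have mphi := measurable_affine_map b c.
apply/esym/lebesgue_measure_unique => //= _ [[x y] _ <-].
rewrite /pushforward /mscale /=.
have -> : affine_map b c @^-1` `]x, y] = `](x - c) / b, (y - c) / b]%classic.
  apply/seteqP; split=> t /=; rewrite !in_itv /= /affine_map ltr_pdivrMr// ler_pdivlMr//;
   by rewrite ltrBlDr lerBrDr mulrC.
rewrite !lebesgue_measure_itv/= !lte_fin ltr_pM2r ?invr_gt0// ltrD2r.
case: ifPn => _; last by rewrite mule0.
by rewrite -!EFinD -EFinM; congr EFin; field; rewrite gt_eqF.
Qed.

Lemma integral_affine (b c : R) (f : R -> \bar R) : 0 < b ->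
  measurable_fun setT f -> (forall x, 0 <= f x)%E ->
  (\int[leb]_t f (b * t + c)%R = b^-1%:E * \int[leb]_t f t)%E.
Proof.
move=> b0 mf f0.
have mphi := measurable_affine_map b c.
have H : (\int[mscale (NngNum (ltW b0)) leb]_(t in affine_map b c @^-1` setT) (f \o affine_map b c) t
    = \int[leb]_t f t)%E.
  rewrite -ge0_integral_pushforward//.
  by apply: eq_measure_integral => A mA _; exact: lebesgue_measure_affine.
rewrite -H preimage_setT ge0_integral_mscale//=; last exact: (measurableT_comp mf mphi).
by rewrite muleA -EFinM mulVf ?gt_eqF// mul1e.
Qed.

Lemma row_mx_ord0 n (t : R) (y : 'rV[R]_n) :
  (row_mx (const_mx t : 'rV[R]_1) y : 'rV[R]_n.+1) 0 ord0 = t.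
Proof. by rewrite mxE; case: splitP => k //=; rewrite mxE. Qed.

Lemma row_mx_lift n (t : R) (y : 'rV[R]_n) j :
  (row_mx (const_mx t : 'rV[R]_1) y : 'rV[R]_n.+1) 0 (lift ord0 j) = y 0 j.
Proof.
rewrite mxE; case: splitP => k /=; first by rewrite ord1.
by move=> h; congr (y _ _); apply/val_inj; case: h.
Qed.

Lemma row_mxB n (a b : R) (x y : 'rV[R]_n) :
  (row_mx (const_mx a : 'rV[R]_1) x : 'rV[R]_n.+1) - row_mx (const_mx b : 'rV[R]_1) y =
  row_mx (const_mx (a - b) : 'rV[R]_1) (x - y).
Proof. by apply/rowP => i; rewrite !mxE; case: splitP => k _; rewrite !mxE. Qed.

(** The substitution formula is recorded as a property of the matrix, to be established only for
    those built by [cov_ublock]. The arbitrary translation [c] is there for the induction: an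
    off-diagonal row shifts the inner variables by an amount that depends on the outer one. *)
Definition cov n (B : 'M[R]_n) := 0 < \det B /\
  forall c f, measurable_fun setT f -> (forall x, 0 <= f x)%E ->
  iint (fun x => f (x *m B + c)) = ((\det B)^-1%:E * iint f)%E.

Lemma cov0 (B : 'M[R]_0) : cov B.
Proof.
rewrite /cov det_mx00 ltr01; split=> // c f mf f0 /=.
by rewrite invr1 mul1e; congr f; apply/rowP; case.
Qed.

(** For a fixed first coordinate [t] the inner variables undergo [B] and a translation, which gives
    $(\det B)^{-1}$; the remaining integral in [t] is a one-dimensional affine substitution, which
    gives $b^{-1}$. *)
Lemma cov_ublock n (b : R) (v : 'rV[R]_n) (B : 'M[R]_n) : 0 < b -> cov B ->
  cov (block_mx (b%:M : 'M[R]_1) v 0 B : 'M[R]_n.+1).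
Proof.
move=> b0 [B0 HB].
have dE : \det (block_mx (b%:M : 'M[R]_1) v 0 B) = b * \det B.
  by rewrite det_ublock det_scalar1.
split=> [|c f mf f0]; first by rewrite dE mulr_gt0.
rewrite dE /=.
have E t (y : 'rV[R]_n) : row_mx (const_mx t : 'rV[R]_1) y *m (block_mx (b%:M : 'M[R]_1) v 0 B) + c =
   row_mx (const_mx (b * t + c 0 0) : 'rV[R]_1) (y *m B + (t *: v + @rsubmx _ 1 1 n c)).
  rewrite -[in LHS](@hsubmxK _ 1 1 n c) mul_row_block mulmx0 addr0 add_row_mx; congr row_mx.
    rewrite mul_mx_scalar; apply/rowP => i; rewrite !mxE ord1; congr (_ + c _ _).
    by apply/val_inj.
  rewrite (_ : const_mx t = t%:M); last by apply/rowP => i; rewrite !mxE !ord1.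
  by rewrite mul_scalar_mx addrA [y *m B + _]addrC.
under eq_integral => t _.
  under eq_fun do rewrite E.
  rewrite (HB (t *: v + @rsubmx _ 1 1 n c) (fun y => f (row_mx (const_mx (b * t + c 0 0) : 'rV[R]_1) y)))//; last exact: measurable_section.
  over.
have mi := measurable_iint_section mf f0.
have mi' := measurableT_comp mi (measurable_affine_map b (c 0 0)).
rewrite ge0_integralZl//; try solve [exact: mi'|by move=> t _; exact: iint_ge0|by rewrite lee_fin invr_ge0 ltW].
rewrite (integral_affine _ b0 mi); last by move=> t; exact: iint_ge0.
by rewrite muleA -EFinM invfM mulrC.
Qed.

Lemma cov_scalar n (h : R) : 0 < h -> cov (h%:M : 'M[R]_n).
Proof.
move=> h0; elim: n => [|n IH]; first exact: cov0.
have -> : (h%:M : 'M[R]_n.+1) = block_mx (h%:M : 'M[R]_1) 0 0 h%:M by exact: (@scalar_mx_block _ 1 n).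
exact: cov_ublock.
Qed.

(** Block recursion on the lower right corner, so that the factor is upper triangular and inherits
    [cov]. The new diagonal entry is the square root of a Schur complement, which has to be shown
    positive. *)
Lemma cholesky n (A : 'M[R]_n) : A^T = A -> posdef A ->
  exists2 B : 'M[R]_n, cov B & A = B *m B^T.
Proof.
elim: n A => [|n IH] A sA pA.
  by exists 0; [exact: cov0|apply/matrixP => -[]].
pose A1 : 'M[R]_(1 + n) := A.
pose a := ulsubmx A1; pose v := ursubmx A1; pose A' := drsubmx A1.
have AE : A1 = block_mx a v v^T A'.
  rewrite -[LHS]submxK; congr block_mx.
  by rewrite /v trmx_ursub; congr dlsubmx.
have sA' : A'^T = A' by rewrite /A' trmx_drsub; congr drsubmx.
have qE (s : 'M[R]_1) (w : 'rV[R]_n) : row_mx s w *m A1 *m (row_mx s w)^T =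
    (s *m a + w *m v^T) *m s^T + (s *m v + w *m A') *m w^T.
  by rewrite AE mul_row_block tr_row_mx mul_row_col.
have pA' : posdef A'.
  move=> w w0; have := pA (row_mx (0 : 'M[R]_1) w).
  have := qE 0 w; rewrite /A1 => ->; rewrite mul0mx trmx0 mulmx0 !add0r mul0mx add0r; apply.
  apply: contra w0 => /eqP h; apply/eqP.
  by have := congr1 (@rsubmx _ 1 1 n) h; rewrite row_mxKr => ->; apply/rowP => i; rewrite !mxE.
have [B' cB' A'E] := IH A' sA' pA'.
have uB' : B' \in unitmx by rewrite unitmxE unitfE gt_eqF//; case: cB'.
have uBt : B'^T \in unitmx by rewrite unitmx_tr.
pose c := v *m invmx (B'^T).
have vE : v = c *m B'^T by rewrite /c -mulmxA mulVmx// mulmx1.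
(* Schur complement of [A'], since $cc^T=vA'^{-1}v^T$. *)
pose b2 := (a - c *m c^T) 0 0.
have b20 : 0 < b2.
  (* The vector $(1,z)$ minimizes the form in its last coordinates, because [z *m A' = - v]; the
     form takes exactly the value [b2] there. *)
  pose z := - (c *m invmx B').
  have := pA (row_mx (1%:M : 'M[R]_1) z); have := qE 1%:M z; rewrite /A1 => ->.
  have zE : z *m A' = - v.
    by rewrite /z A'E mulmxA mulNmx mulmxKV// mulNmx -vE.
  rewrite !mul1mx zE subrr mul0mx addr0 trmx1 mulmx1.
  have -> : z *m v^T = - (c *m c^T).
    by rewrite vE trmx_mul trmxK /z mulNmx mulmxA mulmxKV.
  apply; apply/eqP => /(congr1 (@lsubmx _ 1 1 n)); rewrite row_mxKl => /matrixP/(_ 0 0).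
  by rewrite !mxE => /eqP; rewrite oner_eq0.
pose b := Num.sqrt b2.
have b0 : 0 < b by rewrite sqrtr_gt0.
pose B1 : 'M[R]_(1 + n) := block_mx (b%:M : 'M[R]_1) c 0 B'.
suff A1E : A1 = B1 *m B1^T by exists B1 => //; exact: cov_ublock.
rewrite AE tr_block_mx mulmx_block; congr block_mx.
- rewrite tr_scalar_mx -scalar_mxM -expr2 sqr_sqrtr ?ltW// /b2.
  by apply/matrixP => i j; rewrite !ord1 !mxE /= mulr1n subrK.
- by rewrite trmx0 mulmx0 add0r.
- by rewrite mul0mx add0r vE trmx_mul trmxK.
- by rewrite trmx0 mulmx0 add0r.
Qed.

Lemma leb_mx_prod n (P : 'I_n -> set R) : (forall j, measurable (P j)) ->
  leb_mx [set x : 'rV[R]_n | forall j, P j (x 0 j)] = (\prod_(j < n) leb (P j))%E.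
Proof.
elim: n P => [|n IH] P mP.
  rewrite big_ord0 /leb_mx /= indicE mem_set//=; by case.
rewrite big_ord_recl -IH// /leb_mx /=.
pose Q := [set x : 'rV[R]_n | forall j, P (lift ord0 j) (x 0 j)].
have mQ : measurable_fun setT (fun y => (\1_Q y)%:E : \bar R).
  apply: measurable_EFin_indic.
  have -> : Q = ~` \bigcup_j ~` [set x : 'rV[R]_n | P (lift ord0 j) (x 0 j)].
    rewrite setC_bigcup; apply/seteqP; split=> x h j; first by move=> _; rewrite setCK; exact: h.
    by have := h j I; rewrite setCK.
  apply: measurableC; apply: countable_bigcupT_measurable; first exact: countableP.
  move=> j; apply: measurableC; rewrite -[X in measurable X]setTI.
  have mc : measurable_fun setT (fun x : 'rV[R]_n => x 0 j).
    apply: (@measurable_fun_cont _ 1 n) => [|x _]; first exact: openT.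
    exact: coord_continuous.
  exact: mc.
have E t (y : 'rV[R]_n) : (\1_([set x : 'rV[R]_n.+1 | forall j, P j (x 0 j)]) (row_mx (const_mx t : 'rV[R]_1) y))%:E =
   ((\1_(P ord0) t)%:E * (\1_Q y)%:E)%E :> \bar R.
  rewrite -EFinM !indicE -natrM mulnb; congr (_%:R%:E); congr nat_of_bool.
  apply/idP/idP; rewrite !inE.
    move=> h; apply/andP; split; rewrite inE.
      by have := h ord0; rewrite row_mx_ord0.
    by move=> j; have := h (lift ord0 j); rewrite row_mx_lift.
  move=> /andP[]; rewrite !inE => h0 h j.
  by have [k ->|->] := unliftP ord0 j; [rewrite row_mx_lift; exact: h|rewrite row_mx_ord0].
under eq_integral => t _.
  under eq_fun do rewrite E.
  rewrite iintZl//.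
  over.
have m0 : measurable_fun setT (fun x : R => (\1_(P ord0) x)%:E : \bar R).
  by apply/measurable_EFinP; apply: measurable_indic; exact: mP.
rewrite ge0_integralZr//; try solve [exact: m0|by apply: iint_ge0 => x; rewrite lee_fin].
congr (_ * _)%E; rewrite (@integral_indic _ (measurableTypeR R) R leb setT measurableT (P ord0) (mP ord0)) setIT //.
Qed.

(** A notion of null set tied to iterated integration: it asks for measurability neither of the set
    nor of the functions that are changed on it, and it is flexible enough for boundaries of convex
    sets. *)
Fixpoint inull n : set 'rV[R]_n -> Prop :=
  match n return set 'rV[R]_n -> Prop with
  | 0 => fun N => ~ N 0
  | n'.+1 => fun N => exists2 F : set R, finite_set F &
      forall t, ~ F t -> inull (fun y : 'rV[R]_n' => N (row_mx (const_mx t : 'rV[R]_1) y))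
  end.

Lemma sub_inull n (N N' : set 'rV[R]_n) : N `<=` N' -> inull N' -> inull N.
Proof.
elim: n N N' => [N N' NN' /= h /NN'//|n IH N N' NN' [F fF FP]].
by exists F => // t /FP; apply: IH => y; exact: NN'.
Qed.

(** Since [g] may fail to be measurable, the exceptional set is removed from each simple function
    below [f]: this keeps its integral and puts it below [g]. *)
Lemma le_integral_off_finite (f g : R -> \bar R) (F : set R) : finite_set F ->
  (forall x, 0 <= f x)%E -> (forall x, 0 <= g x)%E -> (forall x, ~ F x -> f x = g x) ->
  (\int[leb]_x f x <= \int[leb]_x g x)%E.
Proof.
move=> fF f0 g0 fg; rewrite ge0_integralTE//; apply: ge_ereal_sup => _ [h hf <-].
rewrite -integralT_nnsfun.
have mF : @measurable _ (measurableTypeR R) F by apply: countable_measurable => //; exact: finite_set_countable.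
rewrite (@ge0_negligible_integral _ (measurableTypeR R) R leb setT F)//; last 3 first.
- exact/measurable_EFinP.
- by move=> x _; rewrite lee_fin.
- by apply: countable_lebesgue_measure0; exact: finite_set_countable.
rewrite integral_mkcond; apply: le_integralT => x; rewrite /patch; case: ifPn => //.
  by rewrite lee_fin.
by rewrite inE => -[_ Fx]; rewrite -fg//; exact: hf.
Qed.

Lemma iint_inull n (f g : 'rV[R]_n -> \bar R) (N : set 'rV[R]_n) : inull N ->
  (forall x, 0 <= f x)%E -> (forall x, 0 <= g x)%E ->
  (forall x, ~ N x -> f x = g x) -> iint f = iint g.
Proof.
elim: n f g N => [f g N /= N0 _ _|n IH f g N [F fF FP] f0 g0 fg] /=; first exact.
have E t : ~ F t -> iint (fun y : 'rV[R]_n => f (row_mx (const_mx t : 'rV[R]_1) y)) =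
     iint (fun y : 'rV[R]_n => g (row_mx (const_mx t : 'rV[R]_1) y)).
  by move=> /FP h; apply: IH h _ _ _ => // y; exact: fg.
apply/eqP; rewrite eq_le; apply/andP; split;
  apply: (le_integral_off_finite fF) => t; try exact: iint_ge0; first exact: E.
by move/E.
Qed.

Definition mxconvex n (K : set 'rV[R]_n) :=
  forall x y (t : R), K x -> K y -> 0 < t < 1 -> K (t *: x + (1 - t) *: y).

Lemma norm_row_mx_lt n (t : R) (y : 'rV[R]_n) (e : R) : 0 < e ->
  `|row_mx (const_mx t : 'rV[R]_1) y| < e <-> `|t| < e /\ `|y| < e.
Proof.
move=> e0; rewrite mx_norm_ltP//; split=> [h|[te /(mx_norm_ltP _ e0) ye] i j].
  split; last by apply/(mx_norm_ltP _ e0) => i j; have := h i (rshift 1 j); rewrite row_mxEr.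
  by have := h 0 (lshift n 0); rewrite row_mxEl mxE.
by rewrite mxE; case: splitP => k _; rewrite ?mxE.
Qed.

(** The convex hull of the point over [s] and of a ball in the slice over [t] contains a
    neighbourhood of the centre of the ball on the side of [s]. It is used once from each side. *)
Lemma convex_cone_nbhs n (K : set 'rV[R]_n.+1) (t s r : R) (y z : 'rV[R]_n) :
  mxconvex K -> s != t -> 0 < r ->
  K (row_mx (const_mx s : 'rV[R]_1) z) ->
  (forall w, `|w - y| < r -> K (row_mx (const_mx t : 'rV[R]_1) w)) ->
  exists2 e, 0 < e & forall t' y', `|t' - t| < e -> `|y' - y| < e ->
    0 <= (t' - t) * (s - t) -> K (row_mx (const_mx t' : 'rV[R]_1) y').
Proof.
move=> cK st r0 Ks Kw.
pose D := `|s - t|; have D0 : 0 < D by rewrite normr_gt0 subr_eq0.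
pose M := `|z - y|; have M0 : 0 <= M by exact: normr_ge0.
have c0 : 0 < 2 * (1 + M / D) by rewrite mulr_gt0// ltr_pwDl// divr_ge0// ltW.
(* The bound $D/2$ keeps the weight [l] of the apex below one half, so that $(1-l)^{-1}\le 2$; the
   other bound keeps the projected point [w] in the ball of radius [r]. *)
exists (Num.min (D / 2) (r / (2 * (1 + M / D)))).
  by rewrite lt_min !divr_gt0.
move=> t' y'; rewrite !lt_min => /andP[t1 t2] /andP[y1 y2] tt.
have [->|tt'] := eqVneq t' t.
  apply: Kw; rewrite (lt_le_trans y2)// ler_pdivrMr// ler_peMr ?ltW//.
  have : 0 <= M / D by rewrite divr_ge0// ltW.
  lra.
pose l := `|t' - t| / D.
have l0 : 0 < l by rewrite divr_gt0// normr_gt0 subr_eq0.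
have l2 : l < 2^-1 by rewrite ltr_pdivrMr// mulrC.
have lE : l * (s - t) = t' - t.
  rewrite /l /D; have st0 : s - t != 0 by rewrite subr_eq0.
  have [sp|sn|s0] := ltgtP (s - t) 0; last by rewrite s0 eqxx in st0.
    rewrite (ltr0_norm sp) ler0_norm; first by field.
    by move: tt; rewrite nmulr_lge0.
  rewrite (gtr0_norm sn) ger0_norm; first by field.
  by move: tt; rewrite pmulr_lge0.
have l1 : 1 - l != 0 by rewrite gt_eqF//; lra.
(* Projection of the given point from the apex onto the slice over [t]. *)
pose w := (1 - l)^-1 *: (y' - l *: z).
have -> : row_mx (const_mx t' : 'rV[R]_1) y' =
   l *: row_mx (const_mx s : 'rV[R]_1) z + (1 - l) *: row_mx (const_mx t : 'rV[R]_1) w.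
  rewrite !scale_row_mx add_row_mx; congr row_mx.
    by apply/rowP => i; rewrite !mxE; move: lE; lra.
  by rewrite /w scalerA mulfV// scale1r addrC subrK.
apply: cK => //; last by apply/andP; split=> //; lra.
apply: Kw.
have -> : w - y = (1 - l)^-1 *: ((y' - y) - l *: (z - y)).
  by rewrite /w; apply/rowP => i; rewrite !mxE; field.
rewrite normrZ.
have h1 : `|y' - y - l *: (z - y)| <= `|y' - y| + l * M.
  by rewrite (le_trans (ler_normB _ _))// normrZ (gtr0_norm l0).
have h2 : `|(1 - l)^-1| <= 2.
  rewrite gtr0_norm ?invr_gt0; last by lra.
  by rewrite invf_ple ?posrE; lra.
have h3 : `|y' - y| + l * M < r / 2.
  have -> : r / 2 = r / (2 * (1 + M / D)) + r / (2 * (1 + M / D)) * (M / D).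
    have DM : D + M != 0 by rewrite gt_eqF// ltr_pwDl.
    by field; rewrite ?DM ?(gt_eqF D0).
  apply: ltr_leD => //.
  have -> : l * M = `|t' - t| * (M / D) by rewrite /l; field; rewrite gt_eqF.
  by rewrite ler_wpM2r ?divr_ge0// ltW.
apply: (@le_lt_trans _ _ (2 * (`|y' - y| + l * M))).
  by apply: ler_pM => //; exact: h1.
by move: h3; rewrite ltr_pdivlMr// mulrC.
Qed.

Lemma nbhs_normP n (x : 'rV[R]_n) (A : set 'rV[R]_n) :
  nbhs x A <-> exists2 e : R, 0 < e & forall y, `|y - x| < e -> A y.
Proof.
split=> [/nbhs_ballP[e /= e0 h]|[e e0 h]]; last apply/nbhs_ballP; exists e => // y.
  by move=> yx; apply: h; rewrite -ball_normE /= distrC.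
by rewrite -ball_normE /= distrC => /h.
Qed.

(** The exceptional first coordinates are the endpoints of the projection of [K], at most two. Over
    any other [t] of the projection there are points of [K] on both sides, so two cones show that
    the interior of the slice lies in the interior of [K]; the boundary of the slice is handled by
    induction. *)
Lemma convex_boundary_inull n (K : set 'rV[R]_n) : mxconvex K -> inull (K `\` K°).
Proof.
elim: n K => [|n IH] K cK.
  move=> [K0 []]; apply/nbhs_normP; exists 1 => // y _.
  by rewrite (_ : y = 0)//; apply/rowP; case.
pose pi := [set t | exists y : 'rV[R]_n, K (row_mx (const_mx t : 'rV[R]_1) y)].
exists ([set t | pi t /\ forall s, pi s -> s <= t] `|` [set t | pi t /\ forall s, pi s -> t <= s]).
  rewrite finite_setU; split.
    have [[t [tp tm]]|h] := pselect (exists t, pi t /\ forall s, pi s -> s <= t).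
      apply: (sub_finite_set _ (finite_set1 t)) => s [sp sm] /=.
      by apply/eqP; rewrite eq_le tm//= sm.
    by apply: (sub_finite_set _ (finite_set0 _)) => s sp; apply: h; exists s.
  have [[t [tp tm]]|h] := pselect (exists t, pi t /\ forall s, pi s -> t <= s).
    apply: (sub_finite_set _ (finite_set1 t)) => s [sp sm] /=.
    by apply/eqP; rewrite eq_le tm//= sm.
  by apply: (sub_finite_set _ (finite_set0 _)) => s sp; apply: h; exists s.
move=> t /not_orP[t1 t2].
pose Kt := [set y : 'rV[R]_n | K (row_mx (const_mx t : 'rV[R]_1) y)].
have cKt : mxconvex Kt.
  move=> x y l Kx Ky l01; rewrite /Kt /=.
  have -> : row_mx (const_mx t : 'rV[R]_1) (l *: x + (1 - l) *: y) =
    l *: row_mx (const_mx t : 'rV[R]_1) x + (1 - l) *: row_mx (const_mx t : 'rV[R]_1) y.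
    rewrite !scale_row_mx add_row_mx; congr row_mx.
    by apply/rowP => i; rewrite !mxE; ring.
  exact: cK.
apply: (sub_inull _ (IH _ cKt)) => y [Ky nKy]; split=> // /nbhs_normP[r r0 Kr]; apply: nKy.
have pt : pi t by exists y.
have [s1 [z1 Kz1] s1t] : exists2 s, pi s & t < s.
  apply: contrapT => h; apply: t1; split=> // s ps.
  by rewrite leNgt; apply/negP => ts; apply: h; exists s.
have [s2 [z2 Kz2] s2t] : exists2 s, pi s & s < t.
  apply: contrapT => h; apply: t2; split=> // s ps.
  by rewrite leNgt; apply/negP => ts; apply: h; exists s.
have [e1 e10 h1] := convex_cone_nbhs cK (negbT (gt_eqF s1t)) r0 Kz1 Kr.
have [e2 e20 h2] := convex_cone_nbhs cK (negbT (lt_eqF s2t)) r0 Kz2 Kr.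
apply/nbhs_normP; exists (Num.min e1 e2); first by rewrite lt_min e10.
move=> x; rewrite -(@hsubmxK _ 1 1 n x).
have -> : lsubmx (x : 'rV[R]_(1 + n)) = const_mx (x 0 0).
  by apply/rowP => i; rewrite !mxE ord1; congr (x _ _); apply/val_inj.
rewrite row_mxB.
move/norm_row_mx_lt; rewrite lt_min e10 e20 => /(_ isT)[].
rewrite !lt_min => /andP[a1 a2] /andP[b1 b2].
have [xt|xt] := lerP 0 (x 0 0 - t).
  by apply: h1 => //; rewrite mulr_ge0// subr_ge0 ltW.
by apply: h2 => //; rewrite nmulr_rge0// subr_le0 ltW.
Qed.

End change_of_variables.

(** * Packing by cubes and nets *)

Section cubes.
Context {R : realType}.
Implicit Types (n : nat).

Definition ccube n (a : 'rV[R]_n) (h : R) : set 'rV[R]_n :=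
  [set x | forall j, a 0 j <= x 0 j <= a 0 j + h].
(** Half-open cubes tile a grid without overlap; the closed ones are compact, which the arguments
    with minimizers need. *)
Definition hcube n (a : 'rV[R]_n) (h : R) : set 'rV[R]_n :=
  [set x | forall j, a 0 j <= x 0 j < a 0 j + h].

Lemma ccubeE n (a : 'rV[R]_n) (h : R) :
  ccube a h = [set x | forall j, `[a 0 j, a 0 j + h]%classic (x 0 j)].
Proof. by apply/seteqP; split=> x Hx j; have := Hx j; rewrite /= in_itv. Qed.

Lemma hcubeE n (a : 'rV[R]_n) (h : R) :
  hcube a h = [set x | forall j, `[a 0 j, a 0 j + h[%classic (x 0 j)].
Proof. by apply/seteqP; split=> x Hx j; have := Hx j; rewrite /= in_itv. Qed.

Lemma measurable_coords n (A : 'I_n -> set R) : (forall j, measurable (A j)) ->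
  measurable [set x : 'rV[R]_n | forall j, A j (x 0 j)].
Proof.
move=> mA.
have -> : [set x : 'rV[R]_n | forall j, A j (x 0 j)] =
    ~` \bigcup_j ~` [set x : 'rV[R]_n | A j (x 0 j)].
  rewrite setC_bigcup; apply/seteqP; split=> x h j; first by move=> _; rewrite setCK; exact: h.
  by have := h j I; rewrite setCK.
apply: measurableC; apply: countable_bigcupT_measurable; first exact: countableP.
move=> j; apply: measurableC; rewrite -[X in measurable X]setTI.
have mc : measurable_fun setT (fun x : 'rV[R]_n => x 0 j).
  apply: (@measurable_fun_cont _ 1 n) => [|x _]; first exact: openT.
  exact: coord_continuous.
exact: mc.
Qed.

Lemma measurable_ccube n (a : 'rV[R]_n) (h : R) : measurable (ccube a h).
Proof.
rewrite ccubeE; apply: (@measurable_coords n (fun j => `[a 0 j, a 0 j + h]%classic)) => j.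
exact: measurable_itv.
Qed.

Lemma measurable_hcube n (a : 'rV[R]_n) (h : R) : measurable (hcube a h).
Proof.
rewrite hcubeE; apply: (@measurable_coords n (fun j => `[a 0 j, a 0 j + h[%classic)) => j.
exact: measurable_itv.
Qed.

Lemma prode_cst n (c : R) : (\prod_(j < n) c%:E)%E = (c ^+ n)%:E.
Proof.
elim: n => [|n IH]; first by rewrite big_ord0 expr0.
by rewrite big_ord_recl IH exprS EFinM.
Qed.

Lemma leb_ccube n (a : 'rV[R]_n) (h : R) : 0 <= h -> leb_mx (ccube a h) = (h ^+ n)%:E.
Proof.
move=> h0; rewrite ccubeE (leb_mx_prod (P := fun j => `[a 0 j, a 0 j + h]%classic)); last by move=> j; exact: measurable_itv.
rewrite -prode_cst; apply: eq_bigr => j _.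
rewrite lebesgue_measure_itv/= lte_fin; case: ifPn => [_|].
  by rewrite -EFinD addrAC subrr add0r.
by rewrite -leNgt gerDl => h1; congr EFin; apply/eqP; rewrite eq_le h0 h1.
Qed.

Lemma leb_hcube n (a : 'rV[R]_n) (h : R) : 0 <= h -> leb_mx (hcube a h) = (h ^+ n)%:E.
Proof.
move=> h0; rewrite hcubeE (leb_mx_prod (P := fun j => `[a 0 j, a 0 j + h[%classic)); last by move=> j; exact: measurable_itv.
rewrite -prode_cst; apply: eq_bigr => j _.
rewrite lebesgue_measure_itv/= lte_fin; case: ifPn => [_|].
  by rewrite -EFinD addrAC subrr add0r.
by rewrite -leNgt gerDl => h1; congr EFin; apply/eqP; rewrite eq_le h0 h1.
Qed.

Lemma compact_ccube n (a : 'rV[R]_n) (h : R) : compact (ccube a h).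
Proof.
rewrite ccubeE; apply: (@rV_compact R n (fun j => `[a 0 j, a 0 j + h]%classic)) => j.
exact: segment_compact.
Qed.

Lemma convex_ccube n (a : 'rV[R]_n) (h : R) : mxconvex (ccube a h).
Proof.
move=> x y t Hx Hy /andP[t0 t1] j; rewrite !mxE.
have /andP[x1 x2] := Hx j; have /andP[y1 y2] := Hy j.
by apply/andP; split; nra.
Qed.

Lemma sub_hcube_ccube n (a : 'rV[R]_n) (h : R) : hcube a h `<=` ccube a h.
Proof. by move=> x Hx j; have /andP[-> /ltW ->] := Hx j. Qed.

Lemma sub_ccube_hcube n (a : 'rV[R]_n) (h : R) h' : h < h' -> ccube a h `<=` hcube a h'.
Proof.
move=> hh x Hx j; have /andP[-> H] := Hx j.
by rewrite (le_lt_trans H)// ltrD2l.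
Qed.

Lemma ccube_corner n (a : 'rV[R]_n) (h : R) : 0 <= h -> ccube a h a.
Proof. by move=> h0 j; rewrite lexx lerDl. Qed.

Lemma ccube_dist n (a : 'rV[R]_n) (h : R) x y : 0 <= h -> ccube a h x -> ccube a h y -> `|x - y| <= h.
Proof.
move=> h0 Hx Hy; apply/(mx_norm_leP _ h0) => i j; rewrite (ord1 i) !mxE.
have /andP[x1 x2] := Hx j; have /andP[y1 y2] := Hy j.
by rewrite ler_norml; apply/andP; split; lra.
Qed.

Definition gridpt n (a : 'rV[R]_n) (h : R) N (k : 'rV['I_N]_n) : 'rV[R]_n :=
  \row_j (a 0 j + h * (k 0 j)%:R).
Arguments gridpt {n} a h {N} k.

Lemma grid_cover n (a : 'rV[R]_n) (h : R) N x : 0 < h -> hcube a (h * N%:R) x ->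
  exists k : 'rV['I_N]_n, hcube (gridpt a h k) h x.
Proof.
move=> h0 Hx.
have Hd j : 0 <= (x 0 j - a 0 j) / h.
  by apply: divr_ge0; [rewrite subr_ge0; have /andP[] := Hx j|exact: ltW].
have Hk j : (Num.trunc ((x 0%R j - a 0%R j) / h)%R < N)%N.
  by rewrite truncn_lt_nat// ltr_pdivrMr// mulrC ltrBlDl; have /andP[] := Hx j.
exists (\row_j Ordinal (Hk j)) => j; rewrite !mxE /=.
have /andP[] := truncn_itv (Hd j).
rewrite ler_pdivlMr// ltr_pdivrMr// => h1 h2; apply/andP; split; first by lra.
by move: h2; rewrite -natr1; lra.
Qed.

Lemma grid_disjoint n (a : 'rV[R]_n) (h : R) N (k k' : 'rV['I_N]_n) x : 0 < h ->
  hcube (gridpt a h k) h x -> hcube (gridpt a h k') h x -> k = k'.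
Proof.
move=> h0 H H'; apply/rowP => j; apply/val_inj => /=.
have := H j; have := H' j; rewrite !mxE => /andP[a1 a2] /andP[b1 b2].
have e1 : h * (k 0 j)%:R < h * ((k' 0 j)%:R + 1) by lra.
have e2 : h * (k' 0 j)%:R < h * ((k 0 j)%:R + 1) by lra.
move: e1 e2; rewrite !ltr_pM2l// !natr1 !ltr_nat !ltnS => e1 e2.
by apply/eqP; rewrite eqn_leq e1 e2.
Qed.

Lemma ler_mulrn (x : R) p q : 0 <= x -> (p <= q)%N -> x *+ p <= x *+ q.
Proof. by move=> x0 pq; rewrite -[x *+ p]mulr_natr -[x *+ q]mulr_natr ler_wpM2l// ler_nat. Qed.

Lemma bernoulli_sub (d : R) n : 0 <= d -> d <= 1 -> 1 - n%:R * d <= (1 - d) ^+ n.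
Proof.
move=> d0 d1; elim: n => [|n IH]; first by rewrite expr0 mul0r subr0.
rewrite exprS -natr1 mulrDl mul1r.
apply: (@le_trans _ _ ((1 - d) * (1 - n%:R * d))).
  have : 0 <= n%:R * d * d by rewrite !mulr_ge0.
  lra.
by rewrite ler_wpM2l// subr_ge0.
Qed.

Lemma integral_le_cover n (I : Type) (s : seq I) (A : I -> set 'rV[R]_n)
    (D : set 'rV[R]_n) (f : 'rV[R]_n -> \bar R) :
  measurable D -> (forall i, measurable (A i)) -> measurable_fun setT f ->
  (forall x, 0 <= f x)%E ->
  (forall x, D x -> exists2 i, List.In i s & A i x) ->
  (\int[@leb_mx R n]_(x in D) f x <= \sum_(i <- s) \int[@leb_mx R n]_(x in A i) f x)%E.
Proof.
move=> mD mA mf f0 cov.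
have mfr B : measurable B -> measurable_fun setT (f \_ B).
  by move=> mB; apply/(measurable_restrictT _ mB); exact: measurable_funTS.
have fr0 B x : (0 <= (f \_ B) x)%E by rewrite /patch; case: ifPn.
under [leRHS]eq_bigr do rewrite integral_mkcond.
rewrite integral_mkcond -ge0_integral_sum//; last by move=> i; exact: mfr.
apply: ge0_le_integral => //.
- exact: mfr.
- by apply: emeasurable_sum => i; exact: mfr.
move=> x _; rewrite [leLHS]/patch; case: ifPn => [|_]; last exact: sume_ge0.
rewrite inE => /cov[i + Aix]; elim: s {cov} => // j s IH [->|/IH{}IH].
  by rewrite big_cons /patch mem_set// leeDl//; apply: sume_ge0 => k _; exact: fr0.
by rewrite big_cons (le_trans IH)// leeDr.
Qed.

Lemma integral_ge_disjoint n (I : eqType) (s : seq I) (A : I -> set 'rV[R]_n)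
    (D : set 'rV[R]_n) (f : 'rV[R]_n -> \bar R) :
  uniq s -> measurable D -> (forall i, measurable (A i)) -> measurable_fun setT f ->
  (forall x, 0 <= f x)%E ->
  (forall i, i \in s -> A i `<=` D) ->
  (forall i j x, i \in s -> j \in s -> A i x -> A j x -> i = j) ->
  (\sum_(i <- s) \int[@leb_mx R n]_(x in A i) f x <= \int[@leb_mx R n]_(x in D) f x)%E.
Proof.
move=> us mD mA mf f0 AD tA.
have mfr B : measurable B -> measurable_fun setT (f \_ B).
  by move=> mB; apply/(measurable_restrictT _ mB); exact: measurable_funTS.
have fr0 B x : (0 <= (f \_ B) x)%E by rewrite /patch; case: ifPn.
under eq_bigr do rewrite integral_mkcond.
rewrite [leRHS]integral_mkcond -ge0_integral_sum//; last by move=> i; exact: mfr.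
apply: ge0_le_integral => //.
- by move=> x _; apply: sume_ge0 => k _; exact: fr0.
- by apply: emeasurable_sum => i; exact: mfr.
- exact: mfr.
move=> x _.
have [[i is_ Aix]|h] := pselect (exists2 i, i \in s & A i x); last first.
  rewrite big_seq big1// => i is_; rewrite /patch memNset// => Aix.
  by apply: h; exists i.
rewrite (bigD1_seq i)//= big_seq_cond big1 ?adde0.
  by rewrite /patch !mem_set//; exact: AD Aix.
move=> j /andP[js ji]; rewrite /patch memNset// => Ajx.
by move/eqP: ji; apply; exact: tA Ajx Aix.
Qed.

Definition mxbounded n (O : set 'rV[R]_n) := exists M : R, forall x, O x -> `|x| <= M.

Lemma mxbounded_hcube n (O : set 'rV[R]_n) : mxbounded O ->
  exists (a : 'rV[R]_n) (L : R), 0 < L /\ O `<=` hcube a L.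
Proof.
move=> [M HM]; exists (const_mx (- (`|M| + 1))), (2 * (`|M| + 1)).
have M0 := normr_ge0 M; split=> [|x Ox j]; first by lra.
have h : `|x 0 j| <= `|M|.
  by rewrite (le_trans (coord_le_norm _ _ _))// (le_trans (HM _ Ox))// ler_norm.
rewrite !mxE; move: h; rewrite ler_norml => /andP[h1 h2].
by apply/andP; split; lra.
Qed.

Lemma leb_mx_fin n (O : set 'rV[R]_n) : measurable O -> mxbounded O ->
  (leb_mx O < +oo)%E.
Proof.
move=> mO /mxbounded_hcube[a [L [L0 OL]]].
apply: (@le_lt_trans _ _ (leb_mx (hcube a L))).
  by apply: le_measure => //; rewrite inE//; exact: measurable_hcube.
by rewrite leb_hcube ?ltW// ltry.
Qed.

(** A fine grid suffices. Any point of [O] lies in a cell that is inside [O] and satisfies [G] once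
    the mesh is small, so by dominated convergence the uncovered measure tends to 0. The cells are
    then shrunk slightly, which makes the closed cubes disjoint; all of them keep the same side. *)
Lemma cube_packing n (O : set 'rV[R]_n) (G : 'rV[R]_n -> R -> Prop) :
  open O -> mxbounded O ->
  (forall x, O x -> exists2 rho : R, 0 < rho & forall a (h : R), 0 < h ->
     (forall y, ccube a h y -> `|y - x| < rho) -> G a h) ->
  forall eta : R, 0 < eta ->
  exists (s : seq 'rV[R]_n) (h : R), [/\ 0 < h, uniq s,
    forall a, a \in s -> ccube a h `<=` O /\ G a h,
    forall a b x, a \in s -> b \in s -> ccube a h x -> ccube b h x -> a = b &
    (leb_mx (O `\` [set x | exists2 a, a \in s & ccube a h x]) <= eta%:E)%E].
Proof.
move=> oO bO HG eta eta0.
have [a0 [L [L0 OL]]] := mxbounded_hcube bO.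
pose hN N : R := L / N.+1%:R.
have hN0 N : 0 < hN N by rewrite divr_gt0.
(* [G] is required at every shrinking ratio [th], because the ratio is fixed only after the mesh. *)
pose good N (k : 'rV['I_N.+1]_n) := ccube (gridpt a0 (hN N) k) (hN N) `<=` O /\
  forall th, 0 < th -> th < 1 -> G (gridpt a0 (hN N) k) (th * hN N).
pose ON N := [set x | exists2 k : 'rV['I_N.+1]_n, good N k & hcube (gridpt a0 (hN N) k) (hN N) x].
have mO : measurable O by exact: open_measurable_mx.
have mON N : measurable (ON N).
  have -> : ON N = \bigcup_(k in good N) hcube (gridpt a0 (hN N) k) (hN N).
    by apply/seteqP; split=> x [k gk Hk]; exists k.
  apply: fin_bigcup_measurable => [|k _]; last exact: measurable_hcube.
  exact: finite_finset.
have ONx x : O x -> \forall N \near \oo, ON N x.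
  move=> Ox.
  have [rho rho0 Hr] := HG x Ox.
  have /nbhs_normP[e e0 He] : nbhs x O by exact: open_nbhs_nbhs.
  have m0 : 0 < Num.min rho e / L by rewrite divr_gt0// lt_min rho0.
  have := @near_infty_natSinv_lt R (PosNum m0); apply: filterS => N /= HN.
  have hm : hN N < Num.min rho e.
    by rewrite /hN mulrC -ltr_pdivlMr.
  have [k Hk] : exists k : 'rV['I_N.+1]_n, hcube (gridpt a0 (hN N) k) (hN N) x.
    apply: grid_cover => //; rewrite (_ : _ * _ = L); first exact: OL.
    by rewrite /hN mulfVK.
  exists k => //.
  have Hd y : ccube (gridpt a0 (hN N) k) (hN N) y -> `|y - x| < Num.min rho e.
    move=> Hy; apply: le_lt_trans hm; apply: ccube_dist Hy _; first exact: ltW.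
    exact: sub_hcube_ccube.
  split=> [y /Hd|th th0 th1].
    by rewrite lt_min => /andP[_]; exact: He.
  apply: Hr => [|y Hy]; first by rewrite mulr_gt0.
  have /Hd : ccube (gridpt a0 (hN N) k) (hN N) y.
    move=> j; have /andP[-> H] := Hy j; rewrite (le_trans H)// lerD2l.
    by rewrite ler_piMl// ltW.
  by rewrite lt_min => /andP[].
have Hlim : leb_mx (O `\` ON N) @[N --> \oo] --> (0 : \bar R).
  have mD N : measurable (O `\` ON N) by exact: measurableD.
  have := @dominated_convergence _ _ R (@leb_mx R n) O mO
     (fun N x => (\1_(O `\` ON N) x)%:E) (cst 0%E) (cst 1%E).
  case.
  - by move=> N; apply: measurable_funTS; exact: measurable_EFin_indic.
  - exact: measurable_cst.
  - apply: aeW => x Ox; apply: cvg_near_cst.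
    have := ONx x Ox; apply: filterS => N HN.
    by rewrite indicE memNset//= => -[].
  - apply/integrableP; split; first exact: measurable_cst.
    under eq_integral do rewrite abse1.
    by rewrite integral_cst//= mul1e; exact: leb_mx_fin.
  - apply: aeW => x N Ox; rewrite /= ger0_norm// lee_fin indicE.
    by case: (_ \in _); rewrite ?ler01.
  move=> _ _; rewrite integral0; apply: cvg_trans; apply: near_eq_cvg.
  apply: nearW => N /=; rewrite integral_indic// setIC setIidr//.
have e2 : (0 < (eta / 2)%:E)%E by rewrite lte_fin divr_gt0.
have [N HN] : exists N, (leb_mx (O `\` ON N) < (eta / 2)%:E)%E.
  have : \forall N \near \oo, (leb_mx (O `\` ON N) < (eta / 2)%:E)%E.
    have nb : nbhs (0 : \bar R) [set z | (z < (eta / 2)%:E)%E].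
      by apply: open_nbhs_nbhs; split; [exact: open_ereal_lt_ereal|exact: e2].
    exact: (Hlim _ nb).
  by case=> N _ /(_ N (leqnn N)) HN; exists N.
(* By the Bernoulli inequality, shrinking by the factor $1-d$ loses at most $ndL^n$ of the total
   volume $L^n$, which this choice makes at most $\eta/2$. *)
pose d := Num.min (1 / 2) (eta / (2 * (n%:R + 1) * L ^+ n)).
have n10 : 0 < n%:R + 1 :> R by rewrite ltr_wpDl.
have dd : 0 < 2 * (n%:R + 1) * L ^+ n.
  by apply: mulr_gt0; [apply: mulr_gt0|exact: exprn_gt0].
have d0 : 0 < d by rewrite lt_min (divr_gt0 eta0 dd) andbT; lra.
have d12 : d <= 1 / 2 by rewrite ge_min lexx.
have d1 : d <= 1 by lra.
pose th := 1 - d.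
have th0 : 0 < th by rewrite /th; lra.
have th1 : th < 1 by rewrite /th; lra.
pose h := th * hN N.
have h0 : 0 < h by rewrite mulr_gt0.
have hh : h < hN N by rewrite /h gtr_pMl.
pose sk := [seq k <- enum {: 'rV['I_N.+1]_n} | `[< good N k >]].
have inj : injective (gridpt a0 (hN N) : 'rV['I_N.+1]_n -> _).
  move=> k k' kk; apply: (@grid_disjoint n a0 (hN N) _ k k' (gridpt a0 (hN N) k)) => //.
    by move=> j; rewrite lexx ltrDl hN0.
  by rewrite kk => j; rewrite lexx ltrDl hN0.
have skP k : k \in sk -> good N k by rewrite mem_filter => /andP[/asboolP].
exists (map (gridpt a0 (hN N)) sk), h; split => //.
- by rewrite map_inj_uniq// filter_uniq// enum_uniq.
- move=> _ /mapP[k /skP[kO kG] ->]; split; last exact: kG.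
  by move=> x /(sub_ccube_hcube hh)/sub_hcube_ccube; exact: kO.
- move=> _ _ x /mapP[k _ ->] /mapP[k' _ ->] /(sub_ccube_hcube hh) H1 /(sub_ccube_hcube hh) H2.
  by congr gridpt; exact: grid_disjoint H1 H2.
set U := [set x | _].
have mQ (k : 'rV['I_N.+1]_n) : measurable (hcube (gridpt a0 (hN N) k) (hN N) `\` ccube (gridpt a0 (hN N) k) h).
  by apply: measurableD; [exact: measurable_hcube|exact: measurable_ccube].
have mV : measurable (\big[setU/set0]_(k <- sk)
    (hcube (gridpt a0 (hN N) k) (hN N) `\` ccube (gridpt a0 (hN N) k) h)).
  by apply: bigsetU_measurable.
have mU : measurable U.
  have -> : U = \big[setU/set0]_(k <- sk) ccube (gridpt a0 (hN N) k) h.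
    rewrite -bigcup_seq; apply/seteqP; split=> x.
      by move=> [_ /mapP[k ks ->] Hx]; exists k.
    by move=> [k ks Hx]; exists (gridpt a0 (hN N) k) => //; exact: map_f.
  by apply: bigsetU_measurable => k _; exact: measurable_ccube.
apply: (@le_trans _ _ (leb_mx ((O `\` ON N) `|` \big[setU/set0]_(k <- sk)
    (hcube (gridpt a0 (hN N) k) (hN N) `\` ccube (gridpt a0 (hN N) k) h)))).
  apply: le_measure; rewrite ?inE.
  - by apply: measurableD.
  - by apply: measurableU => //; exact: measurableD.
  move=> x [Ox nUx]; have [[k gk Hk]|nON] := pselect (ON N x); last by left.
  have ks : k \in sk by rewrite mem_filter mem_enum andbT; apply/asboolP.
  right; rewrite -bigcup_seq; exists k => //; split=> // Hc; apply: nUx.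
  by exists (gridpt a0 (hN N) k) => //; exact: map_f.
apply: (le_trans (measureU2 _ _ _)) => //; first exact: measurableD.
rewrite (splitr eta) EFinD; apply: leeD; first exact: ltW.
have sub : (leb_mx (\big[setU/set0]_(k <- sk)
    (hcube (gridpt a0 (hN N) k) (hN N) `\` ccube (gridpt a0 (hN N) k) h)) <=
  \sum_(k <- sk) leb_mx (hcube (gridpt a0 (hN N) k) (hN N) `\` ccube (gridpt a0 (hN N) k) h))%E.
  elim: sk {mV mU skP U} => [|k s IH]; first by rewrite !big_nil measure0.
  rewrite !big_cons (le_trans (measureU2 _ _ _))//.
    by apply: bigsetU_measurable.
  exact: leeD2l.
apply: (le_trans sub).
have dE (k : 'rV['I_N.+1]_n) : leb_mx (hcube (gridpt a0 (hN N) k) (hN N) `\` ccube (gridpt a0 (hN N) k) h)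
    = (hN N ^+ n - h ^+ n)%:E.
  rewrite measureD//=; last 3 first.
  - exact: measurable_hcube.
  - exact: measurable_ccube.
  - by rewrite leb_hcube ?ltW// ltry.
  rewrite setIidr; last exact: sub_ccube_hcube.
  by rewrite leb_hcube ?ltW// leb_ccube ?ltW.
under eq_bigr do rewrite dE.
rewrite sumEFin lee_fin big_const_seq iter_addr_0 count_predT.
have sz : (size sk <= N.+1 ^ n)%N.
  rewrite size_filter (leq_trans (count_size _ _))// -cardE card_mx card_ord mul1n.
  by [].
have hd0 : 0 <= hN N ^+ n - h ^+ n.
  by rewrite subr_ge0; apply: lerXn2r; rewrite ?nnegrE; exact: ltW.
apply: (@le_trans _ _ ((hN N ^+ n - h ^+ n) *+ (N.+1 ^ n))).
  exact: ler_mulrn.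
rewrite -mulr_natr natrX mulrBl -!exprMn.
have -> : hN N * N.+1%:R = L by rewrite /hN mulfVK.
have -> : h * N.+1%:R = th * L by rewrite /h -mulrA /hN mulfVK.
rewrite exprMn -{1}[L ^+ n]mul1r -mulrBl.
have bern := bernoulli_sub n (ltW d0) d1.
have Ln0 : 0 <= L ^+ n by exact: exprn_ge0 (ltW L0).
have d0' := ltW d0.
apply: (@le_trans _ _ (n%:R * d * L ^+ n)).
  by rewrite ler_wpM2r// /th; lra.
apply: (@le_trans _ _ ((n%:R + 1) * (eta / (2 * (n%:R + 1) * L ^+ n)) * L ^+ n)).
  rewrite ler_wpM2r// ler_pM//.
    by rewrite lerDl.
  by rewrite ge_min lexx orbT.
rewrite le_eqVlt; apply/orP; left; apply/eqP; field.
by rewrite expf_neq0 ?(gt_eqF n10) ?(gt_eqF L0).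
Qed.

Lemma mem_In (T : eqType) (x : T) (s : seq T) : x \in s -> List.In x s.
Proof.
by elim: s => // y s IH; rewrite inE => /orP[/eqP->|/IH]; [left|right].
Qed.

Lemma lift_sig_seq (T : eqType) (P : T -> Prop) (s : seq T) : (forall z, z \in s -> P z) ->
  exists s' : seq {x | P x}, map sval s' = s.
Proof.
elim: s => [_|z t IH Hz]; first by exists [::].
have [y yt|t' t'E] := IH; first by apply: Hz; rewrite inE yt orbT.
by exists (exist _ z (Hz z (mem_head _ _)) :: t'); rewrite /= t'E.
Qed.

Lemma In_pmap (T U : Type) (f : T -> option U) (x : T) (y : U) (s : seq T) :
  List.In x s -> f x = Some y -> List.In y (pmap f s).
Proof.
elim: s => //= z s IH [->|/IH{}IH] fx; first by rewrite fx; left.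
by case: (f z) => [w|] /=; [right|]; exact: IH.
Qed.

(** The net is taken inside the image: one chosen preimage for each cell of a grid that meets the
    range of [Phi]. The elements of [X] may thus carry constraints, such as lying in a given set. *)
Lemma net_lemma n (X : Type) (Phi : X -> 'rV[R]_n) : (0 < n)%N ->
  mxbounded (range Phi) ->
  exists2 C : R, 0 <= C & forall k : nat, (0 < k)%N -> exists2 s : seq X, (size s <= k)%N &
   forall x, exists2 x', List.In x' s & `|Phi x - Phi x'| <= C * k%:R `^ (- n%:R^-1).
Proof.
move=> n0 /mxbounded_hcube[a [L [L0 HL]]].
(* With $N=\lfloor k^{1/n}\rfloor$ cells per side one has $N\ge k^{1/n}/2$, whence the factor 2 in
   the mesh bound $L/N\le 2Lk^{-1/n}$. *)
exists (2 * L); first by rewrite mulr_ge0// ltW.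
move=> k k0.
have n0' : 0 < n%:R :> R by rewrite ltr0n.
pose kr : R := k%:R `^ n%:R^-1.
have kr1 : 1 <= kr.
  have -> : 1 = 1 `^ n%:R^-1 :> R by rewrite powR1.
  by apply: ge0_ler_powR; rewrite ?nnegrE ?invr_ge0 ?ler1n// ltW.
have kr0 : 0 <= kr by lra.
pose N := Num.trunc kr.
have N0 : (0 < N)%N by rewrite truncn_gt0.
have Nk : (N ^ n <= k)%N.
  rewrite -(ler_nat R) natrX.
  have Nkr : N%:R <= kr by rewrite truncn_le.
  apply: (@le_trans _ _ (kr ^+ n)); first by apply: lerXn2r; rewrite ?nnegrE.
  rewrite -powR_mulrn// /kr -powRrM mulVf ?powRr1//.
  by rewrite gt_eqF.
pose h := L / N%:R.
have N0' : 0 < N%:R :> R by rewrite ltr0n.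
have h0 : 0 < h by rewrite divr_gt0.
have hL : h * N%:R = L by rewrite /h mulfVK// gt_eqF.
pose ch (c : 'rV['I_N]_n) : option X :=
  if pselect (exists x, hcube (gridpt a h c) h (Phi x)) is left H then Some (projT1 (cid H)) else None.
exists (pmap ch (enum {: 'rV['I_N]_n})).
  rewrite size_pmap (leq_trans (count_size _ _))// -cardE card_mx card_ord mul1n.
  exact: Nk.
move=> x.
have [c Hc] : exists c : 'rV['I_N]_n, hcube (gridpt a h c) h (Phi x).
  by apply: grid_cover => //; rewrite hL; apply: HL; exists x.
have [x' chx' Hx'] : exists2 x', ch c = Some x' & hcube (gridpt a h c) h (Phi x').
  rewrite /ch; case: pselect => [H|H]; last by exfalso; apply: H; exists x.
  by exists (projT1 (cid H)) => //; exact: projT2 (cid H).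
exists x'; first by apply: In_pmap chx'; apply: mem_In; rewrite mem_enum.
apply: (@le_trans _ _ h).
  by apply: (@ccube_dist _ (gridpt a h c)); [exact: ltW|exact: sub_hcube_ccube|exact: sub_hcube_ccube].
have := truncnS_gt kr; rewrite -/N -natr1 => h1.
have N1 : 1 <= N%:R :> R by rewrite ler1n.
have hh : N%:R^-1 <= 2 / kr.
  by rewrite ler_pdivlMr; [rewrite mulrC ler_pdivrMr//; lra|lra].
by rewrite powRN -/kr /h -[leRHS]mulrA [leRHS]mulrCA ler_wpM2l// ltW.
Qed.

End cubes.

(** * The abstract allocation theorem *)

Section real_inequalities.
Context {R : realType}.
Implicit Types (x y r : R).

Lemma powRK_inv r x : 0 < r -> 0 <= x -> (x `^ r) `^ r^-1 = x.
Proof. by move=> r0 x0; rewrite -powRrM mulfV ?gt_eqF// powRr1. Qed.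

Lemma powRK_inv' r x : 0 < r -> 0 <= x -> (x `^ r^-1) `^ r = x.
Proof. by move=> r0 x0; rewrite -powRrM mulVf ?gt_eqF// powRr1. Qed.

Lemma powR_subadditive (s : R) x y : 0 < s -> s <= 1 -> 0 <= x -> 0 <= y ->
  (x + y) `^ s <= x `^ s + y `^ s :> R.
Proof.
move=> s0 s1 x0 y0.
have [xy0|xy0] := eqVneq (x + y) 0.
  by rewrite xy0 powR0 ?gt_eqF// addr_ge0// powR_ge0.
have xyp : 0 < x + y by rewrite lt_neqAle eq_sym xy0 addr_ge0.
have h (z : R) : 0 <= z -> z <= x + y -> z / (x + y) * (x + y) `^ s <= z `^ s.
  move=> z0 zxy; have [->|zn0] := eqVneq z 0; first by rewrite !mul0r powR_ge0.
  have zp : 0 < z by rewrite lt_neqAle eq_sym zn0.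
  have -> : z `^ s = (z / (x + y)) `^ s * (x + y) `^ s.
    rewrite -powRM ?mulfVK ?gt_eqF// ?divr_ge0// ltW//.
  rewrite ler_wpM2r ?powR_ge0//.
  have q0 : 0 < z / (x + y) by rewrite divr_gt0.
  have q1 : z / (x + y) <= 1 by rewrite ler_pdivrMr// mul1r.
  rewrite -[leLHS](powRr1 (ltW q0)).
  by apply: ger_powR => //; rewrite q0 q1.
have hx := h x x0 (ltac:(by rewrite lerDl)).
have hy := h y y0 (ltac:(by rewrite lerDr)).
apply: le_trans (lerD hx hy).
by rewrite -mulrDl -mulrDl mulfV// mul1r.
Qed.

(** The convex function $x^{1+r}$ lies above its tangent at [l]. This is Young's inequality for the
    exponents $1+r$ and $(1+r)/r$, applied to [x] and $l^r$. *)
Lemma tangent_powR r x l : 0 < r -> 0 <= x -> 0 <= l ->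
  (1 + r) * l `^ r * x <= x `^ (1 + r) + r * l `^ (1 + r).
Proof.
move=> r0 x0 l0.
have r1 : 0 < 1 + r by lra.
have q0 : 0 < (1 + r) / r by rewrite divr_gt0.
have pq : (1 + r)^-1 + ((1 + r) / r)^-1 = 1.
  by field; rewrite !gt_eqF.
have := conjugate_powR x0 (powR_ge0 l r) r1 q0 pq.
rewrite -powRrM (_ : r * ((1 + r) / r) = 1 + r); last by field; rewrite gt_eqF.
move=> H.
have := ler_wpM2l (ltW r1) H.
rewrite (_ : (1 + r) * (x * l `^ r) = (1 + r) * l `^ r * x); last by ring.
move=> /le_trans; apply; rewrite le_eqVlt; apply/orP; left; apply/eqP.
by field; rewrite !gt_eqF.
Qed.

(** Radon's form of Hölder's inequality. It expresses that a budget $\sum t_i$ is best distributed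
    proportionally to the $d_i$. *)
Lemma radon (I : Type) (s : seq I) (d t : I -> R) r : 0 < r ->
  (forall i, 0 <= d i) -> (forall i, 0 < t i) ->
  (\sum_(i <- s) d i) `^ (1 + r) * (\sum_(i <- s) t i) `^ (- r) <=
  \sum_(i <- s) (d i) `^ (1 + r) * (t i) `^ (- r).
Proof.
move=> r0 d0 t0.
have r1 : 0 < 1 + r by lra.
set A := \sum_(i <- s) d i; set T := \sum_(i <- s) t i.
have A0 : 0 <= A by apply: sumr_ge0.
have rhs0 : 0 <= \sum_(i <- s) (d i) `^ (1 + r) * (t i) `^ (- r).
  by apply: sumr_ge0 => i _; rewrite mulr_ge0// powR_ge0.
have [T0|T0] := eqVneq T 0.
  have -> : A = 0; last by rewrite powR0 ?gt_eqF// mul0r.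
  rewrite /A; move: T0; rewrite /T; case: (s) => [|i s']; first by rewrite !big_nil.
  rewrite big_cons => /eqP; rewrite gt_eqF// ltr_pwDl//; apply: sumr_ge0 => j _; exact: ltW.
have Tp : 0 < T by rewrite lt_neqAle eq_sym T0; apply: sumr_ge0 => i _; exact: ltW.
(* The common ratio at which equality holds; the tangent inequality is used at [l] for every
   term. *)
pose l := A / T.
have l0 : 0 <= l by rewrite divr_ge0// ltW.
have term i : (1 + r) * l `^ r * d i - r * l `^ (1 + r) * t i <= (d i) `^ (1 + r) * (t i) `^ (- r).
  have := @tangent_powR r (d i / t i) l r0 (divr_ge0 (d0 i) (ltW (t0 i))) l0.
  move=> /(ler_wpM2r (ltW (t0 i))).
  rewrite [(_ + _) * t i]mulrDl -[_ * (d i / t i) * t i]mulrA divfK ?gt_eqF//.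
  have -> : (d i / t i) `^ (1 + r) * t i = d i `^ (1 + r) * t i `^ (- r).
    rewrite powRM ?invr_ge0 ?(ltW (t0 i))// -mulrA; congr (_ * _).
    rewrite -powR_inv1 ?(ltW (t0 i))// -powRrM.
    rewrite -[X in _ * X]powRr1 ?(ltW (t0 i))// -powRD; last by rewrite (gt_eqF (t0 i)) implybT.
    by congr powR; ring.
  lra.
apply: (@le_trans _ _ (\sum_(i <- s) ((1 + r) * l `^ r * d i - r * l `^ (1 + r) * t i))); last first.
  by apply: ler_sum => i _.
rewrite sumrB -!mulr_sumr -/A -/T.
have E1 : l `^ r * A = A `^ (1 + r) * T `^ (- r).
  rewrite /l powRM ?invr_ge0 ?(ltW Tp)// -powR_inv1 ?(ltW Tp)// -powRrM mulN1r mulrAC; congr (_ * _).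
  have [->|An0] := eqVneq A 0; first by rewrite mulr0 powR0// gt_eqF.
  rewrite -[X in _ * X]powRr1// -powRD; last by rewrite An0 implybT.
  by rewrite addrC.
have E2 : l `^ (1 + r) * T = A `^ (1 + r) * T `^ (- r).
  rewrite -E1 powRD; last by rewrite gt_eqF.
  rewrite powRr1// mulrAC mulrC; congr (_ * _); rewrite /l divfK//.
rewrite -[(1 + r) * _ * A]mulrA E1 -[r * _ * T]mulrA E2 le_eqVlt; apply/orP; left; apply/eqP.
by ring.
Qed.

Lemma le_powR (a b r : R) : 0 <= r -> 0 <= a -> a <= b -> a `^ r <= b `^ r.
Proof.
by move=> r0 a0 ab; apply: ge0_ler_powR => //; rewrite nnegrE// (le_trans a0).
Qed.

Lemma lt_powR (a b r : R) : 0 < r -> 0 <= a -> a < b -> a `^ r < b `^ r.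
Proof.
move=> r0 a0 ab; apply: gt0_ltr_powR => //; rewrite nnegrE//.
exact: le_trans a0 (ltW ab).
Qed.

Lemma le_powRN (a b r : R) : 0 < a -> a <= b -> 0 <= r -> b `^ (- r) <= a `^ (- r).
Proof.
move=> a0 ab r0; have b0 := lt_le_trans a0 ab.
rewrite !powRN lef_pV2 ?posrE ?powR_gt0//.
exact: le_powR (ltW a0) ab.
Qed.

End real_inequalities.

Section eventually.
Context {R : realType}.

Lemma near_ooP (Q : nat -> Prop) : (exists m0, forall m, (m0 <= m)%N -> Q m) <->
  \forall m \near \oo, Q m.
Proof. by split=> [[m0 H]|[m0 _ H]]; exists m0. Qed.

Lemma eventually_seq (I : eqType) (s : seq I) (Q : I -> nat -> Prop) :
  (forall i, i \in s -> \forall m \near \oo, Q i m) ->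
  \forall m \near \oo, forall i, i \in s -> Q i m.
Proof.
elim: s => [_|i s IH H]; first by apply: nearW => m j.
have H1 : \forall m \near \oo, Q i m by apply: H; rewrite mem_head.
have H2 : \forall m \near \oo, forall j, j \in s -> Q j m.
  by apply: IH => j js; apply: H; rewrite inE js orbT.
apply: filterS2 H1 H2 => m h1 h2 j; rewrite inE => /orP[/eqP->//|]; exact: h2.
Qed.

Lemma near_natr_ge (B : R) : \forall m \near \oo, B <= (m%:R : R).
Proof.
apply/near_ooP; exists (Num.trunc `|B|).+1 => m hm.
apply: (le_trans (ler_norm B)); apply/ltW; apply: (lt_le_trans (truncnS_gt _)).
by rewrite ler_nat.
Qed.

Lemma cvg_ereal_squeeze (f : nat -> \bar R) (l : R) :
  (forall eps : R, 0 < eps -> \forall m \near \oo, ((l - eps)%:E <= f m)%E) ->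
  (forall eps : R, 0 < eps -> \forall m \near \oo, (f m <= (l + eps)%:E)%E) ->
  f m @[m --> \oo] --> l%:E.
Proof.
move=> H1 H2; apply/fine_cvgP; split.
  apply: filterS2 (H1 1 ltr01) (H2 1 ltr01) => m h1 h2.
  rewrite fin_numE; apply/andP; split.
    by apply/eqP => E; move: h1; rewrite E leeNy_eq.
  by apply/eqP => E; move: h2; rewrite E leye_eq.
apply/cvgrPdist_le => eps eps0.
apply: filterS2 (H1 eps eps0) (H2 eps eps0) => m /=.
case: (f m) => [z| |] //=; rewrite ?lee_fin.
- by move=> h1 h2; rewrite ler_norml; apply/andP; split; lra.
Qed.

Lemma exists_small_seq (I : eqType) (s : seq I) (Q : I -> R -> Prop) :
  (forall i t t', Q i t -> 0 < t' -> t' <= t -> Q i t') ->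
  (forall i, i \in s -> exists2 t, 0 < t & Q i t) ->
  exists2 t, 0 < t & forall i, i \in s -> Q i t.
Proof.
move=> mQ; elim: s => [_|i s IH H]; first by exists 1.
have [t t0 Qt] : exists2 t, 0 < t & Q i t by apply: H; rewrite mem_head.
have [t' t'0 Qt'] : exists2 t, 0 < t & forall j, j \in s -> Q j t.
  by apply: IH => j js; apply: H; rewrite inE js orbT.
exists (Num.min t t'); first by rewrite lt_min t0.
move=> j; rewrite inE => /orP[/eqP->|js].
  by apply: mQ Qt _ _; [rewrite lt_min t0|rewrite ge_min lexx].
by apply: mQ (Qt' j js) _ _; [rewrite lt_min t0|rewrite ge_min lexx orbT].
Qed.

End eventually.

Section err.
Context {R : realType} {n : nat} {P : Type} (e : P -> 'rV[R]_n -> R).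

(** Lists rather than sets, with value [+oo] on the empty list: concatenation then takes the
    minimum, and repetitions cost only length. *)
Definition err (s : seq P) (x : 'rV[R]_n) : \bar R := \big[mine/+oo%E]_(q <- s) (e q x)%:E.

Lemma err_nil x : err [::] x = +oo%E.
Proof. by rewrite /err big_nil. Qed.

Lemma err_cons q s x : err (q :: s) x = mine (e q x)%:E (err s x).
Proof. by rewrite /err big_cons. Qed.

Lemma err_catl s t x : (err (s ++ t) x <= err s x)%E.
Proof.
elim: s => [|q s IH]; first by rewrite err_nil leey.
by rewrite cat_cons !err_cons le_min !ge_min lexx IH orbT.
Qed.

Lemma err_catr s t x : (err (s ++ t) x <= err t x)%E.
Proof.
elim: s => [|q s IH] //=.
by rewrite err_cons ge_min IH orbT.
Qed.

Lemma err_flatten (I : eqType) (s : seq I) (t : I -> seq P) i x : i \in s ->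
  (err (flatten [seq t j | j <- s]) x <= err (t i) x)%E.
Proof.
elim: s => //= j s IH; rewrite inE => /orP[/eqP->|/IH h]; first exact: err_catl.
exact: le_trans (err_catr _ _ _) h.
Qed.

Lemma err_le_In s x q : List.In q s -> (err s x <= (e q x)%:E)%E.
Proof.
elim: s => //= q' s IH [->|/IH h]; rewrite err_cons ge_min ?lexx//.
by rewrite h orbT.
Qed.

Lemma le_err s x c : (forall q, List.In q s -> (c <= (e q x)%:E)%E) -> (c <= err s x)%E.
Proof.
elim: s => [_|q s IH H]; first by rewrite err_nil leey.
by rewrite err_cons le_min H/=; [apply: IH => q' h; apply: H; right|left].
Qed.

(** Discarded pieces have error at least [tau] at [x], and [t] already does as well as [tau]
    there. *)
Lemma err_filter (p : pred P) (tau : R) s t x :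
  (forall q, ~~ p q -> tau <= e q x) -> (err t x <= tau%:E)%E ->
  (err ([seq q <- s | p q] ++ t) x <= err s x)%E.
Proof.
move=> Hp Ht; elim: s => [|q s IH]; first by rewrite err_nil leey.
rewrite err_cons le_min; apply/andP; split; last first.
  by rewrite /=; case: ifPn => // _; rewrite cat_cons err_cons ge_min IH orbT.
rewrite /=; case: ifPn => [_|nq]; first by rewrite cat_cons err_cons ge_min lexx.
by rewrite (le_trans (err_catr _ _ _))// (le_trans Ht)// lee_fin Hp.
Qed.

Hypothesis e0 : forall q x, 0 <= e q x.
Hypothesis me : forall q, measurable_fun setT (e q).

Lemma err_ge0 s x : (0 <= err s x)%E.
Proof. by apply: le_err => q _; rewrite lee_fin. Qed.

Lemma measurable_err s : measurable_fun setT (err s).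
Proof.
elim: s => [|q s IH].
  rewrite (_ : err [::] = cst +oo%E); first exact: measurable_cst.
  by apply/funext => x; rewrite err_nil.
rewrite (_ : err (q :: s) = (fun x => mine (e q x)%:E (err s x))).
  by apply: measurable_mine => //; apply/measurable_EFinP.
by apply/funext => x; rewrite err_cons.
Qed.

End err.

Section integral_bounds.
Context {R : realType} {n : nat}.
Local Notation mu := (@leb_mx R n).

Lemma integral_le_cst (D : set 'rV[R]_n) (f : 'rV[R]_n -> \bar R) (c : R) :
  measurable D -> measurable_fun setT f -> (forall x, 0 <= f x)%E ->
  (forall x, D x -> f x <= c%:E)%E ->
  (\int[mu]_(x in D) f x <= c%:E * mu D)%E.
Proof.
move=> mD mf f0 fc; rewrite -integral_cst//; apply: ge0_le_integral => //.
exact: measurable_funTS.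
Qed.

Lemma integral_ge_cst (D : set 'rV[R]_n) (f : 'rV[R]_n -> \bar R) (c : R) : 0 <= c ->
  measurable D -> measurable_fun setT f -> (forall x, 0 <= f x)%E ->
  (forall x, D x -> c%:E <= f x)%E ->
  (c%:E * mu D <= \int[mu]_(x in D) f x)%E.
Proof.
move=> c0 mD mf f0 fc; rewrite -integral_cst//; apply: ge0_le_integral => //.
exact: measurable_funTS.
Qed.

End integral_bounds.


Lemma measurable_cubes {R : realType} n (s : seq 'rV[R]_n) (h : R) :
  measurable [set x | exists2 a, a \in s & ccube a h x].
Proof.
have -> : [set x | exists2 a, a \in s & ccube a h x] = \big[setU/set0]_(a <- s) ccube a h.
  by rewrite -bigcup_seq; apply/seteqP; split=> x [a as_ Hx]; exists a.
by apply: bigsetU_measurable => k _; exact: measurable_ccube.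
Qed.

Lemma count_le1 (T : eqType) (p : pred T) (s : seq T) : uniq s ->
  (forall a b, a \in s -> b \in s -> p a -> p b -> a = b) -> (count p s <= 1)%N.
Proof.
move=> us Hp; rewrite -size_filter.
case E : [seq x <- s | p x] => [|a [|b l]] //.
have : uniq [seq x <- s | p x] by rewrite filter_uniq.
have ha : a \in [seq x <- s | p x] by rewrite E mem_head.
have hb : b \in [seq x <- s | p x] by rewrite E !inE eqxx orbT.
move: ha hb; rewrite !mem_filter => /andP[pa as_] /andP[pb bs].
by rewrite E /= inE (Hp a b)// eqxx.
Qed.

Lemma sum_count_le (T : eqType) (U : Type) (s : seq T) (p : T -> pred U) (t : seq U) : uniq s ->
  (forall q a b, a \in s -> b \in s -> p a q -> p b q -> a = b) ->
  (\sum_(a <- s) size [seq q <- t | p a q] <= size t)%N.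
Proof.
move=> us Hp; elim: t => [|q t IH]; first by rewrite big1.
under eq_bigr do rewrite size_filter /= -size_filter.
rewrite big_split/= -[X in (_ <= X)%N]add1n leq_add//.
rewrite (_ : (\sum_(a <- s) p a q = count (fun a => p a q) s)%N); last by rewrite -sum1_count [RHS]big_mkcond/=; apply: eq_bigr => a _; case: (p a q).
by apply: count_le1 => // a b; exact: Hp.
Qed.

(** * Optimal allocation of pieces among the cubes of a packing *)

Section abstract_limit.
Context {R : realType} {n : nat} {P : Type}.
Variables (O : set 'rV[R]_n) (e : P -> 'rV[R]_n -> R) (r : R) (w : 'rV[R]_n -> R).
Local Notation mu := (@leb_mx R n).
Local Notation sg := (1 + r)^-1.

Definition qerr (D : set 'rV[R]_n) (m : nat) : \bar R :=
  ereal_inf [set I | exists2 s : seq P, (size s <= m)%N & I = (\int[mu]_(x in D) err e s x)%E].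

Hypothesis r0 : 0 < r.
Hypothesis oO : open O.
Hypothesis bO : mxbounded O.
Hypothesis e0 : forall q x, 0 <= e q x.
Hypothesis me : forall q, measurable_fun setT (e q).
Hypothesis wc : {in O, continuous w}.
Hypothesis w0 : forall x, O x -> 0 <= w x.
Hypothesis local_upper : forall x0 eps, O x0 -> 0 < eps -> exists2 rho : R, 0 < rho &
  forall a (h : R), 0 < h -> (forall y, ccube a h y -> `|y - x0| < rho) ->
  exists k0 : nat, forall k, (k0 <= k)%N -> exists2 s : seq P, (size s <= k)%N &
   (\int[mu]_(x in ccube a h) err e s x <=
     ((w x0 + eps) * (h ^+ n) `^ (1 + r) * k%:R `^ (- r))%:E)%E.
Hypothesis local_lower : forall x0 eps, O x0 -> 0 < eps -> exists2 rho : R, 0 < rho &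
  forall a (h : R), 0 < h -> (forall y, ccube a h y -> `|y - x0| < rho) ->
  exists k0 : nat, forall k, (k0 <= k)%N -> forall s : seq P, (size s <= k)%N ->
   (((w x0 - eps) * (h ^+ n) `^ (1 + r) * k%:R `^ (- r))%:E <=
    \int[mu]_(x in ccube a h) err e s x)%E.
Hypothesis separation : forall a b (h : R), 0 < h -> ccube a h `<=` O -> ccube b h `<=` O ->
  (forall x, ccube a h x -> ccube b h x -> False) ->
  exists2 tau : R, 0 < tau & forall q x y, ccube a h x -> ccube b h y ->
    e q x < tau -> e q y < tau -> False.
Hypothesis global_upper : exists2 C : R, 0 <= C & forall k, (0 < k)%N ->
  exists2 s : seq P, (size s <= k)%N & forall x, O x -> (err e s x <= (C * k%:R `^ (- r))%:E)%E.

Let r1 : 0 < 1 + r. Proof. by move: r0; lra. Qed.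
Let sg0 : 0 < sg. Proof. by rewrite invr_gt0 r1. Qed.
Let sg1 : sg <= 1. Proof. by rewrite invf_le1 ?r1//; move: r0; lra. Qed.
Let mO : measurable O. Proof. exact: open_measurable_mx. Qed.

Definition wint : \bar R := (\int[mu]_(x in O) (w x `^ sg)%:E)%E.

Let merr s : measurable_fun setT (err e s). Proof. exact: measurable_err. Qed.
Let err0 s x : (0 <= err e s x)%E. Proof. exact: err_ge0. Qed.

Lemma qerr_ge0 D m : (0 <= qerr D m)%E.
Proof.
apply: le_ereal_inf_tmp => _ [s _ ->]; apply: integral_ge0 => x _; exact: err0.
Qed.

Let V := fine (mu O).
Let VE : mu O = V%:E.
Proof. by rewrite /V fineK// ge0_fin_numE//; exact: leb_mx_fin. Qed.
Let V0 : 0 <= V. Proof. by rewrite fine_ge0. Qed.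

Lemma qerr_bounded : exists2 B : R, 0 <= B & forall m, (0 < m)%N ->
  ((m%:R `^ r)%:E * qerr O m <= B%:E)%E.
Proof.
have [C C0 HC] := global_upper; exists (C * V); first exact: mulr_ge0.
move=> m m0; have [s sm Hs] := HC m m0.
have m0' : 0 < m%:R :> R by rewrite ltr0n.
apply: (@le_trans _ _ ((m%:R `^ r)%:E * ((C * m%:R `^ (- r))%:E * mu O))%E).
  rewrite lee_wpmul2l ?lee_fin ?powR_ge0//.
  apply: (@le_trans _ _ (\int[mu]_(x in O) err e s x)%E).
    by apply: ereal_inf_lbound; exists s.
  exact: integral_le_cst.
rewrite VE -!EFinM lee_fin powRN le_eqVlt; apply/orP; left; apply/eqP.
by field; rewrite gt_eqF// powR_gt0.
Qed.

Let cover_ge (s : seq 'rV[R]_n) (h : R) (f : 'rV[R]_n -> \bar R) :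
  measurable_fun setT f -> (forall x, 0 <= f x)%E ->
  (\int[mu]_(x in O) f x <=
   \int[mu]_(x in O `\` [set x | exists2 a, a \in s & ccube a h x]) f x +
   \sum_(a <- s) \int[mu]_(x in ccube a h) f x)%E.
Proof.
move=> mf f0; have mU := measurable_cubes s h; set U := [set x | _] in mU *.
have := @integral_le_cover R n _ (None :: map Some s)
  (fun i => if i is Some a then ccube a h else O `\` U) O f mO.
rewrite big_cons big_map; apply => //.
- by case=> [a|]; [exact: measurable_ccube|exact: measurableD].
- move=> x Ox; have [[a as_ Hx]|nU] := pselect (U x); last by exists None => //; left.
  by exists (Some a) => //; right; apply: List.in_map; exact: mem_In.
Qed.

Let packing_vol (s : seq 'rV[R]_n) (h : R) : 0 < h -> uniq s ->
  (forall a, a \in s -> ccube a h `<=` O) ->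
  (forall a b x, a \in s -> b \in s -> ccube a h x -> ccube b h x -> a = b) ->
  \sum_(a <- s) h ^+ n <= V.
Proof.
move=> h0 us sO ds; rewrite -lee_fin -VE -sumEFin.
have := @integral_ge_disjoint R n _ s (fun a => ccube a h) O (cst 1%E) us mO.
rewrite integral_cst// mul1e => H.
apply: le_trans (H _ _ _ _ _) => //.
- rewrite le_eqVlt; apply/orP; left; apply/eqP; apply: eq_bigr => a _.
  rewrite (integral_cst mu (measurable_ccube a h)) mul1e; apply/esym; apply: leb_ccube; exact: ltW.
- by move=> a; exact: measurable_ccube.
Qed.

Lemma osc_w x0 (eps : R) : O x0 -> 0 < eps -> exists2 rho : R, 0 < rho &
  forall y, `|y - x0| < rho -> `|w y - w x0| <= eps.
Proof.
move=> Ox0 eps0.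
have wc0 : {for x0, continuous w} by apply: wc; rewrite inE.
have /nbhs_normP[rho rho0 H] : nbhs x0 [set y | `|w x0 - w y| < eps].
  by have /cvgrPdist_lt/(_ eps eps0) := wc0.
by exists rho => // y /H /ltW; rewrite distrC.
Qed.

(** On a cube [w] stays within [eps] of a constant and the local estimates are off by [eps], so by
    subadditivity $w^{1/(1+r)}$ is off by at most $(2\epsilon)^{1/(1+r)}$; over the whole volume [V]
    this must stay below [g]. *)
Let small_eps (g : R) : 0 < g -> exists2 eps : R, 0 < eps & (2 * eps) `^ sg * V <= g.
Proof.
move=> g0; exists ((g / (V + 1)) `^ (1 + r) / 2).
  by rewrite divr_gt0// powR_gt0// divr_gt0//; move: V0; lra.
have q0 : 0 <= g / (V + 1) by rewrite divr_ge0 ?(ltW g0)//; move: V0; lra.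
rewrite mulrCA mulfV// mulr1 powRK_inv//.
have V1 : 0 < V + 1 by move: V0; lra.
by rewrite mulrAC ler_pdivrMr// ler_pM2l//; move: V0; lra.
Qed.

Let mw M : measurable_fun O (fun x => Num.min (w x) M).
Proof.
apply: measurable_minr; last exact: measurable_cst.
exact: measurable_fun_cont.
Qed.

Let mpow : measurable_fun setT (fun x : R => x `^ sg).
Proof. exact: measurable_powR. Qed.

Let wM (M : R) x : \bar R := ((Num.min (w x) M) `^ sg)%:E.

Let mwM M : measurable_fun O (wM M).
Proof. by apply/measurable_EFinP; apply: (measurableT_comp mpow (mw M)). Qed.

(** At this point [wint] may be infinite; monotone convergence of the truncations $\min(w,M)$
    supplies a bounded density whose integral still exceeds [y]. *)
Lemma trunc_wint (y : R) : (y%:E < wint)%E -> exists2 M : R, 0 <= M &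
  (y%:E < \int[mu]_(x in O) wM M x)%E.
Proof.
move=> yW.
have H : (\int[mu]_(x in O) wM k%:R x)%E @[k --> \oo] --> wint.
  rewrite /wint [X in _ --> X](_ : _ = (\int[mu]_(x in O) limn (fun k : nat => wM k%:R x))%E); last first.
    apply: eq_integral => x; rewrite inE => Ox; apply/esym/cvg_lim => //.
    apply: cvg_near_cst; apply: filterS (near_natr_ge (w x)) => k hk.
    by rewrite /wM min_l.
  apply: cvg_monotone_convergence => //.
  - by move=> k x Ox; rewrite lee_fin powR_ge0.
  - move=> x Ox a b ab; rewrite lee_fin; apply: ge0_ler_powR.
    + exact: ltW.
    + by rewrite nnegrE le_min w0/=.
    + by rewrite nnegrE le_min w0/=.
    + by rewrite le_min !ge_min lexx/= ler_nat ab orbT.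
have nb : nbhs wint [set z | (y%:E < z)%E].
  by apply: open_nbhs_nbhs; split => //; exact: open_ereal_gt_ereal.
have [k _ /(_ k (leqnn k)) Hk] := H _ nb.
by exists k%:R.
Qed.

(** On each cube only the pieces that are good somewhere on it count, the others being dominated by
    a fixed net. By separation these counts add up to at most [m], apart from a constant, and
    [radon] bounds the sum of the local errors by that of the best distribution. *)
Lemma lower_bound (y : R) : 0 <= y -> (y%:E < wint)%E ->
  \forall m \near \oo, ((y `^ (1 + r))%:E <= (m%:R `^ r)%:E * qerr O m)%E.
Proof.
move=> y0 /trunc_wint[M M0 yM].
pose f := (wM M) \_ O.
have mf : measurable_fun setT f by apply/(measurable_restrictT _ mO).
have fO x : O x -> f x = wM M x by move=> Ox; rewrite /f /patch mem_set.
have f0 x : (0 <= f x)%E.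
  by rewrite /f /patch; case: ifPn => // _; rewrite lee_fin powR_ge0.
have If : (\int[mu]_(x in O) wM M x = \int[mu]_(x in O) f x)%E.
  by apply: eq_integral => x; rewrite inE => Ox; rewrite fO.
pose Ms := M `^ sg.
have Ms0 : 0 <= Ms by exact: powR_ge0.
have fMs x : O x -> (f x <= Ms%:E)%E.
  move=> Ox; rewrite fO// lee_fin; apply: ge0_ler_powR; first exact: ltW.
  - by rewrite nnegrE le_min w0.
  - by rewrite nnegrE.
  - by rewrite ge_min lexx orbT.
have [I IE] : exists I : R, (\int[mu]_(x in O) f x = I%:E)%E.
  exists (fine (\int[mu]_(x in O) f x)); rewrite fineK// ge0_fin_numE; last exact: integral_ge0.
  by apply: (@le_lt_trans _ _ (Ms%:E * mu O)%E); [exact: integral_le_cst|rewrite VE -EFinM ltry].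
have yI : y < I by rewrite -lte_fin -IE -If.
(* One [g] pays for the uncovered part and one for the oscillation of [w]; the two that remain give
   the strict inequality $y<A$. *)
pose g := (I - y) / 4.
have g0 : 0 < g by rewrite /g; lra.
have [eps eps0 Heps] := small_eps g0.
pose eta := g / (Ms + 1).
have Ms1 : 0 < Ms + 1 by lra.
have eta0 : 0 < eta by rewrite divr_gt0.
pose G (a : 'rV[R]_n) (h : R) := exists c : R, [/\ forall x, ccube a h x -> `|w x - c| <= eps,
  0 <= c & exists k0 : nat, forall k, (k0 <= k)%N -> forall s : seq P, (size s <= k)%N ->
   (((c - eps) * (h ^+ n) `^ (1 + r) * k%:R `^ (- r))%:E <=
    \int[mu]_(x in ccube a h) err e s x)%E].
have HG x : O x -> exists2 rho : R, 0 < rho & forall a (h : R), 0 < h ->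
     (forall y, ccube a h y -> `|y - x| < rho) -> G a h.
  move=> Ox; have [ra ra0 Ha] := local_lower Ox eps0; have [rb rb0 Hb] := osc_w Ox eps0.
  exists (Num.min ra rb); first by rewrite lt_min ra0.
  move=> a h h0 Hy; exists (w x); split.
  - by move=> z /Hy; rewrite lt_min => /andP[_ /Hb].
  - exact: w0.
  - by apply: Ha => // z /Hy; rewrite lt_min => /andP[].
have [s [h [h0 us sG ds Hvol]]] := cube_packing oO bO HG eta0.
have sO a : a \in s -> ccube a h `<=` O by move=> /sG[].
have /choice[c Hc] : forall a, exists c : R, a \in s -> [/\ forall x, ccube a h x -> `|w x - c| <= eps,
  0 <= c & exists k0 : nat, forall k, (k0 <= k)%N -> forall s : seq P, (size s <= k)%N ->
   (((c - eps) * (h ^+ n) `^ (1 + r) * k%:R `^ (- r))%:E <=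
    \int[mu]_(x in ccube a h) err e s x)%E].
  move=> a; have [as_|nas] := boolP (a \in s); last by exists 0.
  by have [_ [c Hc]] := sG a as_; exists c.
have /choice[k0 Hk0] : forall a, exists k0 : nat, a \in s -> forall k, (k0 <= k)%N ->
   forall s : seq P, (size s <= k)%N ->
   (((c a - eps) * (h ^+ n) `^ (1 + r) * k%:R `^ (- r))%:E <=
    \int[mu]_(x in ccube a h) err e s x)%E.
  move=> a; have [as_|nas] := boolP (a \in s); last by exists 0%N.
  by have [_ _ [k0 Hk]] := Hc a as_; exists k0.
have [tau tau0 Htau] : exists2 tau : R, 0 < tau & forall a b, a \in s -> b \in s -> a != b ->
    forall q x y, ccube a h x -> ccube b h y -> e q x < tau -> e q y < tau -> False.
  have := @exists_small_seq R _ [seq (a, b) | a <- s, b <- s]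
    (fun ab t => ab.1 != ab.2 -> forall q x y, ccube ab.1 h x -> ccube ab.2 h y ->
       e q x < t -> e q y < t -> False).
  case.
  - move=> [a b] t t' Ht t'0 t't ne q x z Hx Hz e1 e2.
    exact: (Ht ne q x z Hx Hz (lt_le_trans e1 t't) (lt_le_trans e2 t't)).
  - move=> [a b] /allpairsP[[a' b'] /= [as_ bs [-> ->]]].
    have [->|ne] := eqVneq a' b'; first by exists 1.
    have [|t t0 Ht] := separation h0 (sO a' as_) (sO b' bs); last by exists t.
    by move=> x Ha Hb; move/eqP: ne; apply; exact: ds Ha Hb.
  - move=> t t0 Ht; exists t => // a b as_ bs ne; apply: (Ht (a, b)) => //.
    by apply/allpairsP; exists (a, b).
have [C C0 HC] := global_upper.
(* The size [k1] of this net is independent of [m], and its error is at most [tau] on all of [O]. *)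
have [k1 k10 Hk1] : exists2 k1 : nat, (0 < k1)%N & C * k1%:R `^ (- r) <= tau.
  pose B := (C / tau) `^ r^-1.
  have Ct : 0 <= C / tau by rewrite divr_ge0// ltW.
  exists (Num.trunc B).+1 => //.
  have hB : B <= (Num.trunc B).+1%:R by apply/ltW; exact: truncnS_gt.
  have kp : 0 < (Num.trunc B).+1%:R `^ r :> R by rewrite powR_gt0.
  rewrite powRN ler_pdivrMr// -ler_pdivrMl// mulrC -(powRK_inv' r0 Ct) -/B.
  by apply: le_powR => //; [exact: ltW|exact: powR_ge0].
have [net net_sz Hnet] := HC k1 k10.
(* Adding [N0] to a count brings it above every threshold [k0 a] and leaves room for the net. *)
pose N0 := (\sum_(a <- s) k0 a + k1)%N.
pose D a := (Num.max (c a - eps) 0) `^ sg * h ^+ n.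
have hn0 : 0 <= h ^+ n by rewrite exprn_ge0// ltW.
have D0 a : 0 <= D a by rewrite mulr_ge0// powR_ge0.
pose A := \sum_(a <- s) D a.
have AI : y + 2 * g <= A.
  have := cover_ge s h mf f0; rewrite IE.
  have mU := measurable_cubes s h.
  set U := [set x | _] in mU Hvol *.
  have mOU : measurable (O `\` U) by exact: measurableD.
  have T1 : (\int[mu]_(x in O `\` U) f x <= (Ms * eta)%:E)%E.
    apply: (@le_trans _ _ (Ms%:E * mu (O `\` U))%E).
      by apply: integral_le_cst => // x [Ox _]; exact: fMs.
    by rewrite EFinM lee_wpmul2l.
  have T2 : (\sum_(a <- s) \int[mu]_(x in ccube a h) f x <=
     \sum_(a <- s) (D a + (2 * eps) `^ sg * h ^+ n)%:E)%E.
    rewrite big_seq [leRHS]big_seq; apply: lee_sum => a as_.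
    apply: (@le_trans _ _ (((Num.max (c a - eps) 0) `^ sg + (2 * eps) `^ sg)%:E * mu (ccube a h))%E).
      apply: integral_le_cst => //; first exact: measurable_ccube.
      move=> x Hx; have Ox := sO a as_ x Hx; rewrite fO// lee_fin.
      have [Hw _ _] := Hc a as_; have := Hw x Hx; rewrite ler_norml => /andP[h1 h2].
      have mx0 : 0 <= Num.max (c a - eps) 0 by rewrite le_max lexx orbT.
      have mx1 : c a - eps <= Num.max (c a - eps) 0 by rewrite le_max lexx.
      apply: (@le_trans _ _ ((Num.max (c a - eps) 0 + 2 * eps) `^ sg)); last first.
        by apply: powR_subadditive => //; lra.
      apply: ge0_ler_powR; first exact: ltW.
      + by rewrite nnegrE le_min w0.
      + by rewrite nnegrE; lra.
      + by rewrite ge_min; apply/orP; left; lra.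
    by rewrite (leb_ccube a (ltW h0)) -EFinM lee_fin /D mulrDl.
  move=> /le_trans/(_ (leeD T1 T2)); rewrite sumEFin -EFinD lee_fin big_split/= -/A -mulr_sumr.
  have pv := packing_vol h0 us sO ds.
  have T3 : (2 * eps) `^ sg * (\sum_(i <- s) h ^+ n) <= g.
    by apply: le_trans Heps; rewrite ler_wpM2l// powR_ge0.
  have T4 : Ms * eta <= g.
    by rewrite /eta mulrCA ger_pMr// ler_pdivrMr// mul1r; lra.
  rewrite /g in T3 T4 *; lra.
pose K := (size s * N0)%N.
have N00 : (0 < N0)%N by rewrite addn_gt0 k10 orbT.
have lower m sq : (size sq <= m)%N -> ((A `^ (1 + r) * (m%:R + K%:R) `^ (- r))%:E <=
     \int[mu]_(x in O) err e sq x)%E.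
  move=> sqm.
  (* The pieces attached to the cube [a]. By [Htau] no piece is attached to two cubes. *)
  pose p a q := `[< exists2 x, ccube a h x & e q x < tau >].
  pose ms a := size [seq q <- sq | p a q].
  have step1 : (\sum_(a <- s) \int[mu]_(x in ccube a h) err e sq x <= \int[mu]_(x in O) err e sq x)%E.
    by apply: integral_ge_disjoint => // a; exact: measurable_ccube.
  apply: le_trans step1.
  have term a : a \in s -> ((D a `^ (1 + r) * ((ms a + N0)%:R) `^ (- r))%:E <=
      \int[mu]_(x in ccube a h) err e sq x)%E.
    move=> as_.
    apply: (@le_trans _ _ (\int[mu]_(x in ccube a h) err e ([seq q <- sq | p a q] ++ net) x)%E); last first.
      apply: ge0_le_integral => //; first exact: measurable_ccube.
      - exact: measurable_funTS.
      - exact: measurable_funTS.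
      move=> x Hx; apply: (@err_filter _ _ _ _ _ tau) => [q /asboolP nq|].
        by rewrite leNgt; apply/negP => qt; apply: nq; exists x.
      by apply: le_trans (Hnet x (sO a as_ x Hx)) _; rewrite lee_fin.
    have mx0 : 0 <= Num.max (c a - eps) 0 by rewrite le_max lexx orbT.
    have -> : D a `^ (1 + r) = Num.max (c a - eps) 0 * (h ^+ n) `^ (1 + r).
      by rewrite /D powRM ?powR_ge0// powRK_inv'.
    have [cneg|cpos] := leP (c a - eps) 0.
      rewrite !mul0r; apply: integral_ge0 => x _; exact: err0.
    apply: Hk0 => //.
      have kN : (k0 a <= N0)%N by rewrite /N0 (big_rem a as_)/= -addnA leq_addr.
      exact: leq_trans kN (leq_addl _ _).
    by rewrite size_cat leq_add2l (leq_trans net_sz)// leq_addl.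
  apply: (@le_trans _ _ (\sum_(a <- s) (D a `^ (1 + r) * ((ms a + N0)%:R) `^ (- r))%:E)%E); last first.
    by rewrite big_seq [leRHS]big_seq; apply: lee_sum.
  rewrite sumEFin lee_fin.
  have tp a : 0 < (ms a + N0)%:R :> R by rewrite ltr0n addn_gt0 N00 orbT.
  apply: le_trans (radon s r0 D0 tp); rewrite -/A.
  have [A0|A0] := eqVneq A 0; first by rewrite A0 powR0 ?gt_eqF// !mul0r.
  rewrite ler_wpM2l ?powR_ge0//; apply: le_powRN; last exact: ltW.
    have [s0|s0] := eqVneq s [::]; first by move: A0; rewrite /A s0 big_nil eqxx.
    case: (s) s0 => // a s' _; rewrite big_cons ltr_pwDl//.
    by apply: sumr_ge0.
  rewrite -natr_sum -natrD ler_nat big_split/= leq_add//.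
    apply: leq_trans sqm; apply: sum_count_le => // q a b as_ bs /asboolP[x Hx ex] /asboolP[z Hz ez].
    by apply/eqP/negPn/negP => ne; exact: (Htau a b as_ bs ne q x z).
  by rewrite big_const_seq count_predT iter_addn_0 mulnC.
have Ay : y < A by lra.
have A0 : 0 < A by lra.
have yA : 0 <= y / A by rewrite divr_ge0// ltW.
have yA1 : y / A < 1 by rewrite ltr_pdivrMr// mul1r.
(* As $y<A$, this is below 1. For large [m] one has $m/(m+K)\ge\rho$, hence $A^{1+r}(m/(m+K))^r\ge
   y^{1+r}$: the overhead [K] of the nets is absorbed. *)
pose rho := (y / A) `^ ((1 + r) / r).
have rr0 : 0 < (1 + r) / r by rewrite divr_gt0.
have rho0 : 0 <= rho by exact: powR_ge0.
have rho1 : rho < 1.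
  have -> : 1 = 1 `^ ((1 + r) / r) :> R by rewrite powR1.
  exact: lt_powR.
apply: filterS2 (near_natr_ge (K%:R * rho / (1 - rho))) (near_natr_ge (1 : R)) => m hm m1.
have m0 : 0 < m%:R :> R by lra.
have mK : 0 < m%:R + K%:R :> R by rewrite ltr_wpDr.
apply: (@le_trans _ _ ((m%:R `^ r)%:E * (A `^ (1 + r) * (m%:R + K%:R) `^ (- r))%:E)%E); last first.
  rewrite lee_wpmul2l ?lee_fin ?powR_ge0//.
  by apply: le_ereal_inf_tmp => _ [sq sqm ->]; exact: lower.
rewrite -EFinM lee_fin.
have rhoE : rho `^ r = (y / A) `^ (1 + r).
  by rewrite /rho -powRrM divfK// gt_eqF.
have h1 : rho <= m%:R / (m%:R + K%:R).
  rewrite ler_pdivlMr//; move: hm; rewrite ler_pdivrMr; lra.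
have h2 : (y / A) `^ (1 + r) <= (m%:R / (m%:R + K%:R)) `^ r.
  by rewrite -rhoE; apply: le_powR => //; exact: ltW.
have -> : y `^ (1 + r) = A `^ (1 + r) * (y / A) `^ (1 + r).
  by rewrite -powRM ?(ltW A0)// mulrC divfK// gt_eqF.
have -> : m%:R `^ r * (A `^ (1 + r) * (m%:R + K%:R) `^ (- r)) =
   A `^ (1 + r) * (m%:R / (m%:R + K%:R)) `^ r.
  rewrite [in RHS]powRM ?invr_ge0 ?(ltW m0) ?(ltW mK)// -powR_inv1 ?(ltW mK)// -powRrM mulN1r.
  by ring.
by rewrite ler_wpM2l// powR_ge0.
Qed.

(** The cube [a] receives a share of the pieces proportional to [D a], rounded down, and a small
    fraction [dl] of the budget goes to a global net that controls the part left uncovered by the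
    packing. *)
Lemma upper_bound (y : R) : (wint < y%:E)%E ->
  \forall m \near \oo, ((m%:R `^ r)%:E * qerr O m <= (y `^ (1 + r))%:E)%E.
Proof.
move=> Wy.
have W0 : (0 <= wint)%E by apply: integral_ge0 => x _; rewrite lee_fin powR_ge0.
have [W WE] : exists W : R, wint = W%:E.
  by exists (fine wint); rewrite fineK// ge0_fin_numE// (lt_trans Wy)// ltry.
rewrite WE lte_fin in Wy; rewrite WE lee_fin in W0.
pose f := (fun x => (w x `^ sg)%:E) \_ O.
have mf : measurable_fun setT f.
  apply/(measurable_restrictT _ mO); apply/measurable_EFinP.
  by apply: (measurableT_comp mpow); exact: measurable_fun_cont.
have fO x : O x -> f x = (w x `^ sg)%:E by move=> Ox; rewrite /f /patch mem_set.
have f0 x : (0 <= f x)%E.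
  by rewrite /f /patch; case: ifPn => // _; rewrite lee_fin powR_ge0.
have If : (\int[mu]_(x in O) f x = W%:E)%E.
  by rewrite -WE; apply: eq_integral => x; rewrite inE => Ox; rewrite fO.
pose g := (y - W) / 2.
have g0 : 0 < g by rewrite /g; lra.
pose y1 := W + g.
have y10 : 0 < y1 by rewrite /y1; lra.
have y1y : y1 < y by rewrite /y1 /g; lra.
have [eps eps0 Heps] := small_eps g0.
pose Y := y `^ (1 + r); pose Y1 := y1 `^ (1 + r).
have Y10 : 0 < Y1 by rewrite powR_gt0.
have YY1 : Y1 < Y by apply: lt_powR => //; exact: ltW.
(* Chosen so that $Y_1\,\mathrm{kp}^{-r}=(Y+Y_1)/2$: giving the cubes only the fraction [kp] of the
   pieces costs half of the gap between $Y_1$ and $Y$. *)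
pose kp := (2 * Y1 / (Y + Y1)) `^ r^-1.
have YYp : 0 < Y + Y1 by lra.
have kq0 : 0 < 2 * Y1 / (Y + Y1) by rewrite divr_gt0// mulr_gt0.
have kp0 : 0 < kp by rewrite powR_gt0.
have kpr : kp `^ r = 2 * Y1 / (Y + Y1) by rewrite powRK_inv'// ltW.
have kp1 : kp < 1.
  have -> : 1 = 1 `^ r^-1 :> R by rewrite powR1.
  apply: lt_powR; [by rewrite invr_gt0|exact: ltW|].
  by rewrite ltr_pdivrMr// mul1r; lra.
(* The slack between [kp] and 1 is split in two: one [dl] for the global net, one to absorb the
   rounding of the shares. *)
pose dl := (1 - kp) / 2.
have dl0 : 0 < dl by rewrite /dl; lra.
have dlk : 1 - dl = kp + dl by rewrite /dl; lra.
have [C C0 HC] := global_upper.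
have dr0 : 0 < (dl / 2) `^ r by rewrite powR_gt0// divr_gt0.
(* The net will have at least $\mathrm{dl}\,m/2$ pieces; on a set of measure [eta] its error then
   costs at most the other half of the gap. *)
pose eta := (Y - Y1) / 2 * (dl / 2) `^ r / (C + 1).
have C1 : 0 < C + 1 by lra.
have eta0 : 0 < eta by rewrite divr_gt0// mulr_gt0//; lra.
pose G (a : 'rV[R]_n) (h : R) := exists c : R, [/\ forall x, ccube a h x -> `|w x - c| <= eps,
  0 <= c & exists k0 : nat, forall k, (k0 <= k)%N -> exists2 s : seq P, (size s <= k)%N &
   (\int[mu]_(x in ccube a h) err e s x <=
    ((c + eps) * (h ^+ n) `^ (1 + r) * k%:R `^ (- r))%:E)%E].
have HG x : O x -> exists2 rho : R, 0 < rho & forall a (h : R), 0 < h ->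
     (forall y, ccube a h y -> `|y - x| < rho) -> G a h.
  move=> Ox; have [ra ra0 Ha] := local_upper Ox eps0; have [rb rb0 Hb] := osc_w Ox eps0.
  exists (Num.min ra rb); first by rewrite lt_min ra0.
  move=> a h h0 Hy; exists (w x); split.
  - by move=> z /Hy; rewrite lt_min => /andP[_ /Hb].
  - exact: w0.
  - by apply: Ha => // z /Hy; rewrite lt_min => /andP[].
have [s [h [h0 us sG ds Hvol]]] := cube_packing oO bO HG eta0.
have sO a : a \in s -> ccube a h `<=` O by move=> /sG[].
have /choice[c Hc] : forall a, exists c : R, 0 <= c /\ (a \in s -> [/\ forall x, ccube a h x -> `|w x - c| <= eps,
  0 <= c & exists k0 : nat, forall k, (k0 <= k)%N -> exists2 s : seq P, (size s <= k)%N &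
   (\int[mu]_(x in ccube a h) err e s x <=
    ((c + eps) * (h ^+ n) `^ (1 + r) * k%:R `^ (- r))%:E)%E]).
  move=> a; have [as_|nas] := boolP (a \in s); last by exists 0.
  by have [_ [c Hc]] := sG a as_; exists c; split=> //; case: Hc.
have /choice[k0 Hk0] : forall a, exists k0 : nat, a \in s -> forall k, (k0 <= k)%N ->
   exists2 s : seq P, (size s <= k)%N &
   (\int[mu]_(x in ccube a h) err e s x <=
    ((c a + eps) * (h ^+ n) `^ (1 + r) * k%:R `^ (- r))%:E)%E.
  move=> a; have [as_|nas] := boolP (a \in s); last by exists 0%N.
  by have [_ /(_ as_)[_ _ [k0 Hk]]] := Hc a; exists k0.
have hn0 : 0 < h ^+ n by rewrite exprn_gt0.
have ce0 a : 0 < c a + eps by have [c0 _] := Hc a; lra.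
(* Adding [eps] keeps every share positive, even where [w] vanishes. *)
pose D a := (c a + eps) `^ sg * h ^+ n.
have D0 a : 0 < D a by rewrite mulr_gt0// powR_gt0.
pose A := \sum_(a <- s) D a.
have A0 : 0 <= A by apply: sumr_ge0 => a _; exact: ltW.
have mcc (a : 'rV[R]_n) : measurable (ccube a h) by exact: measurable_ccube.
have Ay1 : A <= y1.
  pose kk a := Num.max ((c a + eps) `^ sg - (2 * eps) `^ sg) 0.
  have kk0 a : 0 <= kk a by rewrite le_max lexx orbT.
  have T1 : (\sum_(a <- s) (kk a * h ^+ n)%:E <= W%:E)%E.
    rewrite -If.
    have := @integral_ge_disjoint R n _ s (fun a => ccube a h) O f us mO mcc mf f0 sO ds.
    apply: le_trans; rewrite big_seq [leRHS]big_seq; apply: lee_sum => a as_.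
    rewrite EFinM -(leb_ccube a (ltW h0)); apply: integral_ge_cst => // x Hx.
    have Ox := sO a as_ x Hx; rewrite fO// lee_fin ge_max powR_ge0 andbT lerBlDr.
    have [_ /(_ as_)[Hw _ _]] := Hc a; have := Hw x Hx; rewrite ler_norml => /andP[h1 h2].
    apply: (@le_trans _ _ ((w x + 2 * eps) `^ sg)); last first.
      by apply: powR_subadditive => //; [exact: w0|lra].
    apply: le_powR; [exact: ltW|exact: ltW|lra].
  have T2 a : D a <= kk a * h ^+ n + (2 * eps) `^ sg * h ^+ n.
    rewrite /D -mulrDl ler_wpM2r ?(ltW hn0)// -lerBlDr.
    by rewrite le_max lexx.
  rewrite sumEFin lee_fin in T1.
  have T3 : A <= \sum_(a <- s) (kk a * h ^+ n) + (2 * eps) `^ sg * \sum_(a <- s) h ^+ n.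
    by rewrite mulr_sumr -big_split/=; apply: ler_sum => a _.
  have T4 : (2 * eps) `^ sg * (\sum_(i <- s) h ^+ n) <= g.
    apply: le_trans Heps; rewrite ler_wpM2l ?powR_ge0//.
    exact: packing_vol.
  by rewrite /y1; lra.
have ev : \forall m \near \oo, forall a, a \in s ->
    (k0 a)%:R <= kp * m%:R * (D a / A) /\ 1 <= dl * m%:R * (D a / A).
  apply: eventually_seq => a as_.
  have Ap : 0 < A.
    rewrite /A (big_rem a as_)/= ltr_pwDl//; apply: sumr_ge0 => b _; exact: ltW.
  have q0 : 0 < D a / A by rewrite divr_gt0.
  apply: filterS2 (near_natr_ge ((k0 a)%:R / (kp * (D a / A)))) (near_natr_ge (1 / (dl * (D a / A)))) => m.
  have p1 : 0 < kp * (D a / A) by exact: mulr_gt0.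
  have p2 : 0 < dl * (D a / A) by exact: mulr_gt0.
  rewrite (ler_pdivrMr _ _ p1) (ler_pdivrMr _ _ p2) => h1 h2.
  by split; [rewrite mulrAC mulrC|rewrite mulrAC mulrC].
apply: filterS2 ev (near_natr_ge (2 / dl)) => m Hm; rewrite ler_pdivrMr// => m2.
have m0 : 0 < m%:R :> R by rewrite -(pmulr_lgt0 _ dl0); lra.
pose ka a := Num.trunc ((1 - dl) * m%:R * (D a / A)).
have dl1 : 0 < 1 - dl by rewrite dlk; lra.
have q0 a : 0 <= D a / A by rewrite divr_ge0// ltW.
have arg0 a : 0 <= (1 - dl) * m%:R * (D a / A).
  by apply: mulr_ge0 => //; apply: mulr_ge0 => //; exact: ltW.
have kalo a : a \in s -> kp * m%:R * (D a / A) <= (ka a)%:R.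
  move=> as_; have [_ h1] := Hm a as_.
  have := truncnS_gt ((1 - dl) * m%:R * (D a / A)); rewrite -/(ka a) -natr1 dlk.
  lra.
have /choice[t Ht] : forall a, exists t : seq P, a \in s -> (size t <= ka a)%N /\
   (\int[mu]_(x in ccube a h) err e t x <=
    ((c a + eps) * (h ^+ n) `^ (1 + r) * (ka a)%:R `^ (- r))%:E)%E.
  move=> a; have [as_|nas] := boolP (a \in s); last by exists [::].
  have [|t tk Ht] := Hk0 a as_ (ka a); last by exists t.
  by rewrite -(ler_nat R); apply: le_trans (kalo a as_); have [] := Hm a as_.
pose k' := Num.trunc (dl * m%:R).
have dlm0 : 0 <= dl * m%:R by rewrite mulr_ge0// ltW.
have k'lo : dl / 2 * m%:R <= k'%:R.
  have := truncnS_gt (dl * m%:R); rewrite -/k' -natr1; lra.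
have k'0 : (0 < k')%N by rewrite truncn_gt0; lra.
have [t' t'k Ht'] := HC k' k'0.
pose S := flatten [seq t a | a <- s] ++ t'.
have sizeS : (size S <= m)%N.
  rewrite size_cat size_flatten /shape -map_comp sumnE big_map.
  apply: (@leq_trans (\sum_(a <- s) ka a + k')).
    rewrite leq_add// big_seq [X in (_ <= X)%N]big_seq; apply: leq_sum => a as_.
    by have [] := Ht a as_.
  rewrite -(ler_nat R) natrD natr_sum.
  have k'm : k'%:R <= dl * m%:R by rewrite truncn_le.
  have sm : \sum_(a <- s) (ka a)%:R <= (1 - dl) * m%:R.
    apply: (@le_trans _ _ (\sum_(a <- s) (1 - dl) * m%:R * (D a / A))).
      by apply: ler_sum => a _; rewrite truncn_le.
    rewrite -mulr_sumr -mulr_suml -/A ger_pMr ?mulr_gt0//.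
    by have [->|An0] := eqVneq A 0; [rewrite mul0r|rewrite mulfV].
  lra.
have mU := measurable_cubes s h.
have HS := cover_ge s h (merr S) (err0 S).
set U := [set x | _] in mU Hvol HS *.
have mOU : measurable (O `\` U) by exact: measurableD.
have T1 : (\int[mu]_(x in O `\` U) err e S x <= (C * k'%:R `^ (- r) * eta)%:E)%E.
  apply: (@le_trans _ _ ((C * k'%:R `^ (- r))%:E * mu (O `\` U))%E).
    apply: integral_le_cst => // x [Ox _]; apply: le_trans (Ht' x Ox).
    exact: err_catr.
  by rewrite [leRHS]EFinM lee_wpmul2l// lee_fin mulr_ge0// powR_ge0.
have T2 : (\sum_(a <- s) \int[mu]_(x in ccube a h) err e S x <=
   \sum_(a <- s) (D a * A `^ r * kp `^ (- r) * m%:R `^ (- r))%:E)%E.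
  rewrite big_seq [leRHS]big_seq; apply: lee_sum => a as_.
  apply: (@le_trans _ _ (\int[mu]_(x in ccube a h) err e (t a) x)%E).
    apply: ge0_le_integral => //; [exact: measurable_funTS|exact: measurable_funTS|].
    move=> x _; apply: le_trans (err_catl _ _ _ _) _; exact: err_flatten.
  have [_ Hta] := Ht a as_; apply: (le_trans Hta); rewrite lee_fin.
  have Ap : 0 < A.
    rewrite /A (big_rem a as_)/= ltr_pwDl//; apply: sumr_ge0 => b _; exact: ltW.
  have qp : 0 < D a / A by rewrite divr_gt0.
  have -> : (c a + eps) * (h ^+ n) `^ (1 + r) = D a `^ (1 + r).
    by rewrite /D powRM ?powR_ge0 ?(ltW hn0)// powRK_inv'// ltW.
  have -> : D a * A `^ r * kp `^ (- r) * m%:R `^ (- r) = D a `^ (1 + r) * (kp * m%:R * (D a / A)) `^ (- r).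
    have e1 : (kp * m%:R * (D a / A)) `^ (- r) = kp `^ (- r) * m%:R `^ (- r) * (D a `^ (- r) * A `^ r).
      have kp0' := ltW kp0; have m0' := ltW m0; have Da0 := ltW (D0 a); have qa0 := ltW qp.
      have Ai : 0 <= A^-1 by rewrite invr_ge0.
      have kpm : 0 <= kp * m%:R by exact: mulr_ge0.
      rewrite powRM// powRM//; congr (_ * _); rewrite powRM//; congr (_ * _).
      by rewrite -powR_inv1// -powRrM mulN1r opprK.
    have e2 : D a `^ (1 + r) * D a `^ (- r) = D a.
      by rewrite -powRD ?(gt_eqF (D0 a)) ?implybT// addrK powRr1// ltW.
    rewrite e1.
    rewrite (_ : D a `^ (1 + r) * (kp `^ (- r) * m%:R `^ (- r) * (D a `^ (- r) * A `^ r)) =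
       (D a `^ (1 + r) * D a `^ (- r)) * A `^ r * kp `^ (- r) * m%:R `^ (- r)); last by ring.
    by rewrite e2.
  rewrite ler_wpM2l ?powR_ge0//; apply: le_powRN; [|exact: kalo|exact: ltW].
  by apply: mulr_gt0 => //; exact: mulr_gt0.
have T3 : A * A `^ r <= Y1.
  rewrite -[X in X * _]powRr1//.
  have [->|An0] := eqVneq A 0; first by rewrite powR0 ?oner_eq0// mul0r ltW.
  rewrite -powRD; last by rewrite An0 implybT.
  by apply: le_powR => //; exact: ltW.
have T4 : (\sum_(a <- s) D a * A `^ r * kp `^ (- r) * m%:R `^ (- r)) <= (Y + Y1) / 2 * m%:R `^ (- r).
  rewrite -mulr_suml -mulr_suml -mulr_suml -/A ler_wpM2r ?powR_ge0//.
  apply: (@le_trans _ _ (Y1 * kp `^ (- r))); first by rewrite ler_wpM2r// powR_ge0.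
  rewrite powRN kpr le_eqVlt; apply/orP; left; apply/eqP.
  by field; rewrite ?(gt_eqF YYp) ?(gt_eqF Y10).
have T5 : C * k'%:R `^ (- r) * eta <= (Y - Y1) / 2 * m%:R `^ (- r).
  apply: (@le_trans _ _ (C * (dl / 2 * m%:R) `^ (- r) * eta)).
    rewrite ler_wpM2r ?(ltW eta0)// ler_wpM2l//; apply: le_powRN; [|exact: k'lo|exact: ltW].
    by rewrite mulr_gt0// divr_gt0.
  rewrite powRM ?(ltW m0)//; last by rewrite divr_ge0// ltW.
  rewrite mulrA mulrAC ler_wpM2r ?powR_ge0// /eta powRN.
  rewrite (_ : C * ((dl / 2) `^ r)^-1 * ((Y - Y1) / 2 * (dl / 2) `^ r / (C + 1)) =
    (Y - Y1) / 2 * (C / (C + 1))); last by field; rewrite ?(gt_eqF dr0) ?(gt_eqF C1).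
  rewrite ler_piMr//; first by lra.
  by rewrite ler_pdivrMr// mul1r; lra.
have mm : m%:R `^ r * m%:R `^ (- r) = 1 :> R.
  by rewrite powRN mulfV// gt_eqF// powR_gt0.
apply: (@le_trans _ _ ((m%:R `^ r)%:E * (Y * m%:R `^ (- r))%:E)%E); last first.
  by rewrite -EFinM lee_fin mulrCA mm mulr1.
rewrite lee_wpmul2l ?lee_fin ?powR_ge0//.
apply: (@le_trans _ _ (\int[mu]_(x in O) err e S x)%E).
  by apply: ereal_inf_lbound; exists S.
apply: (le_trans HS); apply: (le_trans (leeD T1 T2)).
rewrite sumEFin -EFinD lee_fin; move: T4 T5; move: (m%:R `^ (- r)) => z T4 T5.
have -> : Y * z = (Y - Y1) / 2 * z + (Y + Y1) / 2 * z by field.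
exact: lerD.
Qed.

(** If [wint] were infinite, the lower bound would exceed the bound [B] drawn from [global_upper];
    integrability of $w^{1/(1+r)}$ is thus a conclusion. The limit then follows from the two bounds
    with [y] slightly below and slightly above [wint]. *)
Theorem abstract_limit : (wint < +oo)%E /\
  ((m%:R `^ r)%:E * qerr O m)%E @[m --> \oo] --> ((fine wint) `^ (1 + r))%:E.
Proof.
have [B B0 HB] := qerr_bounded.
have W0 : (0 <= wint)%E by apply: integral_ge0 => x _; rewrite lee_fin powR_ge0.
have Wfin : (wint < +oo)%E.
  rewrite ltNge; apply/negP; rewrite leye_eq => /eqP WE.
  have B1 : 0 <= B + 1 by lra.
  have := @lower_bound ((B + 1) `^ sg) (powR_ge0 _ _).
  rewrite WE ltry => /(_ isT) H.
  have [m0 _ Hm] := H.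
  have := Hm m0.+1 (leqnSn _); rewrite /= powRK_inv'// => H1.
  have := le_trans H1 (HB m0.+1 (ltn0Sn _)); rewrite lee_fin; lra.
split=> //.
have [W WE] : exists W : R, wint = W%:E.
  by exists (fine wint); rewrite fineK// ge0_fin_numE.
rewrite WE lee_fin in W0; rewrite WE /=.
have l0 : 0 <= W `^ (1 + r) by exact: powR_ge0.
apply: cvg_ereal_squeeze => eps eps0.
  have [neg|pos] := ltP (W `^ (1 + r) - eps) 0.
    apply: nearW => m; apply: (@le_trans _ _ 0%E); first by rewrite lee_fin ltW.
    by rewrite mule_ge0 ?lee_fin ?powR_ge0//; exact: qerr_ge0.
  have := @lower_bound ((W `^ (1 + r) - eps) `^ sg) (powR_ge0 _ _).
  rewrite powRK_inv'// => H; apply: H; rewrite WE lte_fin.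
  rewrite -[ltRHS](powRK_inv r1 W0); apply: lt_powR => //.
  by lra.
have := @upper_bound ((W `^ (1 + r) + eps) `^ sg).
have p : 0 <= W `^ (1 + r) + eps by lra.
rewrite powRK_inv'// => H; apply: H; rewrite WE lte_fin.
rewrite -[ltLHS](powRK_inv r1 W0); apply: lt_powR => //.
by lra.
Qed.

End abstract_limit.

(** * The quantization constant of the cube *)

Section affine_change.
Context {R : realType}.
Implicit Types (n : nat).
Local Notation mu n := (@leb_mx R n).

Lemma measurable_coord n j : measurable_fun setT (fun x : 'rV[R]_n => x 0 j).
Proof.
apply: (@measurable_fun_cont _ 1 n) => [|x _]; first exact: openT.
exact: coord_continuous.
Qed.

Lemma measurable_mulmx_add n (B : 'M[R]_n) (c : 'rV[R]_n) :
  measurable_fun setT (fun x : 'rV[R]_n => x *m B + c).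
Proof.
apply: measurable_fun_mx => i j; rewrite (ord1 i).
under eq_fun do rewrite !mxE.
apply: measurable_funD; last exact: measurable_cst.
apply: measurable_sum => k; apply: measurable_funM; last exact: measurable_cst.
exact: measurable_coord.
Qed.

Lemma integral_cov n (B : 'M[R]_n) (c : 'rV[R]_n) (D : set 'rV[R]_n) (f : 'rV[R]_n -> \bar R) :
  cov B -> measurable D -> measurable_fun setT f -> (forall x, 0 <= f x)%E ->
  (\int[mu n]_(x in D) f x =
   (\det B)%:E * \int[mu n]_(x in [set x | D (x *m B + c)%R]) f (x *m B + c)%R)%E.
Proof.
move=> [B0 HB] mD mf f0.
have mfD : measurable_fun setT (f \_ D).
  by apply/(measurable_restrictT _ mD); exact: measurable_funTS.
have fD0 x : (0 <= (f \_ D) x)%E by rewrite /patch; case: ifPn.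
rewrite integral_mkcond -iintE// [in RHS]integral_mkcond.
have E : (fun x => f (x *m B + c)) \_ [set x | D (x *m B + c)] =
   (fun x => (f \_ D) (x *m B + c)).
  by apply/funext => x; rewrite /patch; congr (if _ then _ else _).
rewrite E -iintE//; last exact: (measurableT_comp mfD (measurable_mulmx_add B c)).
by rewrite HB// muleA -EFinM mulfV ?gt_eqF// mul1e.
Qed.

End affine_change.

Section dotr.
Context {R : realType} {n : nat}.
Implicit Types (x y : 'rV[R]_n).

Lemma dotr_ge0 x : 0 <= dotr x x.
Proof. by apply: sumr_ge0 => i _; rewrite -expr2 sqr_ge0. Qed.

Lemma dotrZ (h : R) x : dotr (h *: x) (h *: x) = h ^+ 2 * dotr x x.
Proof. by rewrite /dotr mulr_sumr; apply: eq_bigr => i _; rewrite !mxE; ring. Qed.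

Lemma coord_le_dotr x j : (x 0 j) ^+ 2 <= dotr x x.
Proof.
rewrite /dotr (bigD1 j)//= -expr2 lerDl; apply: sumr_ge0 => i _.
by rewrite -expr2 sqr_ge0.
Qed.

Lemma dotr_le_norm x : dotr x x <= n%:R * `|x| ^+ 2.
Proof.
rewrite /dotr; apply: (@le_trans _ _ (\sum_(i < n) `|x| ^+ 2)).
  apply: ler_sum => i _; rewrite -expr2 -real_normK ?num_real//.
  by rewrite lerXn2r ?nnegrE// coord_le_norm.
by rewrite sumr_const card_ord mulr_natl.
Qed.

Lemma dotrC x y : dotr x y = dotr y x.
Proof. by apply: eq_bigr => i _; rewrite mulrC. Qed.

Lemma dotrDl x y z : dotr (x + y) z = dotr x z + dotr y z.
Proof. by rewrite /dotr -big_split/=; apply: eq_bigr => i _; rewrite mxE mulrDl. Qed.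

Lemma dotrNl x z : dotr (- x) z = - dotr x z.
Proof. by rewrite /dotr -sumrN; apply: eq_bigr => i _; rewrite mxE mulNr. Qed.

Lemma dotrZl (c : R) x z : dotr (c *: x) z = c * dotr x z.
Proof. by rewrite /dotr mulr_sumr; apply: eq_bigr => i _; rewrite mxE mulrA. Qed.

Lemma enormE (p : R) x : 0 < p -> enorm x `^ (2 * p) = dotr x x `^ p.
Proof.
move=> p0; rewrite /enorm -powR12_sqrt ?dotr_ge0// -powRrM.
by congr powR; field.
Qed.

Lemma measurable_dotr (g : 'rV[R]_n -> 'rV[R]_n) :
  measurable_fun setT g -> measurable_fun setT (fun x => dotr (g x) (g x)).
Proof.
move=> mg; apply: measurable_sum => i.
by apply: measurable_funM; apply: (measurableT_comp (measurable_coord i) mg).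
Qed.

Definition e0 (p : R) (s x : 'rV[R]_n) : R := dotr (x - s) (x - s) `^ p.

Lemma e0_ge0 p s x : 0 <= e0 p s x.
Proof. exact: powR_ge0. Qed.

Lemma measurable_e0 p s : measurable_fun setT (e0 p s).
Proof.
have mp : measurable_fun setT (fun x : R => x `^ p) by exact: measurable_powR.
apply: (measurableT_comp mp); apply: measurable_dotr.
have := @measurable_mulmx_add R n 1%:M (- s).
by under eq_fun do rewrite mulmx1.
Qed.

End dotr.

Lemma err_map {R : realType} {n n' : nat} {P P' : Type} (e : P -> 'rV[R]_n -> R)
   (e' : P' -> 'rV[R]_n' -> R) (phi : P -> P') (k : R) s x y : 0 < k ->
  (forall q, e q x = k * e' (phi q) y) ->
  err e s x = (k%:E * err e' (map phi s) y)%E.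
Proof.
move=> k0 H; elim: s => [|q s IH]; first by rewrite !err_nil gt0_muley// lte_fin.
rewrite /= !err_cons IH H EFinM; apply/esym.
by rewrite !minEle lee_pmul2l ?lte_fin//; case: ifP.
Qed.

Lemma powR_exprn {R : realType} (h : R) (k : nat) (x : R) : 0 <= h ->
  (h ^+ k) `^ x = h `^ (k%:R * x).
Proof. by move=> h0; rewrite -powR_mulrn// -powRrM. Qed.

Section grid_closed.
Context {R : realType}.

Lemma grid_cover_closed n (a : 'rV[R]_n) (h : R) N x : (0 < N)%N -> 0 < h ->
  ccube a (h * N%:R) x -> exists k : 'rV['I_N]_n, ccube (gridpt a h k) h x.
Proof.
move=> N0 h0 Hx.
have Hd j : 0 <= (x 0 j - a 0 j) / h.
  by apply: divr_ge0; [rewrite subr_ge0; have /andP[] := Hx j|exact: ltW].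
(* [minn] sends the far faces of the closed cube, where the quotient equals [N], to the last
   cell. *)
have Hk j : (minn (Num.trunc ((x 0%R j - a 0%R j) / h)%R) N.-1 < N)%N.
  by rewrite gtn_min prednK// leqnn orbT.
exists (\row_j Ordinal (Hk j)) => j; rewrite !mxE /=.
have /andP[] := truncn_itv (Hd j); rewrite ler_pdivlMr// ltr_pdivrMr// -natr1.
have /andP[x1 x2] := Hx j.
move=> h1 h2; case: leqP => H; first by apply/andP; split; lra.
have NE : N.-1%:R + 1 = N%:R :> R by rewrite natr1 prednK.
have : N%:R <= (Num.trunc ((x 0 j - a 0 j) / h))%:R :> R by rewrite ler_nat -(prednK N0).
move=> /(ler_wpM2r (ltW h0)) h3.
by apply/andP; split; nra.
Qed.

End grid_closed.

Section cube_constant.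
Context {R : realType} (n : nat) (p : R).
Hypothesis n0 : (0 < n)%N.
Hypothesis p0 : 0 < p.
Local Notation mu := (@leb_mx R n).
Local Notation e := (@e0 R n p).
Local Notation r := (2 * p / n%:R).
Local Notation Q0 := (ccube (0 : 'rV[R]_n) 1).
Local Notation q := (qerr e Q0).

Let nR0 : 0 < n%:R :> R. Proof. by rewrite ltr0n. Qed.
Let r0 : 0 < r. Proof. by rewrite divr_gt0// mulr_gt0. Qed.

(** Volume contributes $h^n$ and the error $h^{2p}$, which is $(h^n)^r$ for $r=2p/n$. *)
Lemma cube_scale s (a : 'rV[R]_n) (h : R) : 0 < h ->
  (\int[mu]_(x in ccube a h) err e s x =
   ((h ^+ n) `^ (1 + r))%:E * \int[mu]_(x in Q0) err e [seq h^-1 *: (z - a) | z <- s] x)%E.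
Proof.
move=> h0.
have me s' := measurable_err (@measurable_e0 R n p) s'.
have er0 s' x : (0 <= err e s' x)%E := err_ge0 (@e0_ge0 R n p) s' x.
rewrite (integral_cov a (cov_scalar n h0) (measurable_ccube a h) (me s) (er0 s)).
have hn0 : 0 < h ^+ n by rewrite exprn_gt0.
have -> : [set x | ccube a h (x *m h%:M + a)] = Q0.
  apply/seteqP; split=> x Hx j; have := Hx j; rewrite mul_mx_scalar !mxE => /andP[h1 h2];
    apply/andP; split; nra.
have hp0 : 0 < (h ^+ 2) `^ p by rewrite powR_gt0// exprn_gt0.
have E x : err e s (x *m h%:M + a) = (((h ^+ 2) `^ p)%:E * err e [seq h^-1 *: (z - a) | z <- s] x)%E.
  apply: err_map => // z; rewrite /e0 -powRM ?sqr_ge0 ?dotr_ge0// -dotrZ.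
  congr ((dotr _ _) `^ _); rewrite mul_mx_scalar; apply/rowP => j; rewrite !mxE; field;
  by rewrite gt_eqF.
under eq_integral do rewrite E.
rewrite ge0_integralZl//; last 3 first.
- exact: measurable_ccube.
- by apply: measurable_funTS; exact: me.
- by rewrite lee_fin ltW.
rewrite det_scalar muleA -EFinM; congr (_%:E * _)%E.
rewrite powRD ?(gt_eqF hn0) ?implybT// powRr1 ?(ltW hn0)//; congr (_ * _).
rewrite !powR_exprn ?(ltW h0)//; congr powR; field; by rewrite gt_eqF.
Qed.

Lemma q_fin m : (0 < m)%N -> (q m < +oo)%E.
Proof.
move=> m0.
apply: (@le_lt_trans _ _ ((n%:R `^ p)%:E * mu Q0)%E); last first.
  by rewrite leb_ccube// -EFinM ltry.
pose z0 : 'rV[R]_n := 0.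
apply: (@le_trans _ _ (\int[mu]_(x in Q0) err e [:: z0] x)%E).
  by apply: ereal_inf_lbound; exists [:: z0].
apply: integral_le_cst => //.
- exact: measurable_ccube.
- exact: measurable_err (@measurable_e0 R n p) _.
- exact: err_ge0 (@e0_ge0 R n p) _.
move=> x Hx; apply: (@le_trans _ _ (e z0 x)%:E); first by apply: err_le_In; left.
rewrite lee_fin /e0 subr0; apply: le_powR; [exact: ltW|exact: dotr_ge0|].
apply: (le_trans (dotr_le_norm x)); rewrite ler_piMr// expr_le1//.
have := @ccube_dist R n 0 1 x 0 ler01 Hx (ccube_corner 0 ler01).
by rewrite subr0.
Qed.

Lemma le_q m m' : (m <= m')%N -> (q m' <= q m)%E.
Proof.
move=> mm; apply: le_ereal_inf_tmp => _ [s sm ->]; apply: ereal_inf_lbound.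
by exists s => //; exact: leq_trans mm.
Qed.

(** A configuration is copied at scale $1/K$ into the $K^n$ cells of the unit cube, and the errors
    sum to at most $K^n\cdot K^{-n(1+r)}=K^{-2p}$ times the original one. *)
Lemma q_self_similar K m : (0 < K)%N -> (q (K ^ n * m)%N <= (K%:R `^ (- (2 * p)))%:E * q m)%E.
Proof.
move=> K0.
have K0' : 0 < K%:R :> R by rewrite ltr0n.
have Kp : 0 < K%:R `^ (- (2 * p)) :> R by rewrite powR_gt0.
rewrite -lee_pdivrMl//; apply: le_ereal_inf_tmp => _ [s sm ->]; rewrite lee_pdivrMl//.
pose cp (k : 'rV['I_K]_n) := [seq gridpt 0 K%:R^-1 k + K%:R^-1 *: z | z <- s].
pose S := flatten [seq cp k | k <- enum {: 'rV['I_K]_n}].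
apply: (@le_trans _ _ (\int[mu]_(x in Q0) err e S x)%E).
  apply: ereal_inf_lbound; exists S => //.
  rewrite size_flatten /shape -map_comp sumnE big_map.
  under eq_bigr do rewrite /= size_map.
  rewrite big_const_seq count_predT iter_addn_0 -cardE card_mx card_ord mul1n mulnC.
  by rewrite leq_mul2l sm orbT.
have me s' := measurable_err (@measurable_e0 R n p) s'.
have er0 s' x : (0 <= err e s' x)%E := err_ge0 (@e0_ge0 R n p) s' x.
have Ki0 : 0 < K%:R^-1 :> R by rewrite invr_gt0.
have mcc (k : 'rV['I_K]_n) : measurable (ccube (gridpt (0 : 'rV[R]_n) K%:R^-1 k) K%:R^-1).
  exact: measurable_ccube.
apply: (@le_trans _ _ (\sum_(k <- enum {: 'rV['I_K]_n})
   \int[mu]_(x in ccube (gridpt 0 K%:R^-1 k) K%:R^-1) err e S x)%E).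
  apply: integral_le_cover => //; first exact: measurable_ccube.
  move=> x Hx.
  have [k Hk] : exists k : 'rV['I_K]_n, ccube (gridpt 0 K%:R^-1 k) K%:R^-1 x.
    by apply: grid_cover_closed => //; rewrite mulVf// gt_eqF.
  by exists k => //; apply: mem_In; rewrite mem_enum.
apply: (@le_trans _ _ (\sum_(k <- enum {: 'rV['I_K]_n})
   (((K%:R^-1 ^+ n) `^ (1 + r))%:E * \int[mu]_(x in Q0) err e s x))%E).
  apply: lee_sum => k _.
  apply: (@le_trans _ _ (\int[mu]_(x in ccube (gridpt 0 K%:R^-1 k) K%:R^-1) err e (cp k) x)%E).
    apply: ge0_le_integral => //; [exact: measurable_funTS|exact: measurable_funTS|].
    by move=> x _; apply: err_flatten; rewrite mem_enum.
  rewrite cube_scale// /cp -map_comp (_ : map _ s = s)//.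
  rewrite -[RHS]map_id; apply: eq_map => z /=.
  by rewrite addrC addKr scalerA mulVf ?scale1r// gt_eqF// invr_gt0.
rewrite big_const_seq count_predT -cardE card_mx card_ord mul1n.
set I := (\int[mu]_(x in Q0) err e s x)%E.
have -> : forall (c : \bar R) N, iter N (adde c) 0%E = (N%:R%:E * c)%E.
  move=> c N; elim: N => [|N IH]; first by rewrite mul0e.
  by rewrite iterS IH -natr1 EFinD ge0_muleDl ?lee_fin// mul1e addeC.
rewrite muleA -EFinM; apply: lee_wpmul2r.
  by apply: integral_ge0 => x _; exact: er0.
rewrite lee_fin le_eqVlt; apply/orP; left; apply/eqP.
rewrite natrX -powR_mulrn ?ler0n// -powR_mulrn ?(ltW Ki0)// -powR_inv1 ?(ltW K0')// -!powRrM -powRD.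
  by congr powR; field; rewrite gt_eqF.
by rewrite (gt_eqF K0') implybT.
Qed.

(** An infimum rather than a limit, so that the lower bound [zadorc_le] holds for every positive
    number of points; only the upper bound is asymptotic. *)
Definition zadorc : R := fine (ereal_inf [set z | exists2 m, (0 < m)%N & z = ((m%:R `^ r)%:E * q m)%E]).

Let qge0 m : (0 <= q m)%E. Proof. by apply: qerr_ge0 => *; exact: e0_ge0. Qed.

Lemma zadorcE : ereal_inf [set z | exists2 m, (0 < m)%N & z = ((m%:R `^ r)%:E * q m)%E] = zadorc%:E.
Proof.
rewrite /zadorc fineK// ge0_fin_numE.
  apply: (@le_lt_trans _ _ ((1%:R `^ r)%:E * q 1)%E).
    by apply: ereal_inf_lbound; exists 1%N.
  have := q_fin (ltn0Sn 0); case E : (q 1) => [z| |]// _; first by rewrite -EFinM ltry.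
  by have := qge0 1; rewrite E.
apply: le_ereal_inf_tmp => _ [m m0 ->].
by rewrite mule_ge0 ?lee_fin ?powR_ge0.
Qed.

Lemma zadorc_ge0 : 0 <= zadorc.
Proof.
rewrite -lee_fin -zadorcE; apply: le_ereal_inf_tmp => _ [m m0 ->].
by rewrite mule_ge0 ?lee_fin ?powR_ge0.
Qed.

Lemma zadorc_le m : (0 < m)%N -> (zadorc%:E <= (m%:R `^ r)%:E * q m)%E.
Proof. by move=> m0; rewrite -zadorcE; apply: ereal_inf_lbound; exists m. Qed.

(** A nearly optimal configuration of [m] points is replicated $K^n$ times, with [K] the largest
    integer such that $K^nm\le M$. The loss compared with [M] points is at most a factor
    $((K+1)/K)^{2p}$, which tends to 1. *)
Lemma zadorc_lim (eps : R) : 0 < eps ->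
  \forall m \near \oo, ((m%:R `^ r)%:E * q m <= (zadorc + eps)%:E)%E.
Proof.
move=> eps0.
have d0 := zadorc_ge0.
have [m m0 Hm] : exists2 m, (0 < m)%N & ((m%:R `^ r)%:E * q m < (zadorc + eps / 2)%:E)%E.
  have : (ereal_inf [set z | exists2 m, (0 < m)%N & z = ((m%:R `^ r)%:E * q m)%E] < (zadorc + eps / 2)%:E)%E.
    by rewrite zadorcE lte_fin; lra.
  by move=> /ereal_inf_lt[_ [m m0 ->] H]; exists m.
pose be := (zadorc + eps) / (zadorc + eps / 2).
have de : 0 < zadorc + eps / 2 by lra.
have be1 : 1 < be by rewrite ltr_pdivlMr// mul1r; lra.
pose ga := be `^ (2 * p)^-1.
have p2 : 0 < 2 * p by rewrite mulr_gt0.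
have ga1 : 1 < ga.
  have -> : 1 = 1 `^ (2 * p)^-1 :> R by rewrite powR1.
  by apply: lt_powR => //; rewrite invr_gt0.
(* From [K0] on, $1+1/K\le\mathrm{ga}$, hence $((K+1)/K)^{2p}\le\mathrm{be}$. *)
pose K0 := (Num.trunc (ga - 1)^-1).+1.
have HK0 : (ga - 1)^-1 < K0%:R by exact: truncnS_gt.
apply/near_ooP; exists (m * (K0 + 2) ^ n)%N => M HM.
have m0' : 0 < m%:R :> R by rewrite ltr0n.
pose t : R := (M%:R / m%:R) `^ n%:R^-1.
have Mm0 : 0 <= M%:R / m%:R :> R by rewrite divr_ge0.
have tn : t ^+ n = M%:R / m%:R.
  by rewrite -powR_mulrn ?powR_ge0// /t powRK_inv'.
have tK : (K0 + 2)%:R <= t.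
  have h1 : (K0 + 2)%:R ^+ n <= t ^+ n.
    by rewrite tn ler_pdivlMr// -natrX -natrM ler_nat mulnC.
  rewrite -(ler_pXn2r n0) ?nnegrE ?ler0n// /t; exact: powR_ge0.
pose K := Num.trunc t.
have t0 : 0 <= t by exact: powR_ge0.
have KK0 : (K0 <= K)%N.
  rewrite truncn_ge_nat//; apply: le_trans tK; rewrite ler_nat; exact: leq_addr.
have K0p : (0 < K)%N by exact: leq_trans KK0.
have K0' : 0 < K%:R :> R by rewrite ltr0n.
have Kt : K%:R <= t by rewrite truncn_le.
have tK1 : t < K%:R + 1 by rewrite natr1; exact: truncnS_gt.
have HM1 : (K ^ n * m <= M)%N.
  rewrite -(ler_nat R) natrM natrX -ler_pdivlMr// -tn.
  by apply: lerXn2r => //; rewrite nnegrE.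
have HM2 : M%:R <= (K%:R + 1) ^+ n * m%:R :> R.
  rewrite -ler_pdivrMr// -tn; apply: lerXn2r; rewrite ?nnegrE//; lra.
apply: (@le_trans _ _ ((M%:R `^ r)%:E * ((K%:R `^ (- (2 * p)))%:E * q m))%E).
  rewrite lee_wpmul2l ?lee_fin ?powR_ge0//.
  exact: le_trans (le_q HM1) (q_self_similar _ _).
rewrite muleA -EFinM.
apply: (@le_trans _ _ ((be * m%:R `^ r)%:E * q m)%E).
  apply: lee_wpmul2r => //; rewrite lee_fin.
  apply: (@le_trans _ _ (((K%:R + 1) ^+ n * m%:R) `^ r * K%:R `^ (- (2 * p)))).
    by rewrite ler_wpM2r ?powR_ge0//; apply: le_powR => //; exact: ltW.
  have kn : 0 <= (K%:R + 1) ^+ n :> R by rewrite exprn_ge0// addr_ge0.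
  rewrite powRM//.
  rewrite mulrAC ler_wpM2r ?powR_ge0//.
  rewrite -powR_mulrn ?addr_ge0// -powRrM (_ : n%:R * r = 2 * p); last by field; rewrite gt_eqF.
  have -> : (K%:R + 1) `^ (2 * p) * K%:R `^ (- (2 * p)) = ((K%:R + 1) / K%:R) `^ (2 * p).
    rewrite powRM ?addr_ge0 ?invr_ge0//; congr (_ * _).
    by rewrite -powR_inv1// -powRrM mulN1r.
  have -> : be = ga `^ (2 * p) by rewrite powRK_inv'//; lra.
  apply: le_powR; [exact: ltW|by rewrite divr_ge0// addr_ge0|].
  rewrite ler_pdivrMr//.
  have : (ga - 1)^-1 <= K%:R by apply: (le_trans (ltW HK0)); rewrite ler_nat.
  have g1 : 0 < ga - 1 by lra.
  rewrite -[X in X <= _]mul1r ler_pdivrMr// => h; lra.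
rewrite EFinM -muleA.
apply: (@le_trans _ _ (be%:E * (zadorc + eps / 2)%:E)%E).
  by apply: lee_wpmul2l; [rewrite lee_fin; lra|exact: ltW].
by rewrite -EFinM lee_fin /be divfK// gt_eqF.
Qed.

End cube_constant.

(** * Zador's theorem for bounded sets *)

Section zador_set.
Context {R : realType} (n : nat) (p : R).
Hypothesis n0 : (0 < n)%N.
Hypothesis p0 : 0 < p.
Local Notation mu := (@leb_mx R n).
Local Notation e := (@e0 R n p).
Local Notation r := (2 * p / n%:R).
Local Notation delta := (zadorc n p).

Let nR0 : 0 < n%:R :> R. Proof. by rewrite ltr0n. Qed.
Let r0 : 0 < r. Proof. by rewrite divr_gt0// mulr_gt0. Qed.

(** Pieces range over a subtype because the quantizers in [zador_constant] must lie in [J], while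
    integration takes place over its interior, an open set being required for the packing. *)
Definition eset (J : set 'rV[R]_n) (q : {x | J x}) (x : 'rV[R]_n) : R := e (sval q) x.

Lemma eset_ge0 J (q : {x | J x}) x : 0 <= eset q x.
Proof. exact: e0_ge0. Qed.

Lemma measurable_eset J (q : {x | J x}) : measurable_fun setT (eset q).
Proof. exact: measurable_e0. Qed.

Lemma err_eset J (s : seq {x | J x}) x : err (@eset J) s x = err e (map sval s) x.
Proof.
have := @err_map R n n _ _ (@eset J) e sval 1 s x x ltr01.
by rewrite mul1e; apply => q; rewrite mul1r.
Qed.

(** Free of asymptotics because [delta] is an infimum; the points are allowed to lie outside the
    cube. *)
Lemma cube_lower (k : nat) (a : 'rV[R]_n) (h : R) s : (0 < k)%N -> 0 < h -> (size s <= k)%N ->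
  ((delta * (h ^+ n) `^ (1 + r) * k%:R `^ (- r))%:E <= \int[mu]_(x in ccube a h) err e s x)%E.
Proof.
move=> k0 h0 sk.
have k0' : 0 < k%:R :> R by rewrite ltr0n.
rewrite cube_scale//.
apply: (@le_trans _ _ (((h ^+ n) `^ (1 + r))%:E * qerr e (ccube 0 1) k)%E); last first.
  rewrite lee_wpmul2l ?lee_fin ?powR_ge0//; apply: ereal_inf_lbound.
  by eexists; last reflexivity; rewrite size_map.
rewrite (_ : delta * _ * _ = (h ^+ n) `^ (1 + r) * (delta * k%:R `^ (- r))); last by ring.
rewrite [leLHS]EFinM lee_wpmul2l ?lee_fin ?powR_ge0//.
rewrite powRN mulrC EFinM -lee_pdivlMl ?invr_gt0 ?powR_gt0// invrK.
exact: zadorc_le.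
Qed.

(** Projection onto the cube. It does not increase the distance to points of the cube, so
    near-optimal quantizers may be taken inside it. *)
Definition clamp (a : 'rV[R]_n) (h : R) (z : 'rV[R]_n) : 'rV[R]_n :=
  \row_j Num.min (Num.max (z 0 j) (a 0 j)) (a 0 j + h).

Lemma clamp_ccube a h z : 0 <= h -> ccube a h (clamp a h z).
Proof.
move=> h0 j; rewrite mxE ge_min lexx orbT andbT le_min le_max lexx orbT/=.
by rewrite lerDl.
Qed.

Lemma clamp_le a h z x : ccube a h x -> e (clamp a h z) x <= e z x.
Proof.
move=> Hx; apply: le_powR; [exact: ltW|exact: dotr_ge0|].
apply: ler_sum => j _; rewrite !mxE -!expr2.
have /andP[x1 x2] := Hx j.
rewrite minElt maxElt; case: (ltP (z 0 j) (a 0 j)) => h1; case: ltP => h2; nra.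
Qed.

Lemma cube_upper (eps : R) : 0 < eps -> exists k0 : nat, forall k, (k0 <= k)%N ->
  forall (a : 'rV[R]_n) (h : R), 0 < h -> exists s : seq 'rV[R]_n, [/\ (size s <= k)%N,
    forall z, z \in s -> ccube a h z &
    (\int[mu]_(x in ccube a h) err e s x <=
      ((delta + eps) * (h ^+ n) `^ (1 + r) * k%:R `^ (- r))%:E)%E].
Proof.
move=> eps0; have e2 : 0 < eps / 2 by rewrite divr_gt0.
have [k0 Hk0] := (near_ooP _).2 (zadorc_lim n0 p0 e2).
exists k0.+1 => k kk a h h0.
have kp : (0 < k)%N by exact: leq_trans kk.
have k0' : 0 < k%:R :> R by rewrite ltr0n.
have Hk := Hk0 k (ltnW kk).
have [s sk Hs] : exists2 s : seq 'rV[R]_n, (size s <= k)%N &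
    (\int[mu]_(x in ccube 0 1) err e s x < ((delta + eps) * k%:R `^ (- r))%:E)%E.
  have : (qerr e (ccube 0 1) k < ((delta + eps) * k%:R `^ (- r))%:E)%E.
    apply: (@le_lt_trans _ _ ((delta + eps / 2) * k%:R `^ (- r))%:E).
      by rewrite powRN mulrC EFinM -lee_pdivrMl ?invr_gt0 ?powR_gt0// invrK.
    by rewrite lte_fin ltr_pM2r ?powR_gt0// ltrD2l; lra.
  by move=> /ereal_inf_lt[_ [s sk ->] H]; exists s.
pose s1 := [seq a + h *: z | z <- s].
exists [seq clamp a h z | z <- s1]; split.
- by rewrite !size_map.
- by move=> _ /mapP[z _ ->]; apply: clamp_ccube; exact: ltW.
have me s' := measurable_err (@measurable_e0 R n p) s'.
have er0 s' x : (0 <= err e s' x)%E := err_ge0 (@e0_ge0 R n p) s' x.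
apply: (@le_trans _ _ (\int[mu]_(x in ccube a h) err e s1 x)%E).
  apply: ge0_le_integral => //; [exact: measurable_ccube|exact: measurable_funTS|exact: measurable_funTS|].
  move=> x Hx; elim: (s1) => [|z t IH]; first by rewrite err_nil leey.
  rewrite /= !err_cons le_min !ge_min lee_fin clamp_le//=.
  by rewrite IH orbT.
rewrite cube_scale// /s1 -map_comp (_ : map _ s = s); last first.
  rewrite -[RHS]map_id; apply: eq_map => z /=.
  by rewrite addrC addKr scalerA mulVf ?scale1r// gt_eqF.
rewrite (_ : (delta + eps) * _ * _ = (h ^+ n) `^ (1 + r) * ((delta + eps) * k%:R `^ (- r))); last by ring.
rewrite [leRHS]EFinM lee_wpmul2l ?lee_fin ?powR_ge0//.
exact: ltW.
Qed.

Lemma ccube_gap (a b : 'rV[R]_n) (h : R) : 0 < h ->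
  (forall x, ccube a h x -> ccube b h x -> False) ->
  exists j (g : R), 0 < g /\ forall x y, ccube a h x -> ccube b h y -> g <= `|x 0 j - y 0 j|.
Proof.
move=> h0 dis.
have [j Hj] : exists j, h < `|a 0 j - b 0 j|.
  apply: contrapT => H.
  have Hle j : `|a 0 j - b 0 j| <= h.
    by rewrite leNgt; apply/negP => Hj; apply: H; exists j.
  (* If the corners differ by at most [h] in each coordinate, their coordinatewise maximum lies in
     both cubes. *)
  apply: (dis (\row_j Num.max (a 0 j) (b 0 j))) => j; rewrite mxE;
    have := Hle j; rewrite ler_norml => /andP[h1 h2]; rewrite maxElt;
    case: ltP => h3; apply/andP; split; lra.
exists j, (`|a 0 j - b 0 j| - h); split=> [|x y Hx Hy]; first by rewrite subr_gt0.
have /andP[x1 x2] := Hx j; have /andP[y1 y2] := Hy j.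
have [ab|ab] := lerP 0 (a 0 j - b 0 j).
  rewrite ger0_norm//; apply: le_trans (ler_norm _); lra.
rewrite ltr0_norm// distrC; apply: le_trans (ler_norm _); lra.
Qed.

(** The allocation principle with the constant weight [delta]; its limit is
    $(\delta^{1/(1+r)}V)^{1+r}=\delta V^{1+r}$. *)
Lemma zador_set_limit (J : set 'rV[R]_n) : mxbounded J ->
  ((m%:R `^ r)%:E * qerr (@eset J) J° m)%E @[m --> \oo] -->
   (delta * (fine (mu J°)) `^ (1 + r))%:E.
Proof.
move=> bJ.
have JO := @interior_subset _ J.
have oO : open J° by exact: open_interior.
have bO : mxbounded J° by have [M HM] := bJ; exists M => x /JO; exact: HM.
have mO : measurable J° by exact: open_measurable_mx.
have d0 := zadorc_ge0 n p0.
have r1 : 0 < 1 + r by move: r0; lra.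
have mest (q : {x | J x}) := @measurable_eset J q.
have LU (x0 : 'rV[R]_n) (eps : R) : J° x0 -> 0 < eps -> exists2 rho : R, 0 < rho &
  forall a (h : R), 0 < h -> (forall y, ccube a h y -> `|y - x0| < rho) ->
  exists k0 : nat, forall k, (k0 <= k)%N -> exists2 s : seq {x | J x}, (size s <= k)%N &
   (\int[mu]_(x in ccube a h) err (@eset J) s x <=
     ((delta + eps) * (h ^+ n) `^ (1 + r) * k%:R `^ (- r))%:E)%E.
  move=> Jx0 eps0.
  have /nbhs_normP[rho rho0 Hr] : nbhs x0 J by exact: Jx0.
  exists rho => // a h h0 Ha.
  have [k0 Hk0] := cube_upper eps0.
  exists k0 => k kk; have [s [sk sQ Hs]] := Hk0 k kk a h h0.
  have QJ z : ccube a h z -> J z by move=> /Ha /Hr.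
  have [s' s'E] : exists s' : seq {x | J x}, map sval s' = s.
    by apply: lift_sig_seq => z /sQ /QJ.
  exists s'; first by rewrite -(size_map sval) s'E.
  by under eq_integral do rewrite err_eset s'E.
have LL (x0 : 'rV[R]_n) (eps : R) : J° x0 -> 0 < eps -> exists2 rho : R, 0 < rho &
  forall a (h : R), 0 < h -> (forall y, ccube a h y -> `|y - x0| < rho) ->
  exists k0 : nat, forall k, (k0 <= k)%N -> forall s : seq {x | J x}, (size s <= k)%N ->
   (((delta - eps) * (h ^+ n) `^ (1 + r) * k%:R `^ (- r))%:E <=
    \int[mu]_(x in ccube a h) err (@eset J) s x)%E.
  move=> Jx0 eps0; exists 1 => // a h h0 _; exists 1%N => k k0 s sk.
  under eq_integral do rewrite err_eset.
  apply: le_trans (cube_lower a k0 h0 (_ : (size (map sval s) <= k)%N)); last by rewrite size_map.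
  by rewrite lee_fin ler_wpM2r ?powR_ge0// ler_wpM2r ?powR_ge0//; lra.
have SEP (a b : 'rV[R]_n) (h : R) : 0 < h -> ccube a h `<=` J° -> ccube b h `<=` J° ->
  (forall x, ccube a h x -> ccube b h x -> False) ->
  exists2 tau : R, 0 < tau & forall (q : {x | J x}) x y, ccube a h x -> ccube b h y ->
    eset q x < tau -> eset q y < tau -> False.
  move=> h0 _ _ dis; have [j [g [g0 Hg]]] := ccube_gap h0 dis.
  (* An error below this value puts [z] within $g/2$ of the point in the coordinate [j]; this cannot
     happen for two points that are at least [g] apart in that coordinate. *)
  exists (((g / 2) ^+ 2) `^ p); first by rewrite powR_gt0// exprn_gt0// divr_gt0.
  move=> [z Jz] x y Hx Hy /= ex ey.
  have key w : e z w < ((g / 2) ^+ 2) `^ p -> `|w 0 j - z 0 j| < g / 2.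
    move=> H; rewrite ltNge; apply/negP => H'; move: H; rewrite ltNge => /negP; apply.
    apply: le_powR; [exact: ltW|exact: sqr_ge0|].
    apply: le_trans (coord_le_dotr (w - z) j); rewrite !mxE.
    by rewrite -[leRHS]real_normK ?num_real// lerXn2r ?nnegrE// divr_ge0// ltW.
  have := Hg x y Hx Hy.
  have -> : x 0 j - y 0 j = (x 0 j - z 0 j) - (y 0 j - z 0 j) by ring.
  rewrite leNgt => /negP; apply; rewrite (le_lt_trans (ler_normB _ _))//.
  by rewrite (splitr g) ltrD// key.
have GU : exists2 C : R, 0 <= C & forall k, (0 < k)%N ->
  exists2 s : seq {x | J x}, (size s <= k)%N & forall x, J° x -> (err (@eset J) s x <= (C * k%:R `^ (- r))%:E)%E.
  have [|C C0 HC] := @net_lemma R n {x | J x} sval n0.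
    by have [M HM] := bJ; exists M => _ [[z Jz] _ <-]; exact: HM.
  exists ((n%:R * C ^+ 2) `^ p); first exact: powR_ge0.
  move=> k k0; have [s sk Hs] := HC k k0; exists s => // x /JO Jx.
  have [q qs Hq] := Hs (exist _ x Jx).
  apply: (le_trans (err_le_In _ _ qs)); rewrite lee_fin.
  pose D : R := k%:R `^ (- n%:R^-1).
  have D0 : 0 <= D by exact: powR_ge0.
  have -> : k%:R `^ (- r) = (D ^+ 2) `^ p.
    rewrite powR_exprn// /D -powRrM; congr powR; field; by rewrite gt_eqF.
  have -> : (n%:R * C ^+ 2) `^ p * (D ^+ 2) `^ p = (n%:R * (C * D) ^+ 2) `^ p.
    rewrite -powRM ?sqr_ge0//; last by rewrite mulr_ge0// sqr_ge0.
    by congr powR; ring.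
  apply: le_powR; [exact: ltW|exact: dotr_ge0|].
  apply: (le_trans (dotr_le_norm _)); rewrite ler_wpM2l// lerXn2r ?nnegrE//.
  by rewrite mulr_ge0.
have wc : {in (J° : set 'rV[R]_n), continuous (cst delta : 'rV[R]_n -> R)} by move=> x _; exact: cst_continuous.
have := @abstract_limit R n {x | J x} J° (@eset J) r (cst delta) r0 oO bO
  (@eset_ge0 J) mest wc (fun x _ => d0) LU LL SEP GU.
have sg0 : 0 <= delta `^ (1 + r)^-1 by exact: powR_ge0.
have -> : wint J° r (cst delta) = (delta `^ (1 + r)^-1 * fine (mu J°))%:E.
  rewrite /wint /= integral_cst// EFinM fineK// ge0_fin_numE//.
  exact: leb_mx_fin.
move=> [_]; rewrite /= powRM ?fine_ge0// powRK_inv'//.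
Qed.

End zador_set.

(** * Calculus of C2 functions *)

Section calculus.
Context {R : realType}.

Lemma is_derive_cvg (f : R -> R) (x df : R) :
  (forall eps : R, 0 < eps -> exists2 rho : R, 0 < rho & forall h : R, h != 0 -> `|h| < rho ->
     `|f (x + h) - f x - h * df| <= eps * `|h|) -> is_derive x 1 f df.
Proof.
move=> H.
have C : h^-1 *: ((f \o shift x) (h *: (1 : R)) - f x) @[h --> 0^'] --> df.
  apply/cvgrPdist_le => eps eps0; have [rho rho0 Hr] := H eps eps0.
  near=> h.
  have hn0 : h != 0 by near: h; exact: nbhs_dnbhs_neq.
  have hr : `|h| < rho by near: h; apply: dnbhs0_lt.
  have := Hr h hn0 hr.
  rewrite /= /shift /= [h *: 1]mulr1 [h + x]addrC => Hh.
  have -> : df - h^-1 *: (f (x + h) - f x) = - (h^-1 * (f (x + h) - f x - h * df)).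
    by rewrite /GRing.scale /=; field.
  by rewrite normrN normrM normfV ler_pdivrMl ?normr_gt0// [leRHS]mulrC.
by apply: DeriveDef; [exact: cvgP C|exact: cvg_lim C].
Unshelve. all: end_near. Qed.

(* [d > 0] is what yields strict convexity when [g'' > 0]. *)
Lemma second_order_mvt (g g' g'' : R -> R) (t : R) : 0 < t -> t < 1 ->
  (forall s : R, 0 <= s -> s <= 1 -> is_derive s 1 g (g' s)) ->
  (forall s : R, 0 <= s -> s <= 1 -> is_derive s 1 g' (g'' s)) ->
  exists xi d : R, [/\ 0 <= xi, xi <= 1, 0 < d &
    (1 - t) * g 0 + t * g 1 - g t = d * g'' xi].
Proof.
move=> t0 t1 Hg Hg'.
have cg (a b : R) : 0 <= a -> b <= 1 -> {within `[a, b], continuous g}.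
  move=> a0 b1; apply: derivable_within_continuous => x; rewrite in_itv/= => /andP[ax xb].
  by have := Hg x (le_trans a0 ax) (le_trans xb b1); case.
have cg' (a b : R) : 0 <= a -> b <= 1 -> {within `[a, b], continuous g'}.
  move=> a0 b1; apply: derivable_within_continuous => x; rewrite in_itv/= => /andP[ax xb].
  by have := Hg' x (le_trans a0 ax) (le_trans xb b1); case.
have dg (a b x : R) : 0 <= a -> b <= 1 -> x \in `]a, b[ -> is_derive x 1 g (g' x).
  move=> a0 b1; rewrite in_itv/= => /andP[ax xb].
  by apply: Hg; [exact: le_trans a0 (ltW ax)|exact: le_trans (ltW xb) b1].
have dg' (a b x : R) : 0 <= a -> b <= 1 -> x \in `]a, b[ -> is_derive x 1 g' (g'' x).
  move=> a0 b1; rewrite in_itv/= => /andP[ax xb].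
  by apply: Hg'; [exact: le_trans a0 (ltW ax)|exact: le_trans (ltW xb) b1].
have [c1] := MVT t0 (fun x => dg 0 t x (lexx _) (ltW t1)) (cg 0 t (lexx _) (ltW t1)).
rewrite in_itv/= => /andP[c10 c1t] E1.
have [c2] := MVT t1 (fun x => dg t 1 x (ltW t0) (lexx _)) (cg t 1 (ltW t0) (lexx _)).
rewrite in_itv/= => /andP[c2t c21] E2.
have c12 : c1 < c2 by exact: lt_trans c1t c2t.
have [xi] := MVT c12 (fun x => dg' c1 c2 x (ltW c10) (ltW c21)) (cg' c1 c2 (ltW c10) (ltW c21)).
rewrite in_itv/= => /andP[x1 x2] E3.
exists xi, (t * (1 - t) * (c2 - c1)); split.
- by rewrite (le_trans (ltW c10))// ltW.
- by rewrite (le_trans (ltW x2))// ltW.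
- by rewrite !mulr_gt0// subr_gt0.
have -> : (1 - t) * g 0 + t * g 1 - g t = t * (g 1 - g t) - (1 - t) * (g t - g 0) by ring.
rewrite E1 E2.
have -> : t * (1 - t) * (c2 - c1) * g'' xi = t * (1 - t) * (g'' xi * (c2 - c1)) by ring.
by rewrite -E3; ring.
Qed.

(** [second_order_mvt] only tells that the factor [d] is positive, not its value. Subtracting a
    quadratic whose second derivative is the bound reduces both inequalities to a question of
    sign. *)
Lemma quadratic_convexity (g g' g'' : R -> R) (k1 k2 t : R) : 0 <= t -> t <= 1 ->
  (forall s : R, 0 <= s -> s <= 1 -> is_derive s 1 g (g' s)) ->
  (forall s : R, 0 <= s -> s <= 1 -> is_derive s 1 g' (g'' s)) ->
  (forall s : R, 0 <= s -> s <= 1 -> k1 <= g'' s <= k2) ->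
  k1 * (t * (1 - t) / 2) <= (1 - t) * g 0 + t * g 1 - g t <= k2 * (t * (1 - t) / 2).
Proof.
move=> t0 t1 Hg Hg' Hk.
have [->|tn0] := eqVneq t 0; first by rewrite !(subr0, mul0r, mul1r, addr0, mulr0, subrr) lexx.
have [->|tn1] := eqVneq t 1; first by rewrite !(subrr, mul0r, mul1r, add0r, mulr0) lexx.
have tp : 0 < t by rewrite lt_neqAle eq_sym tn0.
have tl : t < 1 by rewrite lt_neqAle tn1.
(* The sign [c] is 1 for the lower bound and -1 for the upper one. *)
have key (k c : R) :
    (forall s : R, 0 <= s -> s <= 1 -> 0 <= c * g'' s - k) ->
    k * (t * (1 - t) / 2) <= c * ((1 - t) * g 0 + t * g 1 - g t).
  move=> Hc.
  pose G (s : R) := c * g s - k / 2 * (s * s).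
  pose G' (s : R) := c * g' s - k * s.
  have dG (s : R) : 0 <= s -> s <= 1 -> is_derive s 1 G (G' s).
    move=> s0 s1; have Hs := Hg s s0 s1.
    have : is_derive s 1 (c *: g - (k / 2) *: ((@id R) * (@id R))) (c *: g' s - (k / 2) *: (s *: 1 + s *: 1)).
      by apply: is_deriveB.
    rewrite (_ : _ - _ = G' s); last by rewrite /G' /GRing.scale /=; field.
    by [].
  have dG' (s : R) : 0 <= s -> s <= 1 -> is_derive s 1 G' (c * g'' s - k).
    move=> s0 s1; have Hs := Hg' s s0 s1.
    have : is_derive s 1 (c *: g' - k *: (@id R)) (c *: g'' s - k *: 1).
      by apply: is_deriveB.
    rewrite (_ : _ - _ = c * g'' s - k); last by rewrite /GRing.scale /= mulr1.
    by [].
  have [xi [d [x0 x1 d0 E]]] := second_order_mvt tp tl dG dG'.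
  have : 0 <= d * (c * g'' xi - k) by rewrite mulr_ge0 ?(ltW d0)//; exact: Hc.
  rewrite -E /G; lra.
apply/andP; split.
  have := key k1 1; rewrite !mul1r; apply => s s0 s1; rewrite mul1r subr_ge0.
  by have /andP[] := Hk s s0 s1.
have := key (- k2) (-1); rewrite !mulN1r mulNr lerN2; apply => s s0 s1.
by rewrite mulN1r opprK addrC subr_ge0; have /andP[] := Hk s s0 s1.
Qed.

End calculus.

Section multivariate.
Context {R : realType} {n : nat}.
Implicit Types (f : 'rV[R]_n -> R) (x y v : 'rV[R]_n).

Lemma norm_scale_ebase (s : R) (i : 'I_n) : `|s *: ebase R i| <= `|s|.
Proof.
apply/(mx_norm_leP _ (normr_ge0 _)) => a b; rewrite !mxE.
by case: eqP; case: eqP => _ _; rewrite /= ?mulr1 ?mulr0 ?normr0.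
Qed.

Lemma derivable_line f x v (s : R) : derivable f (x + s *: v) v ->
  is_derive s 1 (fun t : R => f (x + t *: v)) ('D_v f (x + s *: v)).
Proof.
move=> df.
have E : (fun h : R => h^-1 *: (((fun t : R => f (x + t *: v)) \o shift s) (h *: (1 : R)) - f (x + s *: v))) =
   (fun h : R => h^-1 *: ((f \o shift (x + s *: v)) (h *: v) - f (x + s *: v))).
  apply/funext => h; congr (_ *: (f _ - _)); rewrite /= [h *: 1]mulr1 scalerDl.
  by rewrite addrCA.
apply: DeriveDef; first by rewrite /derivable E.
by rewrite /derive E.
Qed.

Lemma coord_mvt f x (i : 'I_n) (s : R) :
  (forall t : R, `|t| <= `|s| -> derivable f (x + t *: ebase R i) (ebase R i)) ->
  exists2 t : R, `|t| <= `|s| & f (x + s *: ebase R i) - f x = s * pderiv f i (x + t *: ebase R i).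
Proof.
move=> df.
pose phi (t : R) := f (x + t *: ebase R i).
have dphi (t : R) : `|t| <= `|s| -> is_derive t 1 phi (pderiv f i (x + t *: ebase R i)).
  by move=> /df; exact: derivable_line.
have f0 : f x = phi 0 by rewrite /phi scale0r addr0.
have [s0|s0|s0] := ltgtP s 0.
- have nb (t : R) : t \in `[s, 0] -> `|t| <= `|s|.
    rewrite in_itv/= => /andP[h1 h2]; rewrite (ltr0_norm s0) ler_norml.
    by apply/andP; split; lra.
  have [c cs E] : exists2 c : R, c \in `]s, 0[ & phi 0 - phi s = pderiv f i (x + c *: ebase R i) * (0 - s).
    apply: MVT => //.
      move=> t ts; apply: dphi; apply: nb; move: ts; rewrite !in_itv/= => /andP[/ltW-> /ltW->].
      by [].
    apply: derivable_within_continuous => t /nb /dphi; by case.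
  exists c; first by apply: nb; move: cs; rewrite !in_itv/= => /andP[/ltW-> /ltW->].
  rewrite f0 -/(phi s); move: E; lra.
- have nb (t : R) : t \in `[0, s] -> `|t| <= `|s|.
    rewrite in_itv/= => /andP[h1 h2]; rewrite (gtr0_norm s0) ler_norml.
    by apply/andP; split; lra.
  have [c cs E] : exists2 c : R, c \in `]0, s[ & phi s - phi 0 = pderiv f i (x + c *: ebase R i) * (s - 0).
    apply: MVT => //.
      move=> t ts; apply: dphi; apply: nb; move: ts; rewrite !in_itv/= => /andP[/ltW-> /ltW->].
      by [].
    apply: derivable_within_continuous => t /nb /dphi; by case.
  exists c; first by apply: nb; move: cs; rewrite !in_itv/= => /andP[/ltW-> /ltW->].
  rewrite f0 -/(phi s) E; lra.
- exists 0; first by rewrite normr0.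
  by rewrite s0 scale0r addr0 subrr mul0r.
Qed.

Lemma addrrKA x y v : x + y + v - x = y + v.
Proof. by rewrite -[x + y + v]addrA [x + _]addrC addrK. Qed.

Definition C1_at f (O : set 'rV[R]_n) :=
  (forall i x, O x -> derivable f x (ebase R i)) /\
  (forall i, {in O, continuous (pderiv f i)}).

Definition grad f x : 'rV[R]_n := \row_i pderiv f i x.

(** The increment is taken one coordinate at a time; on each edge the mean value theorem evaluates a
    partial derivative at a point near [x], where continuity applies. Total differentiability is
    thus recovered from the partial derivatives that [C2_on] speaks of. *)
Lemma C1_diff f O x : open O -> C1_at f O -> O x -> forall eps : R, 0 < eps ->
  exists2 rho : R, 0 < rho & forall y, `|y - x| < rho ->
    `|f y - f x - dotr (grad f x) (y - x)| <= eps * `|y - x|.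
Proof.
move=> oO [df cf] Ox eps eps0.
pose ep := eps / (n%:R + 1).
have n1 : 0 < n%:R + 1 :> R by rewrite ltr_wpDl.
have ep0 : 0 < ep by rewrite divr_gt0.
have /nbhs_normP[r0 r00 Hr0] : nbhs x O by exact: open_nbhs_nbhs.
have [r1 r10 Hr1] : exists2 r1 : R, 0 < r1 & forall i, i \in enum 'I_n ->
    forall y, `|y - x| < r1 -> `|pderiv f i y - pderiv f i x| <= ep.
  apply: exists_small_seq.
    by move=> i t t' Ht t'0 t't y yx; apply: Ht; exact: lt_le_trans yx t't.
  move=> i _.
  have ci : {for x, continuous (pderiv f i)} by apply: cf; rewrite inE.
  have /nbhs_normP[r rp Hr] : nbhs x [set y | `|pderiv f i x - pderiv f i y| < ep].
    by have /cvgrPdist_lt/(_ ep ep0) := ci.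
  by exists r => // y /Hr /ltW; rewrite distrC.
exists (Num.min r0 r1); first by rewrite lt_min r00.
move=> y; rewrite lt_min => /andP[y0 y1].
pose v := y - x.
pose pv k : 'rV[R]_n := \row_j (if (j < k)%N then v 0 j else 0).
have pvS (i : 'I_n) : pv i.+1 = pv i + v 0 i *: ebase R i.
  apply/rowP => j; rewrite !mxE ltnS leq_eqVlt eqxx/= /ebase.
  have [->|ji] := eqVneq j i; first by rewrite eqxx ltnn/= mulr1 add0r.
  by rewrite val_eqE (negbTE ji) mulr0 addr0.
have pv0 : pv 0%N = 0 by apply/rowP => j; rewrite !mxE.
have pvn : pv n = v by apply/rowP => j; rewrite !mxE ltn_ord.
have pvle k (i : 'I_n) (t : R) : (k <= i)%N -> `|t| <= `|v 0 i| -> `|pv k + t *: ebase R i| <= `|v|.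
  move=> ki tv; apply/(mx_norm_leP _ (normr_ge0 _)) => a b; rewrite (ord1 a) !mxE eqxx/=.
  have [->|bi] := eqVneq b i.
    rewrite ltnNge ki/= add0r mulr1; exact: le_trans tv (coord_le_norm _ _ _).
  rewrite mulr0 addr0; case: ifP => _; last by rewrite normr0.
  by have := coord_le_norm v 0 b; rewrite !mxE.
have /choice[T HT] : forall i : 'I_n, exists t : R, `|t| <= `|v 0 i| /\
    f (x + pv i.+1) - f (x + pv i) = v 0 i * pderiv f i (x + pv i + t *: ebase R i).
  move=> i; have [|t tv E] := @coord_mvt f (x + pv i) i (v 0 i).
    move=> t tv; apply: df; apply: Hr0.
    rewrite addrrKA; apply: le_lt_trans y0; exact: pvle.
  by exists t; split=> //; rewrite pvS addrA.
have E : f y - f x = \sum_(i < n) v 0 i * pderiv f i (x + pv i + T i *: ebase R i).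
  have -> : f y - f x = f (x + pv n) - f (x + pv 0%N).
    by rewrite pvn pv0 addr0 /v [x + _]addrC subrK.
  rewrite -(telescope_sumr (fun k => f (x + pv k))) // big_mkord.
  by apply: eq_bigr => i _; have [_ ->] := HT i.
rewrite E /dotr -/v -sumrB.
apply: (le_trans (ler_norm_sum _ _ _)).
apply: (@le_trans _ _ (\sum_(i < n) (`|v| * ep))).
  apply: ler_sum => i _; rewrite /grad mxE [X in _ - X]mulrC -mulrBr normrM.
  apply: ler_pM => //; first exact: coord_le_norm.
  apply: Hr1; first by rewrite mem_enum.
  rewrite addrrKA; apply: le_lt_trans y1; apply: pvle => //.
  by have [] := HT i.
rewrite sumr_const card_ord -mulr_natr -mulrA mulrC ler_wpM2r// /ep mulrAC ler_pdivrMr//.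
by rewrite ler_pM2l//; lra.
Qed.

Lemma C1_continuous f O x : open O -> C1_at f O -> O x -> {for x, continuous f}.
Proof.
move=> oO cf Ox A /nbhs_ballP[eps /= eps0 HA].
have [rho rho0 H] := C1_diff oO cf Ox (ltr01).
pose M := \sum_(i < n) `|pderiv f i x|.
have M0 : 0 <= M by apply: sumr_ge0.
have M2 : 0 < M + 1 by lra.
pose d := Num.min rho (eps / (M + 1)) : R.
have d0 : 0 < d by rewrite lt_min rho0 divr_gt0.
apply/nbhs_normP; exists d => // y; rewrite lt_min => /andP[y1 y2]; apply: HA; rewrite /ball /=.
have := H y y1.
have D : `|dotr (grad f x) (y - x)| <= M * `|y - x|.
  rewrite /dotr mulr_suml (le_trans (ler_norm_sum _ _ _))//; apply: ler_sum => i _.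
  by rewrite mxE normrM ler_wpM2l// coord_le_norm.
move=> H1; rewrite distrC.
have -> : f y - f x = (f y - f x - dotr (grad f x) (y - x)) + dotr (grad f x) (y - x) by rewrite subrK.
apply: (le_lt_trans (ler_normD _ _)); apply: (le_lt_trans (lerD H1 D)).
by rewrite -mulrDl [1 + M]addrC mulrC -ltr_pdivlMr.
Qed.

Lemma C1_is_derive_line f O x v (s : R) : open O -> C1_at f O -> O (x + s *: v) ->
  is_derive s 1 (fun t : R => f (x + t *: v)) (dotr (grad f (x + s *: v)) v).
Proof.
move=> oO cf Ox; apply: is_derive_cvg => eps eps0.
pose M := `|v| + 1.
have M0 : 0 < M by rewrite /M ltr_wpDl.
have [rho rho0 H] := C1_diff oO cf Ox (divr_gt0 eps0 M0).
exists (rho / M); first by rewrite divr_gt0.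
move=> h hn0; rewrite ltr_pdivlMr// => hr.
have E : x + (s + h) *: v - (x + s *: v) = h *: v.
  by rewrite scalerDl opprD addrACA subrr add0r addrAC subrr add0r.
have hv : `|h *: v| <= `|h| * M by rewrite normrZ ler_wpM2l// lerDl.
have := H (x + (s + h) *: v); rewrite E => /(_ (le_lt_trans hv hr)).
rewrite dotrC dotrZl dotrC => /le_trans; apply.
rewrite mulrAC ler_pdivrMr// -mulrA ler_wpM2l ?(ltW eps0)//.
Qed.

Lemma C2_C1 f O : C2_on f O -> C1_at f O /\ forall j, C1_at (pderiv f j) O.
Proof.
move=> [_ [H1 [H2 [H3 H4]]]]; split; first exact: (conj H1 H2).
by move=> j; apply: conj => [i x Ox|i]; [apply: H3|apply: H4].
Qed.

Lemma hessian_line f O x v (s : R) : C2_on f O -> O (x + s *: v) ->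
  is_derive s 1 (fun t : R => dotr (grad f (x + t *: v)) v)
    ((v *m hessian f (x + s *: v) *m v^T) 0 0).
Proof.
move=> H Ox; have oO := H.1; have [_ Hj] := C2_C1 H.
have D j := C1_is_derive_line oO (Hj j) Ox.
have : is_derive s 1 (\sum_(j < n) (v 0 j *: (fun t : R => pderiv f j (x + t *: v))))
   (\sum_(j < n) (v 0 j *: dotr (grad (pderiv f j) (x + s *: v)) v)).
  by apply: is_derive_sum => j.
rewrite (_ : \sum_(j < n) _ = (fun t : R => dotr (grad f (x + t *: v)) v)); last first.
  apply/funext => t; rewrite fct_sumE /dotr; apply: eq_bigr => j _.
  by rewrite mxE mulrC.
rewrite (_ : \sum_(j < n) _ = (v *m hessian f (x + s *: v) *m v^T) 0 0)//.
rewrite !mxE; apply: eq_bigr => j _; rewrite mulrC !mxE; congr (_ * _).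
by apply: eq_bigr => i _; rewrite !mxE mulrC.
Qed.

Lemma pderiv_shift f (c : 'rV[R]_n) i x : derivable f (x + c) (ebase R i) ->
  derivable (fun z => f (z + c)) x (ebase R i) /\
  pderiv (fun z => f (z + c)) i x = pderiv f i (x + c).
Proof.
move=> df.
have E : (fun h : R => h^-1 *: (((fun z => f (z + c)) \o shift x) (h *: ebase R i) - f (x + c))) =
   (fun h : R => h^-1 *: ((f \o shift (x + c)) (h *: ebase R i) - f (x + c))).
  by apply/funext => h /=; rewrite addrA.
by split; [rewrite /derivable E|rewrite /pderiv /derive E].
Qed.

(** Mean value theorem twice: in direction [i] for $F(z)=f(z+he_j)-f(z)$, then in direction [j] for
    the partial derivative. The left side is symmetric in [i] and [j]. *)
Lemma second_difference f O x (i j : 'I_n) (d h : R) : C2_on f O -> 0 < h ->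
  h < d / 2 -> (forall y, `|y - x| < d -> O y) ->
  exists2 y, `|y - x| <= 2 * h &
   f (x + h *: ebase R i + h *: ebase R j) - f (x + h *: ebase R i) - f (x + h *: ebase R j) + f x
   = h ^+ 2 * pderiv (pderiv f i) j y.
Proof.
move=> H h0 hd HO; have [[df _] Hj] := C2_C1 H.
have ah : `|h| = h by rewrite gtr0_norm.
have bnd (a b : R) : `|a| <= h -> `|b| <= h ->
    `|x + a *: ebase R i + b *: ebase R j - x| <= 2 * h.
  move=> ha hb; rewrite addrrKA (le_trans (ler_normD _ _))// mulr2n mulrDl mul1r.
  by rewrite lerD// (le_trans (norm_scale_ebase _ _)).
have bO (a b : R) : `|a| <= h -> `|b| <= h -> O (x + a *: ebase R i + b *: ebase R j).
  by move=> ha hb; apply: HO; rewrite (le_lt_trans (bnd a b ha hb))//; lra.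
have bO0 (a : R) : `|a| <= h -> O (x + a *: ebase R i).
  by move=> ha; rewrite -[X in O X]addr0 -(scale0r (ebase R j)); apply: bO; rewrite ?normr0 ?(ltW h0).
pose F z := f (z + h *: ebase R j) - f z.
have dF (a : R) : `|a| <= h -> derivable F (x + a *: ebase R i) (ebase R i) /\
    pderiv F i (x + a *: ebase R i) = pderiv f i (x + a *: ebase R i + h *: ebase R j) - pderiv f i (x + a *: ebase R i).
  move=> ha.
  have d1 := df i _ (bO0 a ha).
  have [d2 e2] := pderiv_shift (df i _ (bO a h ha (ltac:(by rewrite ah)))).
  split; first exact: derivableB.
  by rewrite -e2 /pderiv -deriveB.
have [|a ha E1] := @coord_mvt F x i h; first by move=> a; rewrite ah => /dF[].
rewrite ah in ha.
have [|b hb E2] := @coord_mvt (pderiv f i) (x + a *: ebase R i) j h.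
  by move=> b; rewrite ah => hb; apply: (Hj i).1; exact: bO.
rewrite ah in hb.
exists (x + a *: ebase R i + b *: ebase R j); first exact: bnd.
have [_ E3] := dF a ha; rewrite E3 E2 in E1.
rewrite expr2 -mulrA -E1 /F; ring.
Qed.

Lemma continuous_norm f x (eps : R) : {for x, continuous f} -> 0 < eps ->
  exists2 r : R, 0 < r & forall y, `|y - x| < r -> `|f y - f x| < eps.
Proof.
move=> cf e0; have /nbhs_normP[r rp Hr] : nbhs x [set y | `|f x - f y| < eps].
  by have /cvgrPdist_lt/(_ _ e0) := cf.
by exists r => // y /Hr; rewrite distrC.
Qed.

(** The symmetric second difference divided by $h^2$ is a value of either mixed derivative near [x],
    and both are continuous. The symmetry of the Hessian serves for its Cholesky factorization. *)
Lemma schwarz_pderiv f O x (i j : 'I_n) : C2_on f O -> O x ->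
  pderiv (pderiv f i) j x = pderiv (pderiv f j) i x.
Proof.
move=> H Ox; have oO := H.1.
have cH a b : {for x, continuous (pderiv (pderiv f a) b)}.
  by case: H => _ [_ [_ [_ H4]]]; apply: H4; rewrite inE.
apply/eqP; rewrite -subr_eq0 -normr_le0; apply/ler_addgt0Pr => eps eps0; rewrite add0r.
have /nbhs_normP[d d0 HO] : nbhs x O by exact: open_nbhs_nbhs.
have e2 : 0 < eps / 2 by rewrite divr_gt0.
have [r1 r10 H1] := continuous_norm (cH i j) e2.
have [r2 r20 H2] := continuous_norm (cH j i) e2.
have [h [h0 hd hr1 hr2]] : exists h : R, [/\ 0 < h, h < d / 2, 2 * h < r1 & 2 * h < r2].
  clear - d0 r10 r20; pose m := Num.min d (Num.min r1 r2).
  have m0 : 0 < m by rewrite !lt_min d0 r10 r20.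
  have md : m <= d by rewrite ge_min lexx.
  have m1 : m <= r1 by rewrite !ge_min lexx orbT.
  have m2 : m <= r2 by rewrite !ge_min lexx !orbT.
  by exists (m / 4); split; lra.
have [y yx Ey] := @second_difference f O x i j d h H h0 hd HO.
have [z zx Ez] := @second_difference f O x j i d h H h0 hd HO.
have yz : pderiv (pderiv f i) j y = pderiv (pderiv f j) i z.
  have h2 : h ^+ 2 != 0 by rewrite expf_neq0// gt_eqF.
  have Exy : x + h *: ebase R i + h *: ebase R j = x + h *: ebase R j + h *: ebase R i.
    by rewrite addrAC.
  have swap (a b c g w1 w2 : R) : a - b - c + g = h ^+ 2 * w1 ->
      a - c - b + g = h ^+ 2 * w2 -> w1 = w2.
    by rewrite [a - c - b]addrAC => -> /(mulfI h2).
  rewrite Exy in Ey; exact: swap Ey Ez.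
have Hy := H1 y (le_lt_trans yx hr1).
have Hz := H2 z (le_lt_trans zx hr2).
move: Hy Hz; rewrite yz; clear.
move: (pderiv (pderiv f i) j x) (pderiv (pderiv f j) i x) (pderiv _ _ z) => a b c.
by rewrite !ltr_norml ler_norml => /andP[? ?] /andP[? ?]; apply/andP; split; lra.
Qed.

Lemma schwarz f O x : C2_on f O -> O x -> (hessian f x)^T = hessian f x.
Proof. by move=> H Ox; apply/matrixP => i j; rewrite !mxE (schwarz_pderiv _ _ H Ox). Qed.

End multivariate.

(** * Jordan sets and parallelepipeds *)

Section err_extra.
Context {R : realType} {n : nat} {P : Type}.
Variable e : P -> 'rV[R]_n -> R.

Lemma err_eq (v : R) s x : (exists2 q, List.In q s & e q x = v) ->
  (forall q, List.In q s -> v <= e q x) -> err e s x = v%:E.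
Proof.
move=> [q qs <-] H; apply/eqP; rewrite eq_le err_le_In//=.
by apply: le_err => q' /H; rewrite lee_fin.
Qed.

Lemma err_sub s t x : (forall q, List.In q s -> List.In q t) -> (err e t x <= err e s x)%E.
Proof. by move=> H; apply: le_err => q /H; exact: err_le_In. Qed.

End err_extra.

Lemma In_mem (T : eqType) (x : T) (s : seq T) : List.In x s -> x \in s.
Proof. by elim: s => //= y s IH [->|/IH]; rewrite inE ?eqxx// => ->; rewrite orbT. Qed.

Lemma bigmin_attained {R : realType} k (F : 'I_k.+1 -> R) :
  exists i, \big[Num.min/F ord0]_(j < k.+1) F j = F i.
Proof.
elim/big_ind : _; first by exists ord0.
  by move=> _ _ [i ->] [j ->]; rewrite minEle; case: ifP => _; [exists i|exists j].
by move=> i _; exists i.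
Qed.

Lemma bigmin_err {R : realType} {n : nat} {P : Type} (e : P -> 'rV[R]_n -> R) k
    (Q : 'I_k.+1 -> P) x :
  (\big[Num.min/e (Q ord0) x]_(i < k.+1) e (Q i) x)%:E =
  err e [seq Q i | i <- enum 'I_k.+1] x.
Proof.
apply/esym/err_eq.
  have [i ->] := bigmin_attained (fun i => e (Q i) x).
  by exists (Q i) => //; apply: List.in_map; apply: mem_In; rewrite mem_enum.
move=> q /List.in_map_iff[i [<- _]].
exact: (bigmin_le_cond (e (Q ord0) x) (P := xpredT) (fun i => e (Q i) x)).
Qed.

Section set_measure.
Context {R : realType} {n : nat}.
Local Notation mu := (@leb_mx R n).

Lemma compact_mxbounded (K : set 'rV[R]_n) : compact K -> mxbounded K.
Proof.
by move=> /compact_bounded [M [_ HM]]; exists (M + 1) => x Kx; apply: (HM (M + 1)) => //; rewrite ltrDl.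
Qed.

Lemma compact_measurable_mx (K : set 'rV[R]_n) : compact K -> measurable K.
Proof.
move=> cK; apply: closed_measurable_mx; exact: compact_closed.
Qed.

Lemma integral_interior (K : set 'rV[R]_n) (f : 'rV[R]_n -> \bar R) :
  measurable K -> mu (K `\` K°) = 0%E -> measurable_fun K f -> (forall x, 0 <= f x)%E ->
  (\int[mu]_(x in K) f x = \int[mu]_(x in K°) f x)%E.
Proof.
move=> mK N0 mf f0; rewrite (ge0_negligible_integral _ mK mf _ N0)//.
  by rewrite setDD setIidr//; exact: interior_subset.
by apply: measurableD => //; apply: open_measurable_mx; exact: open_interior.
Qed.

Lemma measure_interior (K : set 'rV[R]_n) : measurable K -> mu (K `\` K°) = 0%E ->
  mu K = mu K°.
Proof.
move=> mK N0; have := integral_interior mK N0 (f := cst 1%E) (measurable_cst _) (fun _ => lee01).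
by rewrite !integral_cst ?mul1e//; apply: open_measurable_mx; exact: open_interior.
Qed.

Lemma convex_boundary_null (K : set 'rV[R]_n) : measurable K -> mxconvex K ->
  mu (K `\` K°) = 0%E.
Proof.
move=> mK cK; rewrite /leb_mx -[RHS](iint0 n); apply: (iint_inull (convex_boundary_inull cK)).
- by move=> x; rewrite lee_fin.
- by [].
- by move=> x Nx; rewrite indicE memNset.
Qed.

End set_measure.

(** * Zador's theorem for Jordan compact sets *)

Section zador_theorem.
Context {R : realType} (n : nat) (p : R).
Hypothesis n0 : (0 < n)%N.
Hypothesis p0 : 0 < p.
Local Notation mu := (@leb_mx R n).
Local Notation e := (@e0 R n p).
Local Notation r := (2 * p / n%:R).
Local Notation delta := (zadorc n p).

(** [quant_err] asks for exactly [m.+1] distinct points of [J], whereas lists may be shorter or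
    repeat points. Near an interior point there are infinitely many fresh points to fill up with,
    here along a diagonal. *)
Lemma interior_fresh (J : set 'rV[R]_n) (s : seq 'rV[R]_n) : J° !=set0 ->
  exists2 z, J z & z \notin s.
Proof.
move=> [x /nbhs_normP[rho rho0 H]].
pose z k : 'rV[R]_n := x + (rho / 2 / k.+1%:R) *: const_mx 1.
have zJ k : J (z k).
  apply: H; rewrite /z addrC addKr.
  apply: (@le_lt_trans _ _ (rho / 2)); last by lra.
  have d0 : 0 <= rho / 2 by lra.
  apply/(mx_norm_leP _ d0) => i j; rewrite !mxE mulr1 ger0_norm; last exact: divr_ge0.
  by rewrite ler_pdivrMr ?ltr0n// ler_peMr// ler1n.
have zi : injective z.
  move=> a b /addrI /rowP /(_ (Ordinal n0)); rewrite !mxE !mulr1.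
  have d0 : rho / 2 != 0 by rewrite gt_eqF// divr_gt0.
  by move=> /(mulfI d0) /invr_inj /eqP; rewrite eqr_nat => /eqP[].
apply: contrapT => Hn.
have : (size (map z (iota 0 (size s).+1)) <= size s)%N.
  apply: uniq_leq_size; first by rewrite map_inj_uniq ?iota_uniq.
  move=> _ /mapP[k _ ->]; apply: contrapT => /negP zk; apply: Hn; by exists (z k).
by rewrite size_map size_iota ltnn.
Qed.

Lemma extend_uniq (J : set 'rV[R]_n) k (s : seq 'rV[R]_n) : J° !=set0 -> uniq s ->
  (forall z, z \in s -> J z) -> (size s <= k)%N ->
  exists t, [/\ uniq t, size t = k, (forall z, z \in t -> J z) & {subset s <= t}].
Proof.
move=> J0; move Ed : (k - size s)%N => d; elim: d s Ed => [|d IH] s Ed us sJ sk.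
  by exists s; split=> //; apply/eqP; rewrite eqn_leq sk -subn_eq0 Ed.
have [z Jz zs] := interior_fresh s J0.
have [| | | |t [ut st tJ sub]] := IH (z :: s).
- by rewrite /= subnS Ed.
- by rewrite /= zs.
- by move=> y; rewrite inE => /orP[/eqP->|/sJ].
- by rewrite /= -subn_gt0 Ed.
by exists t; split=> // y ys; apply: sub; rewrite inE ys orbT.
Qed.

(** The shift is that of [quant_err], whose index [m] stands for [m.+1] points. To pass from a list
    to an injective family, repetitions are removed and new points are added, which can only lower
    the error. *)
Lemma quant_errE (J : set 'rV[R]_n) m : jordan_compact J -> (0 < vol J)%E ->
  quant_err p J m = qerr (@eset R n p J) J° m.+1.
Proof.
move=> [cJ vJ] v0.
have mJ := compact_measurable_mx cJ.
have clJ : closure J = J by apply/esym/closure_id; apply: compact_closed => //; exact: norm_hausdorff.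
have mI : measurable J° by apply: open_measurable_mx; exact: open_interior.
have N0 : mu (J `\` J°) = 0%E by move: vJ; rewrite clJ volE//; exact: measurableD.
have J0 : J° !=set0.
  apply/set0P/negP => /eqP E; move: v0; rewrite volE// measure_interior// E measure0 ltxx//.
have merr (s : seq 'rV[R]_n) : measurable_fun setT (err e s).
  by apply: measurable_err => q; exact: measurable_e0.
have err0 (s : seq 'rV[R]_n) x : (0 <= err e s x)%E by apply: err_ge0 => *; exact: e0_ge0.
have intE (S : 'I_m.+1 -> 'rV[R]_n) :
  iint_on J (fun x => (\big[Num.min/enorm (x - S ord0) `^ (2 * p)]_(i < m.+1)
                               (enorm (x - S i) `^ (2 * p)))%:E) =
  (\int[mu]_(x in J°) err e [seq S i | i <- enum 'I_m.+1] x)%E.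
  have E : (fun x => (\big[Num.min/enorm (x - S ord0) `^ (2 * p)]_(i < m.+1)
                               (enorm (x - S i) `^ (2 * p)))%:E) =
     err e [seq S i | i <- enum 'I_m.+1].
    apply/funext => x; rewrite -bigmin_err; congr EFin.
    by rewrite enormE//; apply: eq_bigr => i _; rewrite enormE.
  rewrite E iint_onE//; last exact: measurable_funTS.
  by rewrite integral_interior//; exact: measurable_funTS.
apply/eqP; rewrite eq_le; apply/andP; split.
  apply: le_ereal_inf_tmp => _ [s ss ->].
  have [||t [ut st tJ sub]] := @extend_uniq J m.+1 (undup (map sval s)) J0 (undup_uniq _).
  - by move=> z; rewrite mem_undup => /mem_In /List.in_map_iff[[y Jy] [<- _]].
  - by rewrite (leq_trans (size_undup _))// size_map.
  pose S (i : 'I_m.+1) := nth 0 t i.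
  apply: (@le_trans _ _ (\int[mu]_(x in J°) err e [seq S i | i <- enum 'I_m.+1] x)%E).
    apply: ereal_inf_lbound; exists S; split; last split.
    - by move=> i j /eqP; rewrite nth_uniq ?st// => /eqP/val_inj.
    - by move=> i; apply: tJ; rewrite mem_nth// st.
    - by rewrite intE.
  apply: ge0_le_integral => //.
  - exact: measurable_funTS.
  - by apply: measurable_funTS; apply: measurable_err => q; exact: measurable_eset.
  move=> x _; rewrite err_eset; apply: err_sub => z /In_mem zs.
  have zt : z \in t by apply: sub; rewrite mem_undup.
  have it : (index z t < m.+1)%N by rewrite -st index_mem.
  apply: mem_In; apply/mapP; exists (Ordinal it); first by rewrite mem_enum.
  by rewrite /S /= nth_index.
apply: le_ereal_inf_tmp => _ [S [injS [SJ ->]]]; rewrite intE.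
apply: ereal_inf_lbound.
exists [seq (exist _ (S i) (SJ i) : {x | J x}) | i <- enum 'I_m.+1].
  by rewrite size_map size_enum_ord.
by apply: eq_integral => x _; rewrite err_eset -map_comp.
Qed.

Lemma zador_constant_zadorc : zador_constant n p delta.
Proof.
move=> J jJ v0; have [cJ vJ] := jJ.
have nR0 : 0 < n%:R :> R by rewrite ltr0n.
have mJ := compact_measurable_mx cJ.
have clJ : closure J = J by apply/esym/closure_id; apply: compact_closed => //; exact: norm_hausdorff.
have mI : measurable J° by apply: open_measurable_mx; exact: open_interior.
have N0 : mu (J `\` J°) = 0%E by move: vJ; rewrite clJ volE//; exact: measurableD.
have := zador_set_limit n0 p0 (compact_mxbounded cJ).
rewrite -measure_interior// -volE//.
have -> : (n%:R + 2 * p) / n%:R = 1 + r by field; rewrite gt_eqF.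
rewrite -(cvg_shiftS (fun m : nat => ((m%:R `^ r)%:E * qerr (@eset R n p J) J° m)%E)) /=.
rewrite (_ : (fun m : nat => _) = (fun m : nat => ((m.+1%:R `^ r)%:E * quant_err p J m)%E))//.
by apply/funext => m; rewrite quant_errE.
Qed.

(** * Quantization of a cube for the quadratic form with matrix $BB^T$ *)

Section parallelepiped.
Variable B : 'M[R]_n.
Hypothesis covB : cov B.

Definition eB (z x : 'rV[R]_n) : R := dotr ((x - z) *m B) ((x - z) *m B) `^ p.

Lemma eBE z x : eB z x = e (z *m B) (x *m B).
Proof. by rewrite /eB /e0 mulmxBl. Qed.

Lemma eB_ge0 z x : 0 <= eB z x.
Proof. exact: powR_ge0. Qed.

Lemma measurable_eB z : measurable_fun setT (eB z).
Proof.
rewrite (_ : eB z = e (z *m B) \o (fun x => x *m B + 0)).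
  by apply: measurableT_comp; [exact: measurable_e0|exact: measurable_mulmx_add].
by apply/funext => x /=; rewrite addr0 eBE.
Qed.

Lemma err_eB s x : err eB s x = err e (map (mulmx^~ B) s) (x *m B).
Proof.
have := @err_map R n n _ _ eB e (mulmx^~ B) 1 s x (x *m B) ltr01.
by rewrite mul1e; apply => z; rewrite mul1r eBE.
Qed.

(** The image of the cube under right multiplication by [B], where the error [eB] becomes the
    Euclidean one. *)
Let J (a : 'rV[R]_n) (h : R) : set 'rV[R]_n := [set y | ccube a h (y *m invmx B)].

Let dB0 : 0 < \det B. Proof. by have [] := covB. Qed.
Let uB : B \in unitmx. Proof. by rewrite unitmxE unitfE gt_eqF. Qed.
Let r0 : 0 < r. Proof. by rewrite divr_gt0 ?ltr0n// mulr_gt0. Qed.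

Let mJ a h : measurable (J a h).
Proof.
rewrite -[J a h]setTI (_ : J a h = (fun y => y *m invmx B + 0) @^-1` ccube a h).
  by apply: measurable_mulmx_add => //; exact: measurable_ccube.
by apply/seteqP; split=> y; rewrite /J /= addr0.
Qed.

Let convJ a h : mxconvex (J a h).
Proof.
move=> x y t Hx Hy Ht; rewrite /J /= mulmxDl -!scalemxAl; exact: convex_ccube.
Qed.

Let integral_J a h (f : 'rV[R]_n -> \bar R) : measurable_fun setT f -> (forall x, 0 <= f x)%E ->
  (\int[mu]_(x in (J a h)°) f x = (\det B)%:E * \int[mu]_(x in ccube a h) f (x *m B))%E.
Proof.
move=> mf f0; rewrite -integral_interior//; last 2 first.
- exact: convex_boundary_null.
- exact: measurable_funTS.
rewrite (integral_cov (B := B) 0)//; congr (_ * _)%E.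
have -> : [set x | J a h (x *m B + 0)] = ccube a h.
  by apply/seteqP; split=> x; rewrite /J /= addr0 mulmxK.
by apply: eq_integral => x _; rewrite addr0.
Qed.

Let leb_J a h : 0 <= h -> mu (J a h)° = (\det B * h ^+ n)%:E.
Proof.
move=> h0; have := @integral_J a h (cst 1%E) (measurable_cst _) (fun _ => lee01).
rewrite integral_cst ?mul1e; last by apply: open_measurable_mx; exact: open_interior.
have E1 : (\int[mu]_(x in ccube a h) cst 1 x = (h ^+ n)%:E)%E.
  by rewrite (integral_cst mu (measurable_ccube a h)) mul1e; exact: leb_ccube.
by move=> E2; apply: (etrans E2); rewrite EFinM; congr (_ * _)%E; exact: E1.
Qed.

Let J_bounded a h : 0 <= h -> mxbounded (J a h).
Proof.
move=> h0; pose M := `|a| + h.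
exists (\sum_j \sum_k (M * `|B k j|)) => y Jy.
have [x -> Hx] : exists2 x : 'rV[R]_n, y = x *m B & ccube a h x.
  by exists (y *m invmx B) => //; rewrite mulmxKV.
have xk k : `|x 0 k| <= M.
  have /andP[x1 x2] := Hx k; have := coord_le_norm a 0 k.
  by rewrite /M !ler_norml => /andP[a1 a2]; apply/andP; split; lra.
have S0 : 0 <= \sum_j \sum_k (M * `|B k j|).
  by apply: sumr_ge0 => ? _; apply: sumr_ge0 => ? _; rewrite mulr_ge0// /M addr_ge0.
apply/(mx_norm_leP _ S0) => i j; rewrite (ord1 i) mxE (le_trans (ler_norm_sum _ _ _))//.
apply: (@le_trans _ _ (\sum_k (M * `|B k j|))).
  by apply: ler_sum => k _; rewrite normrM ler_wpM2r.
rewrite [leRHS](bigD1 j)//= lerDl; apply: sumr_ge0 => ? _; apply: sumr_ge0 => ? _.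
by rewrite mulr_ge0// /M addr_ge0.
Qed.

(** One factor $\det B$ is kept apart: dividing by it brings the integral back to the cube and
    leaves the constant $\delta(\det B)^r$. *)
Let J_limit a h : 0 < h -> ((m%:R `^ r)%:E * qerr (@eset R n p (J a h)) (J a h)° m)%E @[m --> \oo]
  --> (\det B * (delta * \det B `^ r) * (h ^+ n) `^ (1 + r))%:E.
Proof.
move=> h0; have := zador_set_limit n0 p0 (@J_bounded a h (ltW h0)).
rewrite leb_J ?(ltW h0)//= powRM ?(ltW dB0) ?exprn_ge0 ?(ltW h0)//.
rewrite (@powRD _ (\det B)); last by rewrite (gt_eqF dB0) implybT.
by rewrite powRr1 ?(ltW dB0)// (_ : delta * _ = \det B * (delta * \det B `^ r) * (h ^+ n) `^ (1 + r))//; ring.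
Qed.

Let hn0 (h : R) : 0 < h -> 0 < (h ^+ n) `^ (1 + r).
Proof. by move=> h0; rewrite powR_gt0// exprn_gt0. Qed.

Lemma parallelepiped_upper a (h eps : R) : 0 < h -> 0 < eps ->
  exists k0 : nat, forall k, (k0 <= k)%N -> exists s : seq 'rV[R]_n,
   [/\ (size s <= k)%N, (forall z, z \in s -> ccube a h z) &
   (\int[mu]_(x in ccube a h) err eB s x <=
     ((delta * \det B `^ r + eps) * (h ^+ n) `^ (1 + r) * k%:R `^ (- r))%:E)%E].
Proof.
move=> h0 eps0; have hh := hn0 h0.
have [k1 _ Hk1] : \forall m \near \oo, ((m%:R `^ r)%:E * qerr (@eset R n p (J a h)) (J a h)° m <
    (\det B * (delta * \det B `^ r + eps) * (h ^+ n) `^ (1 + r))%:E)%E.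
  have nb : nbhs (\det B * (delta * \det B `^ r) * (h ^+ n) `^ (1 + r))%:E
     [set y : \bar R | (y < (\det B * (delta * \det B `^ r + eps) * (h ^+ n) `^ (1 + r))%:E)%E].
    apply: open_nbhs_nbhs; split; first exact: open_ereal_lt_ereal.
    by rewrite /= lte_fin ltr_pM2r// ltr_pM2l// ltrDl.
  exact: (J_limit a h0 nb).
exists k1.+1 => k kk.
have k0 : 0 < k%:R :> R by rewrite ltr0n (leq_ltn_trans _ kk).
have := Hk1 k (ltnW kk); rewrite /= muleC -lte_pdivlMr ?powR_gt0// -EFinM => /ereal_inf_lt[_ [s sk ->]].
under eq_integral do rewrite err_eset.
rewrite integral_J; last 2 first.
- by apply: measurable_err => q; exact: measurable_e0.
- by apply: err_ge0 => *; exact: e0_ge0.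
move=> H; exists (map ((mulmx^~ (invmx B)) \o sval) s); split.
- by rewrite size_map.
- by move=> z /mem_In /List.in_map_iff[[y Jy] [<- _]].
move: H; rewrite muleC -lte_pdivlMr// -EFinM => /ltW H.
apply: le_trans (_ : _ <= ((\det B * (delta * \det B `^ r + eps) * (h ^+ n) `^ (1 + r)) / k%:R `^ r / \det B)%:E)%E _.
  apply: le_trans H; rewrite le_eqVlt; apply/orP; left; apply/eqP; apply: eq_integral => x _.
  rewrite err_eB -map_comp; congr (err _ _ _); apply: eq_map => q /=.
  by rewrite mulmxKV.
rewrite lee_fin powRN le_eqVlt; apply/orP; left; apply/eqP; field.
by rewrite !gt_eqF// powR_gt0.
Qed.

(** Centres are restricted to the cube because the limit concerns quantizers of [J a h] that lie
    inside it. This costs nothing later: the centre attached to a minorant is a minimizer over the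
    cube. *)
Lemma parallelepiped_lower a (h eps : R) : 0 < h -> 0 < eps ->
  exists k0 : nat, forall k, (k0 <= k)%N -> forall s : seq 'rV[R]_n, (size s <= k)%N ->
   (forall z, z \in s -> ccube a h z) ->
   (((delta * \det B `^ r - eps) * (h ^+ n) `^ (1 + r) * k%:R `^ (- r))%:E <=
   \int[mu]_(x in ccube a h) err eB s x)%E.
Proof.
move=> h0 eps0; have hh := hn0 h0.
have [k1 _ Hk1] : \forall m \near \oo, ((\det B * (delta * \det B `^ r - eps) * (h ^+ n) `^ (1 + r))%:E <
     (m%:R `^ r)%:E * qerr (@eset R n p (J a h)) (J a h)° m)%E.
  have nb : nbhs (\det B * (delta * \det B `^ r) * (h ^+ n) `^ (1 + r))%:E
     [set y : \bar R | ((\det B * (delta * \det B `^ r - eps) * (h ^+ n) `^ (1 + r))%:E < y)%E].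
    apply: open_nbhs_nbhs; split; first exact: open_ereal_gt_ereal.
    by rewrite /= lte_fin ltr_pM2r// ltr_pM2l// ltrBlDr ltrDl.
  exact: (J_limit a h0 nb).
exists k1.+1 => k kk s sk sQ.
have k0 : 0 < k%:R :> R by rewrite ltr0n (leq_ltn_trans _ kk).
have := Hk1 k (ltnW kk); rewrite /= muleC -lte_pdivrMr ?powR_gt0// -EFinM => /ltW H.
have [s' s'E] : exists s' : seq {x | J a h x}, map sval s' = map (mulmx^~ B) s.
  by apply: lift_sig_seq => _ /mapP[z zs ->]; rewrite /J /= mulmxK//; exact: sQ.
have : (qerr (@eset R n p (J a h)) (J a h)° k <= (\det B)%:E * \int[mu]_(x in ccube a h) err eB s x)%E.
  apply: ereal_inf_lbound; exists s'; first by rewrite -(size_map sval) s'E size_map.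
  under eq_integral do rewrite err_eB.
  under [RHS]eq_integral do rewrite err_eset s'E.
  rewrite integral_J//.
  - by apply: measurable_err => q; exact: measurable_e0.
  - by apply: err_ge0 => *; exact: e0_ge0.
move=> /(le_trans H); rewrite muleC -lee_pdivrMr// -EFinM; apply: le_trans.
rewrite lee_fin powRN le_eqVlt; apply/orP; left; apply/eqP; field.
by rewrite !gt_eqF// powR_gt0.
Qed.

End parallelepiped.

End zador_theorem.

(** * Local quadratic models *)

Section err_compare.
Context {R : realType} {n n' : nat} {P P' : Type}.
Variables (e : P -> 'rV[R]_n -> R) (e' : P' -> 'rV[R]_n' -> R).

Lemma err_le_map (phi : P' -> P) (k : R) s x y : 0 < k ->
  (forall q, List.In q s -> e (phi q) x <= k * e' q y) ->
  (err e (map phi s) x <= k%:E * err e' s y)%E.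
Proof.
move=> k0 H; rewrite -lee_pdivrMl//; apply: le_err => q qs; rewrite lee_pdivrMl// -EFinM.
apply: (@le_trans _ _ (e (phi q) x)%:E); last by rewrite lee_fin H.
by apply: err_le_In; exact: List.in_map.
Qed.

Lemma err_ge_map (phi : P -> P') (k : R) s x y : 0 < k ->
  (forall q, List.In q s -> k * e' (phi q) y <= e q x) ->
  (k%:E * err e' (map phi s) y <= err e s x)%E.
Proof.
move=> k0 H; apply: le_err => q qs.
apply: (@le_trans _ _ (k * e' (phi q) y)%:E); last by rewrite lee_fin H.
rewrite EFinM lee_wpmul2l// ?lee_fin ?(ltW k0)//.
by apply: err_le_In; exact: List.in_map.
Qed.

End err_compare.

Section real_constants.
Context {R : realType}.

Lemma powR_half (p : R) : (2^-1) `^ p = (2 `^ p)^-1 :> R.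
Proof.
have h : 2 `^ p != 0 :> R by rewrite gt_eqF// powR_gt0.
by apply: (mulfI h); rewrite mulfV// -powRM// mulfV// powR1.
Qed.

Lemma continuous_powR (a x : R) : 0 < x -> {for x, continuous (fun y : R => y `^ a)}.
Proof.
move=> x0; apply: differentiable_continuous; apply/derivable1_diffP.
by apply: derivable_powR; rewrite in_itv/= andbT.
Qed.

Lemma power_slack (p eta : R) : 0 < p -> 0 < eta -> eta < 1 ->
  exists t : R, [/\ 0 < t, t < 1, (1 + t) `^ p <= 1 + eta & 1 - eta <= (1 - t) `^ p].
Proof.
move=> p0 e0 e1.
have ip : 0 < p^-1 by rewrite invr_gt0.
pose u := (1 + eta) `^ p^-1; pose l := (1 - eta) `^ p^-1.
have u1 : 1 < u by have := @lt_powR R 1 (1 + eta) p^-1 ip ler01; rewrite powR1; apply; lra.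
have l1 : l < 1 by have := @lt_powR R (1 - eta) 1 p^-1 ip; rewrite powR1; apply; lra.
have l0 : 0 < l by rewrite powR_gt0//; lra.
pose t := Num.min (u - 1) (1 - l).
have t1 : t <= u - 1 by rewrite ge_min lexx.
have t2 : t <= 1 - l by rewrite ge_min lexx orbT.
have t0 : 0 < t by rewrite lt_min; apply/andP; split; lra.
exists t; split => //; first by lra.
  rewrite -[leRHS](powRK_inv' p0); last by lra.
  by apply: le_powR; [exact: ltW|lra|rewrite -/u; lra].
rewrite -[leLHS](powRK_inv' p0); last by lra.
by apply: le_powR; [exact: ltW|exact: ltW|rewrite -/l; lra].
Qed.

(** In the application $K=2^{-p}\omega$ at [x0] and $Z=\delta(\det B)^r$. The square collects one
    factor from the Hessian and one from the oscillation of $\omega$; [d] is the error of the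
    quantization estimate. *)
Lemma product_slack (K Z eps : R) : 0 < K -> 0 <= Z -> 0 < eps ->
  exists eta d : R, [/\ 0 < eta, eta < 1, 0 < d,
   (1 + eta) ^+ 2 * K * (Z + d) <= K * Z + eps &
   K * Z - eps <= (1 - eta) ^+ 2 * K * (Z - d)].
Proof.
move=> K0 Z0 e0; pose W := K * Z.
have W0 : 0 <= W by rewrite mulr_ge0// ltW.
have W8 : 0 < 8 * (W + 1) by lra.
pose eta := Num.min (2^-1) (eps / (8 * (W + 1))).
have h1 : eta <= 2^-1 by rewrite ge_min lexx.
have h2 : eta <= eps / (8 * (W + 1)) by rewrite ge_min lexx orbT.
have h0 : 0 < eta by rewrite lt_min invr_gt0 ltr0n divr_gt0.
have hW : eta * W <= eps / 8.
  apply: (@le_trans _ _ (eps / (8 * (W + 1)) * W)); first by rewrite ler_wpM2r.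
  have -> : eps / (8 * (W + 1)) * W = (eps / 8) * (W / (W + 1)) by field; lra.
  by rewrite ler_piMr ?divr_ge0 ?(ltW e0)// ler_pdivrMr; lra.
pose d := eps / (8 * K).
have Kd : K * d = eps / 8 by rewrite /d; field; rewrite gt_eqF.
exists eta, d; split => //; first lra.
- by rewrite divr_gt0// mulr_gt0.
- have -> : (1 + eta) ^+ 2 * K * (Z + d) = (1 + 2 * eta + eta ^+ 2) * (W + K * d) by rewrite /W; ring.
  rewrite Kd -/W; have q : eta ^+ 2 <= eta by rewrite expr2 ler_piMl ?(ltW h0)//; lra.
  apply: (@le_trans _ _ ((1 + 3 * eta) * (W + eps / 8))).
    by rewrite ler_wpM2r//; [apply: addr_ge0 => //; lra|lra].
  have : eta * eps <= eps by rewrite ler_piMl ?(ltW e0)//; lra.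
  lra.
- have -> : (1 - eta) ^+ 2 * K * (Z - d) = (1 - 2 * eta + eta ^+ 2) * (W - K * d) by rewrite /W; ring.
  rewrite Kd -/W.
  have s1 : 1 - 2 * eta <= 1 - 2 * eta + eta ^+ 2 by rewrite lerDl sqr_ge0.
  have s2 : 1 - 2 * eta + eta ^+ 2 <= 1.
    have : eta ^+ 2 <= eta by rewrite expr2 ler_piMl ?(ltW h0)//; lra.
    lra.
  have t1 := ler_wpM2r W0 s1.
  have e8 : 0 <= eps / 8 by lra.
  have t2 := ler_wpM2r e8 s2.
  move: t1 t2; rewrite !mulrDl !mulrDr; lra.
Qed.

End real_constants.

Section continuity.
Context {R : realType} {n : nat}.
Implicit Types (x : 'rV[R]_n).

Lemma continuous_big_sum (I : Type) (s : seq I) (F : I -> 'rV[R]_n -> R) x :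
  (forall i, {for x, continuous (F i)}) -> {for x, continuous (fun y => \sum_(i <- s) F i y)}.
Proof.
move=> H; elim: s => [|i s IH].
  under [X in {for _, continuous X}]eq_fun do rewrite big_nil.
  exact: cst_continuous.
under [X in {for _, continuous X}]eq_fun do rewrite big_cons.
exact: continuousD.
Qed.

Lemma continuous_big_prod (I : Type) (s : seq I) (F : I -> 'rV[R]_n -> R) x :
  (forall i, {for x, continuous (F i)}) -> {for x, continuous (fun y => \prod_(i <- s) F i y)}.
Proof.
move=> H; elim: s => [|i s IH].
  under [X in {for _, continuous X}]eq_fun do rewrite big_nil.
  exact: cst_continuous.
under [X in {for _, continuous X}]eq_fun do rewrite big_cons.
exact: continuousM.
Qed.

Lemma continuous_det k (M : 'rV[R]_n -> 'M[R]_k) x :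
  (forall i j, {for x, continuous (fun y => M y i j)}) -> {for x, continuous (fun y => \det (M y))}.
Proof.
move=> H; apply: continuous_big_sum => s.
apply: continuousM; first exact: cst_continuous.
by apply: continuous_big_prod => i.
Qed.

Lemma continuous_dotr (a : 'rV[R]_n) x : {for x, continuous (dotr a)}.
Proof.
apply: continuous_big_sum => i; apply: continuousM; first exact: cst_continuous.
exact: coord_continuous.
Qed.

End continuity.

Section quadratic_model.
Context {R : realType} {n : nat}.
Implicit Types (f : 'rV[R]_n -> R) (x y z v : 'rV[R]_n) (O : set 'rV[R]_n).

Lemma dotrBr a x y : dotr a (x - y) = dotr a x - dotr a y.
Proof. by rewrite dotrC dotrDl dotrNl ![dotr _ a]dotrC. Qed.

Lemma direction_approx f O z v (eps : R) : open O -> C1_at f O -> O z -> 0 < eps ->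
  exists t : R, [/\ 0 < t, t < 1 & `|f (z + t *: v) - f z - t * dotr (grad f z) v| <= t * eps].
Proof.
move=> oO cf Oz eps0.
have v1 : 0 < `|v| + 1 by rewrite ltr_wpDl.
have [rho rho0 H] := C1_diff oO cf Oz (divr_gt0 eps0 v1).
pose t := Num.min 2^-1 (rho / (2 * (`|v| + 1))).
have t0 : 0 < t by rewrite lt_min invr_gt0 ltr0n divr_gt0// mulr_gt0.
have t1 : t <= 2^-1 by rewrite ge_min lexx.
have t2 : t <= rho / (2 * (`|v| + 1)) by rewrite ge_min lexx orbT.
have E : z + t *: v - z = t *: v by rewrite addrC addKr.
have nE : `|t *: v| <= t * (`|v| + 1) by rewrite normrZ gtr0_norm// ler_pM2l// lerDl.
exists t; split=> //; first lra.
have := H (z + t *: v); rewrite E dotrC dotrZl dotrC => H'.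
apply: (le_trans (H' _)).
  apply: (le_lt_trans nE); move: t2; rewrite ler_pdivlMr ?mulr_gt0//.
  by rewrite mulrCA => t2; lra.
apply: (@le_trans _ _ (eps / (`|v| + 1) * (t * (`|v| + 1)))).
  by rewrite ler_wpM2l// divr_ge0 ?ltW.
by rewrite mulrCA divfK// gt_eqF.
Qed.

Lemma direction_ge f O z v (c : R) : open O -> C1_at f O -> O z ->
  (forall t : R, 0 < t -> t < 1 -> t * c <= f (z + t *: v) - f z) -> c <= dotr (grad f z) v.
Proof.
move=> oO cf Oz H; apply/ler_addgt0Pr => eps eps0.
have [t [t0 t1]] := direction_approx v oO cf Oz eps0.
rewrite ler_norml => /andP[_ h]; have := H t t0 t1 => h'.
by rewrite -(ler_pM2l t0) mulrDr; lra.
Qed.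

Lemma direction_le f O z v (c : R) : open O -> C1_at f O -> O z ->
  (forall t : R, 0 < t -> t < 1 -> f (z + t *: v) - f z <= t * c) -> dotr (grad f z) v <= c.
Proof.
move=> oO cf Oz H; apply/ler_addgt0Pr => eps eps0.
have [t [t0 t1]] := direction_approx v oO cf Oz eps0.
rewrite ler_norml => /andP[h _]; have := H t t0 t1 => h'.
by rewrite -(ler_pM2l t0) mulrDr; lra.
Qed.

Lemma quad_form_sqr (B : 'M[R]_n) v :
  (v *m (B *m B^T) *m v^T) 0 0 = dotr (v *m B) (v *m B).
Proof.
rewrite mulmxA -mulmxA -trmx_mul mxE; apply: eq_bigr => i _.
by rewrite [X in _ * X]mxE.
Qed.

Lemma quad_formB (M N : 'M[R]_n) v :
  (v *m (M - N) *m v^T) 0 0 = (v *m M *m v^T) 0 0 - (v *m N *m v^T) 0 0.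
Proof. by rewrite mulmxBr mulmxBl [LHS]mxE [X in _ + X = _]mxE. Qed.

(** The entries of [v] are recovered from [v *m B] through [invmx B], so they are bounded by a
    multiple of the length of [v *m B]. The constant is crude, but independent of [v]. *)
Lemma quad_form_bound (B D : 'M[R]_n) (eta : R) v : B \in unitmx -> 0 <= eta ->
  (forall i j, `|D i j| <= eta) ->
  `|(v *m D *m v^T) 0 0| <=
    eta * (n%:R ^+ 2 * (\sum_i \sum_k `|invmx B k i|) ^+ 2) * dotr (v *m B) (v *m B).
Proof.
move=> uB eta0 HD; pose M : R := \sum_i \sum_k `|invmx B k i|; rewrite -/M.
pose dd : R := dotr (v *m B) (v *m B); rewrite -/dd; pose s : R := Num.sqrt dd.
have SS (c : R) : \sum_(j < n) \sum_(i < n) c = n%:R * (n%:R * c).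
  by rewrite !sumr_const !card_ord !mulr_natl.
have dd0 : 0 <= dd by exact: dotr_ge0.
have sE : s ^+ 2 = dd by rewrite sqr_sqrtr.
have s0 : 0 <= s by exact: sqrtr_ge0.
have wk k : `|(v *m B) 0 k| <= s.
  rewrite -(@ler_pXn2r _ 2%N)// ?nnegrE// sE real_normK ?num_real//.
  exact: coord_le_dotr.
have vi i : `|v 0 i| <= s * M.
  have -> : v 0 i = (v *m B *m invmx B) 0 i by rewrite mulmxK.
  rewrite mxE (le_trans (ler_norm_sum _ _ _))//.
  apply: (@le_trans _ _ (\sum_k (s * `|invmx B k i|))).
    by apply: ler_sum => k _; rewrite normrM ler_wpM2r.
  rewrite -mulr_sumr ler_wpM2l// /M [leRHS](bigD1 i)//= lerDl.
  by apply: sumr_ge0 => ? _; apply: sumr_ge0.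
have sM0 : 0 <= s * M by rewrite mulr_ge0//; apply: sumr_ge0 => ? _; apply: sumr_ge0.
rewrite mxE (le_trans (ler_norm_sum _ _ _))//.
apply: (@le_trans _ _ (\sum_(j < n) \sum_(i < n) ((s * M) * eta * (s * M)))).
  apply: ler_sum => j _; rewrite normrM !mxE -mulr_suml ler_pM//.
  rewrite (le_trans (ler_norm_sum _ _ _))//; apply: ler_sum => i _.
  by rewrite normrM ler_pM.
rewrite SS -sE le_eqVlt; apply/orP; left; apply/eqP; clear.
by move: s M (n%:R : R) => a b c; ring.
Qed.

(** The comparison is multiplicative in $|vB|^2$, which is possible because the form at [x0] is
    definite; in this shape it survives taking [p]-th powers. *)
Lemma hessian_close f O x0 (B : 'M[R]_n) (eps : R) : C2_on f O -> O x0 ->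
  hessian f x0 = B *m B^T -> B \in unitmx -> 0 < eps ->
  exists2 rho : R, 0 < rho & forall z, `|z - x0| < rho -> O z /\ forall v,
    (1 - eps) * dotr (v *m B) (v *m B) <= (v *m hessian f z *m v^T) 0 0 <=
    (1 + eps) * dotr (v *m B) (v *m B).
Proof.
move=> H Ox0 HB uB eps0; have oO := H.1.
pose C := n%:R ^+ 2 * (\sum_i \sum_k `|invmx B k i|) ^+ 2 : R.
have C0 : 0 <= C by apply: mulr_ge0; exact: sqr_ge0.
have C1 : 0 < C + 1 by lra.
pose eta := eps / (C + 1).
have eta0 : 0 < eta by rewrite divr_gt0.
have /nbhs_normP[r0 r00 Hr0] : nbhs x0 O by exact: open_nbhs_nbhs.
have [r1 r10 Hr1] : exists2 r1 : R, 0 < r1 & forall ij : 'I_n * 'I_n, ij \in enum {: 'I_n * 'I_n} ->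
    forall y, `|y - x0| < r1 -> `|pderiv (pderiv f ij.2) ij.1 y - pderiv (pderiv f ij.2) ij.1 x0| <= eta.
  apply: exists_small_seq.
    by move=> i t t' Ht t'0 t't y yx; apply: Ht; exact: lt_le_trans yx t't.
  move=> [i j] _ /=.
  have ci : {for x0, continuous (pderiv (pderiv f j) i)}.
    by case: H => _ [_ [_ [_ H4]]]; apply: H4; rewrite inE.
  have [r rp Hr] := continuous_norm ci eta0.
  by exists r => // y /Hr /ltW.
exists (Num.min r0 r1); first by rewrite lt_min r00.
move=> z; rewrite lt_min => /andP[z0 z1]; split; first exact: Hr0.
move=> v.
have HD i j : `|(hessian f z - hessian f x0) i j| <= eta.
  by rewrite !mxE; apply: (Hr1 (i, j)) => //; rewrite mem_enum.
have E : (v *m (hessian f z - hessian f x0) *m v^T) 0 0 =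
    (v *m hessian f z *m v^T) 0 0 - dotr (v *m B) (v *m B).
  by rewrite -quad_form_sqr -HB quad_formB.
have := quad_form_bound v uB (ltW eta0) HD.
rewrite E -/C.
have := dotr_ge0 (v *m B); move: (dotr _ _) ((v *m hessian f z *m v^T) 0 0) => dd q dd0.
have le : eta * C * dd <= eps * dd.
  rewrite ler_wpM2r// /eta mulrAC ler_pdivrMr// ler_pM2l//; lra.
by rewrite ler_norml => /andP[h1 h2]; apply/andP; split; lra.
Qed.

Definition hess_near f O x0 (B : 'M[R]_n) (eps rho : R) := forall z, `|z - x0| < rho -> O z /\ forall v,
    (1 - eps) * dotr (v *m B) (v *m B) <= (v *m hessian f z *m v^T) 0 0 <=
    (1 + eps) * dotr (v *m B) (v *m B).

Lemma norm_segment x0 x y (s rho : R) : 0 <= s -> s <= 1 -> `|x - x0| < rho -> `|y - x0| < rho ->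
  `|x + s *: (y - x) - x0| < rho.
Proof.
move=> s0 s1 hx hy.
have -> : x + s *: (y - x) - x0 = (1 - s) *: (x - x0) + s *: (y - x0).
  by apply/rowP => j; rewrite !mxE; ring.
apply: (le_lt_trans (ler_normD _ _)); rewrite !normrZ !ger0_norm ?subr_ge0//.
pose m := Num.max `|x - x0| `|y - x0|.
apply: (@le_lt_trans _ _ ((1 - s) * m + s * m)); last first.
  by rewrite -mulrDl subrK mul1r gt_max hx.
by rewrite lerD// ler_wpM2l ?subr_ge0// /m le_max lexx ?orbT.
Qed.

Lemma segment_quadratic f O x0 (B : 'M[R]_n) (eps rho : R) x y (t : R) : C2_on f O ->
  hess_near f O x0 B eps rho -> `|x - x0| < rho -> `|y - x0| < rho -> 0 <= t -> t <= 1 ->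
  (1 - eps) * dotr ((y - x) *m B) ((y - x) *m B) * (t * (1 - t) / 2) <=
  (1 - t) * f x + t * f y - f (x + t *: (y - x)) <=
  (1 + eps) * dotr ((y - x) *m B) ((y - x) *m B) * (t * (1 - t) / 2).
Proof.
move=> H Hn hx hy t0 t1; have oO := H.1; have [c1 _] := C2_C1 H.
have seg (s : R) : 0 <= s -> s <= 1 -> `|x + s *: (y - x) - x0| < rho by move=> *; exact: norm_segment.
have := @quadratic_convexity R (fun s : R => f (x + s *: (y - x)))
  (fun s : R => dotr (grad f (x + s *: (y - x))) (y - x))
  (fun s : R => ((y - x) *m hessian f (x + s *: (y - x)) *m (y - x)^T) 0 0)
  ((1 - eps) * dotr ((y - x) *m B) ((y - x) *m B))
  ((1 + eps) * dotr ((y - x) *m B) ((y - x) *m B)) t t0 t1.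
rewrite scale0r addr0 scale1r [x + (y - x)]addrC subrK; apply.
- by move=> s s0 s1; apply: (C1_is_derive_line oO c1); have [] := Hn _ (seg s s0 s1).
- by move=> s s0 s1; apply: (hessian_line H); have [] := Hn _ (seg s s0 s1).
- by move=> s s0 s1; have [_] := Hn _ (seg s s0 s1); apply.
Qed.

(** The convexity defect on the segment from [z] to [x] is divided by [t], and [t] tends to 0: the
    difference quotient at [z] becomes the gradient term. *)
Lemma tangent_gap f O x0 (B : 'M[R]_n) (eps rho : R) x z : C2_on f O -> 0 <= eps ->
  hess_near f O x0 B eps rho -> `|x - x0| < rho -> `|z - x0| < rho ->
  f x - f z - dotr (grad f z) (x - z) <= (1 + eps) / 2 * dotr ((x - z) *m B) ((x - z) *m B).
Proof.
move=> H e0 Hn hx hz; have oO := H.1; have [c1 _] := C2_C1 H.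
have [Oz _] := Hn _ hz.
suff : f x - f z - (1 + eps) / 2 * dotr ((x - z) *m B) ((x - z) *m B) <= dotr (grad f z) (x - z).
  by move: (dotr _ _) (dotr _ _) => a b; lra.
apply: (direction_ge oO c1 Oz) => t t0 t1.
have /andP[_] := segment_quadratic H Hn hz hx (ltW t0) (ltW t1).
have := dotr_ge0 ((x - z) *m B); move: (dotr _ _) (f x) (f z) (f (z + t *: (x - z))) => d a b c d0.
have t2 : (1 + eps) * d * (t * (1 - t) / 2) <= (1 + eps) * d * (t / 2).
  by rewrite ler_wpM2l ?mulr_ge0 ?addr_ge0// ler_pM2r ?invr_gt0// ler_piMr ?(ltW t0)//; lra.
by move=> h; lra.
Qed.

(** The minimizer may lie on the boundary of [Q], where the gradient of the gap can be nonzero. So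
    the convexity defect along the segment from [z] to [x] is compared with the minimum at [z], and
    [t] tends to 0. *)
Lemma minimizer_gap f O x0 (B : 'M[R]_n) (eps rho : R) (q : 'rV[R]_n * R) x z (Q : set 'rV[R]_n) :
  C2_on f O -> 
  hess_near f O x0 B eps rho -> (forall y, Q y -> `|y - x0| < rho) -> mxconvex Q -> Q x -> Q z ->
  (forall y, Q y -> f z - (dotr q.1 z + q.2) <= f y - (dotr q.1 y + q.2)) ->
  0 <= f z - (dotr q.1 z + q.2) ->
  (1 - eps) / 2 * dotr ((x - z) *m B) ((x - z) *m B) <= f x - (dotr q.1 x + q.2).
Proof.
move=> H Hn HQ cQ Qx Qz zmin z0.
have key (t : R) : 0 < t -> t < 1 -> (1 - eps) / 2 * dotr ((x - z) *m B) ((x - z) *m B) * (1 - t) <=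
   f x - (dotr q.1 x + q.2).
  move=> t0 t1.
  have /andP[+ _] := segment_quadratic H Hn (HQ _ Qz) (HQ _ Qx) (ltW t0) (ltW t1).
  have Qm : Q (z + t *: (x - z)).
    have -> : z + t *: (x - z) = t *: x + (1 - t) *: z by apply/rowP => j; rewrite !mxE; ring.
    by apply: cQ => //; rewrite t0.
  have := zmin _ Qm.
  have -> : dotr q.1 (z + t *: (x - z)) = (1 - t) * dotr q.1 z + t * dotr q.1 x.
    by rewrite dotrC dotrDl dotrZl dotrDl dotrNl ![dotr _ q.1]dotrC; ring.
  move: z0 {zmin}; move: (dotr q.1 z) (dotr q.1 x) q.2 (f z) (f x) (f (z + t *: (x - z))) (dotr ((x - z) *m B) ((x - z) *m B)) => a b c fz fx fm d.
  move=> h0 h1 h2; rewrite -(ler_pM2l t0); have := mulr_ge0 (ltW t0) h0; lra.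
apply/ler_addgt0Pr => e e0.
set G := (1 - eps) / 2 * _; pose t := Num.min 2^-1 (e / (`|G| + 1)).
have G1 : 0 < `|G| + 1 by rewrite ltr_wpDl.
have t0 : 0 < t by rewrite lt_min invr_gt0 ltr0n divr_gt0.
have t1 : t <= 2^-1 by rewrite ge_min lexx.
have t2 : t <= e / (`|G| + 1) by rewrite ge_min lexx orbT.
have := key t t0 (ltac:(lra)); rewrite -/G.
have : G * t <= e.
  apply: (le_trans (ler_norm _)); rewrite normrM (gtr0_norm t0).
  apply: (@le_trans _ _ ((`|G| + 1) * t)); first by rewrite ler_pM2r// lerDl.
  by move: t2; rewrite ler_pdivlMr// mulrC.
lra.
Qed.

Lemma strict_midpoint f O x y : C2plus_on f O -> mxconvex O -> O x -> O y -> x != y ->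
  0 < f x + f y - 2 * f (2^-1 *: (x + y)).
Proof.
move=> [H pd] cO Ox Oy xy; have oO := H.1; have [c1 _] := C2_C1 H.
have seg (s : R) : 0 <= s -> s <= 1 -> O (x + s *: (y - x)).
  move=> s0 s1; have [->|sn0] := eqVneq s 0; first by rewrite scale0r addr0.
  have [->|sn1] := eqVneq s 1; first by rewrite scale1r addrC subrK.
  have -> : x + s *: (y - x) = s *: y + (1 - s) *: x by apply/rowP => j; rewrite !mxE; ring.
  by apply: cO => //; rewrite !lt_neqAle s0 s1 eq_sym sn0 sn1.
have h0 : 0 < 2^-1 :> R by rewrite invr_gt0.
have h1 : 2^-1 < 1 :> R by rewrite invf_lt1// ltr1n.
have := @second_order_mvt R (fun s : R => f (x + s *: (y - x)))
  (fun s : R => dotr (grad f (x + s *: (y - x))) (y - x))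
  (fun s : R => ((y - x) *m hessian f (x + s *: (y - x)) *m (y - x)^T) 0 0) 2^-1 h0 h1.
case=> [s s0 s1|s s0 s1|xi [d [x0 x1 d0]]].
- exact: (C1_is_derive_line oO c1 (seg s s0 s1)).
- exact: (hessian_line H (seg s s0 s1)).
have -> : x + 2^-1 *: (y - x) = 2^-1 *: (x + y).
  by apply/rowP => j; rewrite !mxE; field.
rewrite scale0r addr0 scale1r [x + (y - x)]addrC subrK => E.
have : 0 < d * ((y - x) *m hessian f (x + xi *: (y - x)) *m (y - x)^T) 0 0.
  by rewrite mulr_gt0// pd ?subr_eq0 1?eq_sym//; exact: seg.
by rewrite -E; lra.
Qed.

End quadratic_model.

(** * Affine minorants of a C2 convex function *)

Section affine_pieces.
Context {R : realType} {n : nat} (p : R) (f om : 'rV[R]_n -> R) (O : set 'rV[R]_n)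
  (A : set ('rV[R]_n * R)).
Hypothesis n0 : (0 < n)%N.
Hypothesis p0 : 0 < p.
Hypothesis c2f : C2plus_on f O.
Hypothesis convO : mxconvex O.
Hypothesis bO : mxbounded O.
Hypothesis lipf : lip_on f O.
Hypothesis A_le : forall q x, A q -> O x -> dotr q.1 x + q.2 <= f x.
Hypothesis A_tangent : forall z, O z -> A (grad f z, f z - dotr (grad f z) z).
Hypothesis omc : {in O, continuous om}.
Hypothesis om_gt0 : forall x, O x -> 0 < om x.
Hypothesis om_bd : exists M : R, forall x, O x -> om x <= M.
Local Notation mu := (@leb_mx R n).
Local Notation r := (2 * p / n%:R).
Local Notation delta := (zadorc n p).

Let nR0 : 0 < n%:R :> R. Proof. by rewrite ltr0n. Qed.
Let r0 : 0 < r. Proof. by rewrite divr_gt0// mulr_gt0. Qed.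
Let oO : open O. Proof. by case: c2f => -[]. Qed.
Let mO : measurable O. Proof. exact: open_measurable_mx. Qed.
Let C2f : C2_on f O. Proof. by case: c2f. Qed.
Let C1f : C1_at f O. Proof. by have [] := C2_C1 C2f. Qed.
Let fc x : O x -> {for x, continuous f}. Proof. exact: (C1_continuous oO C1f). Qed.

Let gap_continuous (q : 'rV[R]_n * R) x : O x ->
  {for x, continuous (fun y => f y - (dotr q.1 y + q.2))}.
Proof.
move=> Ox; have c : {for x, continuous (fun y => dotr q.1 y + q.2)}.
  have cc : {for x, continuous (fun _ : 'rV[R]_n => q.2)} by exact: cst_continuous.
  exact: (continuousD (continuous_dotr (x := x)) cc).
exact: (continuousB (fc Ox) c).
Qed.

(** Put to 0 outside [O], where [f] and [om] are arbitrary, so as to be measurable on the whole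
    space, as the allocation principle requires. *)
Definition gap_error (q : {q | A q}) (x : 'rV[R]_n) : R :=
  if x \in O then (f x - (dotr (sval q).1 x + (sval q).2)) `^ p * om x else 0.
Local Notation e := gap_error.

Lemma gap_errorE q x : O x ->
  gap_error q x = (f x - (dotr (sval q).1 x + (sval q).2)) `^ p * om x.
Proof. by move=> Ox; rewrite /gap_error mem_set. Qed.

Lemma gap_error_ge0 q x : 0 <= e q x.
Proof.
rewrite /gap_error; case: ifPn => //; rewrite inE => Ox.
by rewrite mulr_ge0 ?powR_ge0// ltW// om_gt0.
Qed.

Lemma measurable_gap_error q : measurable_fun setT (e q).
Proof.
have -> : e q = (fun x => (f x - (dotr (sval q).1 x + (sval q).2)) `^ p * om x) \_ O.
  by apply/funext => x; rewrite /gap_error /patch.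
apply/(measurable_restrictT _ mO); apply: measurable_funM; last exact: measurable_fun_cont.
apply: (measurableT_comp (measurable_powR p)); apply: measurable_fun_cont => // x.
rewrite inE => Ox; exact: gap_continuous.
Qed.

(** The factor $2^{-p}$ comes from the one half in the second-order expansion, and $(\det
    D^2f)^{p/n}=(\det B)^r$ from quantizing the image of a cube under [B]. *)
Definition weight x : R := delta / 2 `^ p * \det (hessian f x) `^ (p / n%:R) * om x.
Local Notation w := weight.

Let factor x : O x -> exists B : 'M[R]_n, [/\ cov B, B \in unitmx, hessian f x = B *m B^T,
  0 < \det (hessian f x) & \det (hessian f x) `^ (p / n%:R) = \det B `^ r].
Proof.
move=> Ox; have [B cB E] := cholesky (schwarz C2f Ox) (c2f.2 x Ox).
have [dB _] := cB.
exists B; split => //; first by rewrite unitmxE unitfE gt_eqF.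
  by rewrite E det_mulmx det_tr mulr_gt0.
rewrite E det_mulmx det_tr -expr2 powR_exprn ?(ltW dB)//; congr powR; field.
by rewrite gt_eqF.
Qed.

Lemma weight_continuous : {in O, continuous w}.
Proof.
move=> x; rewrite inE => Ox; have [B [_ _ _ d0 _]] := factor Ox.
have co : {for x, continuous om} by apply: omc; rewrite inE.
have cc : {for x, continuous (fun _ : 'rV[R]_n => delta / 2 `^ p)} by exact: cst_continuous.
suff cd : {for x, continuous (fun y => \det (hessian f y) `^ (p / n%:R))}.
  exact: (continuousM (continuousM cc cd) co).
apply: (@continuous_comp _ _ _ (fun y => \det (hessian f y)) (fun d : R => d `^ (p / n%:R)) x).
  apply: continuous_det => i j.
  under [X in {for _, continuous X}]eq_fun do rewrite mxE.
  by case: C2f => _ [_ [_ [_ H4]]]; apply: H4; rewrite inE.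
exact: continuous_powR.
Qed.

Lemma weight_ge0 x : O x -> 0 <= w x.
Proof.
move=> Ox; rewrite !mulr_ge0 ?powR_ge0 ?invr_ge0 ?powR_ge0 ?(ltW (om_gt0 Ox))//.
exact: zadorc_ge0.
Qed.

Definition tangent (z : {z | O z}) : {q | A q} := exist _ _ (A_tangent (svalP z)).

Let tangent_eval z (Oz : O z) x : f x - (dotr (sval (tangent (exist _ z Oz))).1 x +
   (sval (tangent (exist _ z Oz))).2) = f x - f z - dotr (grad f z) (x - z).
Proof. by rewrite /= dotrBr; lra. Qed.

(** Near [x0] an affine minorant behaves like a point: a tangent like its point of contact, for the
    upper bound, and an arbitrary minorant like a minimizer of its gap on the cube, for the lower
    one. *)
Lemma local_model x0 (eta : R) : O x0 -> 0 < eta -> eta < 1 ->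
  let K := (2 `^ p)^-1 * om x0 in
  exists (B : 'M[R]_n) (rho : R), [/\ cov B, \det (hessian f x0) `^ (p / n%:R) = \det B `^ r, 0 < rho &
    [/\ forall y, `|y - x0| < rho -> O y,
      forall z (Oz : O z) y, `|y - x0| < rho -> `|z - x0| < rho ->
        e (tangent (exist _ z Oz)) y <= (1 + eta) ^+ 2 * K * eB p B z y &
      forall a (h : R), 0 < h -> (forall y, ccube a h y -> `|y - x0| < rho) ->
        forall q, exists2 z, ccube a h z & forall y, ccube a h y ->
          (1 - eta) ^+ 2 * K * eB p B z y <= e q y]].
Proof.
move=> Ox0 eta0 eta1 K.
have [B [cB uB HB d0 dE]] := factor Ox0.
have [t [t0 t1 tu tl]] := power_slack p0 eta0 eta1.
have [r1 r10 Hn] := hessian_close C2f Ox0 HB uB t0.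
have o0 := om_gt0 Ox0.
have eo : 0 < eta * om x0 by rewrite mulr_gt0.
have ocx : {for x0, continuous om} by apply: omc; rewrite inE.
have [r2 r20 Ho] := continuous_norm ocx eo.
exists B, (Num.min r1 r2); split => //; first by rewrite lt_min r10.
have m1 y : `|y - x0| < Num.min r1 r2 -> `|y - x0| < r1 by rewrite lt_min => /andP[].
have m2 y : `|y - x0| < Num.min r1 r2 -> (1 - eta) * om x0 <= om y <= (1 + eta) * om x0.
  rewrite lt_min => /andP[_ /Ho]; rewrite ltr_norml => /andP[h1 h2].
  by apply/andP; split; lra.
have half (c : R) d : 0 <= c -> 0 <= d -> (c / 2 * d) `^ p = c `^ p * (2 `^ p)^-1 * d `^ p.
  by move=> c0 dd0; rewrite powRM ?divr_ge0// powRM ?invr_ge0// powR_half.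
have i2 : 0 <= (2 `^ p)^-1 :> R by rewrite invr_ge0 powR_ge0.
split.
- by move=> y /m1 /Hn[].
- move=> z Oz y hy hz; have [Oy _] := Hn _ (m1 _ hy).
  rewrite gap_errorE// tangent_eval.
  have gle := tangent_gap C2f (ltW t0) Hn (m1 _ hy) (m1 _ hz).
  have g0 : 0 <= f y - f z - dotr (grad f z) (y - z).
    by rewrite -(tangent_eval Oz) subr_ge0; apply: A_le => //=; exact: A_tangent.
  have /andP[_ ou] := m2 _ hy.
  apply: (@le_trans _ _ (((1 + t) / 2 * dotr ((y - z) *m B) ((y - z) *m B)) `^ p * ((1 + eta) * om x0))).
    by apply: ler_pM => //; [exact: powR_ge0|exact: ltW (om_gt0 Oy)|exact: le_powR (ltW p0) g0 gle].
  rewrite half ?dotr_ge0//; last by lra.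
  rewrite -/(eB p B z y) /K.
  have -> : (1 + eta) ^+ 2 * ((2 `^ p)^-1 * om x0) * eB p B z y =
     (1 + eta) * ((2 `^ p)^-1 * eB p B z y * ((1 + eta) * om x0)) by ring.
  have -> : (1 + t) `^ p * (2 `^ p)^-1 * eB p B z y * ((1 + eta) * om x0) =
     (1 + t) `^ p * ((2 `^ p)^-1 * eB p B z y * ((1 + eta) * om x0)) by ring.
  rewrite ler_wpM2r//; apply: mulr_ge0; first by rewrite mulr_ge0// eB_ge0.
  by rewrite mulr_ge0 ?(ltW o0)//; lra.
- move=> a h h0 hQ q.
  have QO y : ccube a h y -> O y by move=> /hQ /m1 /Hn[].
  have [z zQ zmin] : exists2 z, z \in ccube a h & forall y, y \in ccube a h ->
      f z - (dotr (sval q).1 z + (sval q).2) <= f y - (dotr (sval q).1 y + (sval q).2).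
    apply: (@EVT_min_rV R n (fun y => f y - (dotr (sval q).1 y + (sval q).2)) (ccube a h)).
    - by exists a; exact: ccube_corner (ltW h0).
    - exact: compact_ccube.
    apply: continuous_in_subspaceT => y; rewrite inE => /QO Oy.
    exact: gap_continuous.
  rewrite inE in zQ; exists z => // y Qy; have Oy := QO _ Qy; rewrite gap_errorE//.
  have gle : (1 - t) / 2 * dotr ((y - z) *m B) ((y - z) *m B) <= f y - (dotr (sval q).1 y + (sval q).2).
    apply: (minimizer_gap C2f Hn (Q := ccube a h)) => //.
    - by move=> x /hQ /m1.
    - exact: convex_ccube.
    - by move=> x Qx; apply: zmin; rewrite inE.
    - by rewrite subr_ge0; apply: A_le; [exact: svalP|exact: QO].
  have /andP[ol _] := m2 _ (hQ _ Qy).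
  have k0 : 0 <= (1 - t) / 2 * dotr ((y - z) *m B) ((y - z) *m B).
    by rewrite mulr_ge0 ?dotr_ge0// divr_ge0//; lra.
  apply: (@le_trans _ _ (((1 - t) / 2 * dotr ((y - z) *m B) ((y - z) *m B)) `^ p * ((1 - eta) * om x0))); last first.
    apply: ler_pM => //; [exact: powR_ge0| |exact: le_powR (ltW p0) k0 gle].
    by rewrite mulr_ge0 ?(ltW o0)//; lra.
  rewrite half ?dotr_ge0//; last by lra.
  rewrite -/(eB p B z y) /K.
  have -> : (1 - eta) ^+ 2 * ((2 `^ p)^-1 * om x0) * eB p B z y =
     (1 - eta) * ((2 `^ p)^-1 * eB p B z y * ((1 - eta) * om x0)) by ring.
  have -> : (1 - t) `^ p * (2 `^ p)^-1 * eB p B z y * ((1 - eta) * om x0) =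
     (1 - t) `^ p * ((2 `^ p)^-1 * eB p B z y * ((1 - eta) * om x0)) by ring.
  rewrite ler_wpM2r//; apply: mulr_ge0; first by rewrite mulr_ge0// eB_ge0.
  by rewrite mulr_ge0 ?(ltW o0)//; lra.
Qed.

Let weightE x0 (B : 'M[R]_n) : \det (hessian f x0) `^ (p / n%:R) = \det B `^ r ->
  w x0 = (2 `^ p)^-1 * om x0 * (delta * \det B `^ r).
Proof.
by move=> E; rewrite /weight E; move: (_ `^ _) (_ `^ _)^-1 delta (om x0) => a b c d; ring.
Qed.

Let Zx x0 := delta * \det (hessian f x0) `^ (p / n%:R).

(** Tangents at near-optimal centres of the parallelepiped problem; these centres lie in the cube,
    hence in [O], where tangents exist. *)
Lemma gap_local_upper x0 eps : O x0 -> 0 < eps -> exists2 rho : R, 0 < rho &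
  forall a (h : R), 0 < h -> (forall y, ccube a h y -> `|y - x0| < rho) ->
  exists k0 : nat, forall k, (k0 <= k)%N -> exists2 s : seq {q | A q}, (size s <= k)%N &
   (\int[mu]_(x in ccube a h) err e s x <=
     ((w x0 + eps) * (h ^+ n) `^ (1 + r) * k%:R `^ (- r))%:E)%E.
Proof.
move=> Ox0 eps0.
have Z0 : 0 <= Zx x0 by rewrite mulr_ge0 ?powR_ge0//; exact: zadorc_ge0.
have K0 : 0 < (2 `^ p)^-1 * om x0 by rewrite mulr_gt0 ?om_gt0// invr_gt0 powR_gt0.
have [eta [d [eta0 eta1 d0 Hu _]]] := product_slack K0 Z0 eps0.
have [B [rho [cB dE rho0 [HO Htan _]]]] := local_model Ox0 eta0 eta1.
rewrite /Zx dE in Hu; rewrite (weightE dE).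
exists rho => // a h h0 hQ.
have [k0 Hk] := parallelepiped_upper n0 p0 cB a h0 d0.
exists k0 => k kk; have [s [sk sQ Hs]] := Hk k kk.
have [s' s'E] : exists s' : seq {z | O z}, map sval s' = s.
  by apply: lift_sig_seq => z /sQ /hQ /HO.
exists (map tangent s'); first by rewrite size_map -(size_map sval) s'E.
set c := (1 + eta) ^+ 2 * ((2 `^ p)^-1 * om x0) in Htan Hu.
have c0 : 0 < c by rewrite mulr_gt0// exprn_gt0//; lra.
have merr : measurable_fun setT (err (eB p B) s) by apply: measurable_err => z; exact: measurable_eB.
have err0 x : (0 <= err (eB p B) s x)%E by apply: err_ge0 => *; exact: eB_ge0.
apply: (@le_trans _ _ (\int[mu]_(x in ccube a h) (c%:E * err (eB p B) s x))%E).
  apply: ge0_le_integral => //.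
  - exact: measurable_ccube.
  - by move=> x _; apply: err_ge0; exact: gap_error_ge0.
  - by apply: measurable_funTS; apply: measurable_err; exact: measurable_gap_error.
  - by apply: measurable_funTS; exact: measurable_funeM.
  move=> x Qx.
  have -> : err (eB p B) s x = err (fun z : {z | O z} => eB p B (sval z)) s' x.
    have := @err_map R n n _ _ (fun z : {z | O z} => eB p B (sval z)) (eB p B) sval 1 s' x x ltr01.
    by rewrite mul1e s'E => ->// z; rewrite mul1r.
  apply: err_le_map => // -[z Oz] zs /=; apply: Htan; first exact: hQ.
  apply: hQ; apply: sQ; rewrite -s'E; apply: In_mem; exact: (List.in_map sval _ _ zs).
rewrite ge0_integralZl_EFin ?(ltW c0)//; last 2 first.
- exact: measurable_ccube.
- exact: measurable_funTS.
apply: (@le_trans _ _ (c%:E * ((delta * \det B `^ r + d) * (h ^+ n) `^ (1 + r) * k%:R `^ (- r))%:E)%E).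
  by rewrite lee_wpmul2l// lee_fin ltW.
rewrite -EFinM lee_fin !mulrA ler_wpM2r ?powR_ge0// ler_wpM2r ?powR_ge0//.
by move: Hu; rewrite !mulrA.
Qed.

(** Replacing each minorant by a minimizer of its gap turns the list into one of centres in the
    cube, of the same length. *)
Lemma gap_local_lower x0 eps : O x0 -> 0 < eps -> exists2 rho : R, 0 < rho &
  forall a (h : R), 0 < h -> (forall y, ccube a h y -> `|y - x0| < rho) ->
  exists k0 : nat, forall k, (k0 <= k)%N -> forall s : seq {q | A q}, (size s <= k)%N ->
   (((w x0 - eps) * (h ^+ n) `^ (1 + r) * k%:R `^ (- r))%:E <=
    \int[mu]_(x in ccube a h) err e s x)%E.
Proof.
move=> Ox0 eps0.
have Z0 : 0 <= Zx x0 by rewrite mulr_ge0 ?powR_ge0//; exact: zadorc_ge0.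
have K0 : 0 < (2 `^ p)^-1 * om x0 by rewrite mulr_gt0 ?om_gt0// invr_gt0 powR_gt0.
have [eta [d [eta0 eta1 d0 _ Hu]]] := product_slack K0 Z0 eps0.
have [B [rho [cB dE rho0 [HO _ Hmin]]]] := local_model Ox0 eta0 eta1.
rewrite /Zx dE in Hu; rewrite (weightE dE).
exists rho => // a h h0 hQ.
have [k0 Hk] := parallelepiped_lower n0 p0 cB a h0 d0.
exists k0 => k kk s sk.
have /choice[phi Hphi] : forall q, exists z, ccube a h z /\ forall y, ccube a h y ->
    (1 - eta) ^+ 2 * ((2 `^ p)^-1 * om x0) * eB p B z y <= e q y.
  by move=> q; have [z] := Hmin a h h0 hQ q; exists z.
set c := (1 - eta) ^+ 2 * ((2 `^ p)^-1 * om x0) in Hphi Hu.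
have c0 : 0 < c by rewrite mulr_gt0// exprn_gt0//; lra.
have sQ z : z \in map phi s -> ccube a h z.
  by move=> /mem_In /List.in_map_iff[q [<- _]]; have [] := Hphi q.
have Hs := Hk k kk (map phi s) (ltac:(by rewrite size_map)) sQ.
have merr : measurable_fun setT (err (eB p B) (map phi s)) by apply: measurable_err => z; exact: measurable_eB.
have err0 x : (0 <= err (eB p B) (map phi s) x)%E by apply: err_ge0 => *; exact: eB_ge0.
apply: (@le_trans _ _ (\int[mu]_(x in ccube a h) (c%:E * err (eB p B) (map phi s) x))%E); last first.
  apply: ge0_le_integral => //.
  - exact: measurable_ccube.
  - by move=> x _; rewrite mule_ge0// lee_fin ltW.
  - by apply: measurable_funTS; exact: measurable_funeM.
  - by apply: measurable_funTS; apply: measurable_err; exact: measurable_gap_error.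
  by move=> x Qx; apply: err_ge_map => // q _; have [_] := Hphi q; apply.
rewrite ge0_integralZl_EFin ?(ltW c0)//; last 2 first.
- exact: measurable_ccube.
- exact: measurable_funTS.
apply: (@le_trans _ _ (c%:E * ((delta * \det B `^ r - d) * (h ^+ n) `^ (1 + r) * k%:R `^ (- r))%:E)%E); last first.
  by rewrite lee_wpmul2l// lee_fin ltW.
rewrite -EFinM lee_fin !mulrA ler_wpM2r ?powR_ge0// ler_wpM2r ?powR_ge0//.
by move: Hu; rewrite !mulrA.
Qed.

Let midO x y : O x -> O y -> O (2^-1 *: (x + y)).
Proof.
move=> Ox Oy; have -> : 2^-1 *: (x + y) = 2^-1 *: x + (1 - 2^-1) *: y.
  by apply/rowP => j; rewrite !mxE; field.
by apply: convO => //; rewrite invr_gt0 ltr0n/= invf_lt1// ltr1n.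
Qed.

(** As a minorant is at most [f] at the midpoint, its gaps at [x] and [y] add up to at least
    $f(x)+f(y)-2f((x+y)/2)$. Strict convexity makes this positive on two disjoint cubes, and
    compactness of their product bounds it away from 0. *)
Lemma gap_separation a b (h : R) : 0 < h -> ccube a h `<=` O -> ccube b h `<=` O ->
  (forall x, ccube a h x -> ccube b h x -> False) ->
  exists2 tau : R, 0 < tau & forall q x y, ccube a h x -> ccube b h y ->
    e q x < tau -> e q y < tau -> False.
Proof.
move=> h0 aO bO' dis.
have ca := ccube_corner a (ltW h0); have cb := ccube_corner b (ltW h0).
have omin c : ccube c h `<=` O -> exists2 o1 : R, 0 < o1 & forall x, ccube c h x -> o1 <= om x.
  move=> cO; have [z zQ zm] : exists2 z, z \in ccube c h & forall y, y \in ccube c h -> om z <= om y.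
    apply: (@EVT_min_rV R n om (ccube c h)).
    - by exists c; exact: ccube_corner (ltW h0).
    - exact: compact_ccube.
    by apply: continuous_in_subspaceT => y; rewrite inE => /cO Oy; apply: omc; rewrite inE.
  exists (om z); first by apply: om_gt0; apply: cO; rewrite inE in zQ.
  by move=> x Qx; apply: zm; rewrite inE.
have [oa oa0 Ha] := omin a aO; have [ob ob0 Hb] := omin b bO'.
pose G (xy : 'rV[R]_n * 'rV[R]_n) : R := f xy.1 + f xy.2 - 2 * f (2^-1 *: (xy.1 + xy.2)).
have Gc xy : O xy.1 -> O xy.2 -> {for xy, continuous G}.
  move=> O1 O2.
  have c1 : {for xy, continuous (fun z : 'rV[R]_n * 'rV[R]_n => f z.1)}.
    by apply: (@continuous_comp _ _ _ fst f); [exact: cvg_fst|exact: fc].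
  have c2 : {for xy, continuous (fun z : 'rV[R]_n * 'rV[R]_n => f z.2)}.
    by apply: (@continuous_comp _ _ _ snd f); [exact: cvg_snd|exact: fc].
  have c3 : {for xy, continuous (fun z : 'rV[R]_n * 'rV[R]_n => f (2^-1 *: (z.1 + z.2)))}.
    apply: (@continuous_comp _ _ _ (fun z : 'rV[R]_n * 'rV[R]_n => 2^-1 *: (z.1 + z.2)) f).
      by apply: cvgZr; apply: cvgD; [exact: cvg_fst|exact: cvg_snd].
    by apply: fc; exact: midO.
  apply: continuousB; first exact: continuousD.
  by apply: continuousM; [exact: cst_continuous|exact: c3].
have [[z1 z2] zQ zm] : exists2 z, z \in ccube a h `*` ccube b h &
    forall y, y \in ccube a h `*` ccube b h -> G z <= G y.
  apply: compact_EVT_min.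
  - by exists (a, b).
  - by apply: compact_setX; exact: compact_ccube.
  apply: continuous_in_subspaceT => -[y1 y2]; rewrite inE => -[/= /aO O1 /bO' O2]; exact: Gc.
rewrite inE in zQ; case: zQ => /= zQ1 zQ2.
have g0 : 0 < G (z1, z2).
  apply: (strict_midpoint c2f convO (aO _ zQ1) (bO' _ zQ2)).
  by apply/eqP => E; apply: (dis z1) => //; rewrite E.
set g := G _ in g0 zm.
have g2 : 0 < (g / 2) `^ p by rewrite powR_gt0// divr_gt0.
(* Half of the minimum [g] for each gap, times a lower bound of [om] on the two cubes. *)
exists ((g / 2) `^ p * Num.min oa ob); first by rewrite mulr_gt0// lt_min oa0.
have big q x (o1 : R) : O x -> 0 < o1 -> o1 <= om x -> Num.min oa ob <= o1 ->
   e q x < (g / 2) `^ p * Num.min oa ob -> f x - (dotr (sval q).1 x + (sval q).2) < g / 2.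
  move=> Ox o10 o1x mo; rewrite gap_errorE// => lt; rewrite ltNge; apply/negP => ge.
  move: lt; rewrite ltNge => /negP; apply; apply: ler_pM.
  - exact: ltW.
  - by rewrite le_min !ltW.
  - by apply: le_powR ge; [exact: ltW|rewrite divr_ge0 ?ltW].
  - exact: le_trans mo o1x.
move=> q x y Qx Qy ex ey.
have h1 := big q x oa (aO _ Qx) oa0 (Ha _ Qx) (ltac:(by rewrite ge_min lexx)) ex.
have h2 := big q y ob (bO' _ Qy) ob0 (Hb _ Qy) (ltac:(by rewrite ge_min lexx orbT)) ey.
have h3 : g <= f x + f y - 2 * f (2^-1 *: (x + y)) by apply: (zm (x, y)); rewrite inE.
have := A_le (svalP q) (midO (aO _ Qx) (bO' _ Qy)).
have -> : dotr (sval q).1 (2^-1 *: (x + y)) = 2^-1 * (dotr (sval q).1 x + dotr (sval q).1 y).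
  by rewrite dotrC dotrZl dotrDl ![dotr _ (sval q).1]dotrC.
move: h1 h2 h3; move: (dotr (sval q).1 x) (dotr (sval q).1 y) (sval q).2 (f x) (f y).
by move: (f (2^-1 *: (x + y))) => f0 d1 d2 q2 f1 f2; lra.
Qed.

Lemma grad_bounded : exists2 L : R, 0 <= L & forall z, O z -> `|grad f z| <= L.
Proof.
have [L HL] := lipf; exists `|L| => // z Oz.
have dir (v : 'rV[R]_n) : `|v| <= 1 -> dotr (grad f z) v <= `|L|.
  move=> v1.
  have /nbhs_normP[d d0 Hd] : nbhs z O by exact: open_nbhs_nbhs.
  apply/ler_addgt0Pr => eps eps0.
  pose c := d / 2.
  have c0 : 0 < c by rewrite divr_gt0.
  have cd : c < d by rewrite /c; lra.
  have : dotr (grad f z) (c *: v) <= c * `|L|.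
    apply: (direction_le oO C1f Oz) => t t0 t1.
    have E : z + t *: (c *: v) - z = (t * c) *: v by rewrite addrC addKr scalerA.
    have tc : 0 < t * c by rewrite mulr_gt0.
    have nv : `|(t * c) *: v| <= t * c by rewrite normrZ gtr0_norm// ler_piMr// ltW.
    have Oy : O (z + t *: (c *: v)).
      apply: Hd; rewrite E (le_lt_trans nv)// (le_lt_trans _ cd)// ler_piMl ?(ltW c0)// ltW//.
    apply: (le_trans (ler_norm _)); apply: (le_trans (HL _ _ Oy Oz)); rewrite E.
    apply: (@le_trans _ _ (`|L| * `|(t * c) *: v|)); first by rewrite ler_wpM2r// ler_norm.
    by rewrite mulrA [leRHS]mulrC ler_wpM2l.
  rewrite dotrC dotrZl dotrC ler_pM2l// => h; apply: (le_trans h); lra.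
apply/(mx_norm_leP _ (normr_ge0 _)) => i j; rewrite (ord1 i).
have eb : `|ebase R j| <= 1.
  by have := norm_scale_ebase (1 : R) j; rewrite scale1r normr1.
have dE (v : 'rV[R]_n) : dotr v (ebase R j) = v 0 j.
  rewrite /dotr (bigD1 j)//= big1 => [|k kj]; rewrite !mxE ?eqxx ?mulr1 ?addr0//.
  by rewrite (negbTE kj) andbF mulr0.
have := dir _ eb; have := dir (- ebase R j); rewrite normrN => /(_ eb).
rewrite dotrC dotrNl dotrC dE ler_norml => h1 h2; apply/andP; split; lra.
Qed.

(** A net for the points alone would call for bounded second derivatives, which may fail at the
    boundary. A net for [Phi] also controls the variation of the gradient, and $b\cdot a\le|a+b|^2$
    bounds the gap by the squared distance of the images. *)
Lemma gap_global_upper : exists2 C : R, 0 <= C & forall k, (0 < k)%N ->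
  exists2 s : seq {q | A q}, (size s <= k)%N &
    forall x, O x -> (err e s x <= (C * k%:R `^ (- r))%:E)%E.
Proof.
have [L L0 HL] := grad_bounded; have [M HM] := bO; have [Mo HMo] := om_bd.
pose Phi (z : {z | O z}) := sval z + grad f (sval z).
have bPhi : mxbounded (range Phi).
  exists (M + L) => _ [[z Oz] _ <-]; rewrite /Phi /=.
  by apply: (le_trans (ler_normD _ _)); apply: lerD; [exact: HM|exact: HL].
have [C C0 HC] := net_lemma n0 bPhi.
exists ((n%:R * C ^+ 2) `^ p * `|Mo|); first by rewrite mulr_ge0// powR_ge0.
move=> k k0; have [s sk Hs] := HC k k0.
exists (map tangent s); first by rewrite size_map.
move=> x Ox; have [[z Oz] zs Hz] := Hs (exist _ x Ox).
apply: (le_trans (err_le_In _ _ (List.in_map tangent _ _ zs))); rewrite lee_fin gap_errorE// tangent_eval.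
pose D : R := k%:R `^ (- n%:R^-1).
have D0 : 0 <= D by exact: powR_ge0.
have -> : k%:R `^ (- r) = (D ^+ 2) `^ p.
  rewrite powR_exprn// /D -powRrM; congr powR; field; by rewrite gt_eqF.
rewrite mulrAC.
have -> : (n%:R * C ^+ 2) `^ p * (D ^+ 2) `^ p = (n%:R * (C * D) ^+ 2) `^ p.
  rewrite -powRM ?sqr_ge0//; last by rewrite mulr_ge0// sqr_ge0.
  by congr powR; ring.
have g0 : 0 <= f x - f z - dotr (grad f z) (x - z).
  by rewrite -(tangent_eval Oz) subr_ge0; apply: A_le => //=; exact: A_tangent.
have g1 : 0 <= f z - f x - dotr (grad f x) (z - x).
  by rewrite -(tangent_eval Ox) subr_ge0; apply: A_le => //=; exact: A_tangent.
apply: ler_pM.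
- exact: powR_ge0.
- exact: ltW (om_gt0 Ox).
- apply: le_powR => //; first exact: ltW.
  apply: (@le_trans _ _ (dotr (Phi (exist _ x Ox) - Phi (exist _ z Oz)) (Phi (exist _ x Ox) - Phi (exist _ z Oz)))); last first.
    apply: (le_trans (dotr_le_norm _)); rewrite ler_wpM2l// lerXn2r ?nnegrE//.
    by rewrite mulr_ge0.
  have -> : Phi (exist _ x Ox) - Phi (exist _ z Oz) = (x - z) + (grad f x - grad f z).
    by rewrite /Phi /= opprD addrACA.
  move: g1; have -> : dotr (grad f x) (z - x) = - dotr (grad f x) (x - z).
    by rewrite !dotrBr; lra.
  (* From $2(|a+b|^2-a\cdot b)=|a|^2+|b|^2+|a+b|^2$. *)
  have q (a b : 'rV[R]_n) : dotr b a <= dotr (a + b) (a + b).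
    have := dotr_ge0 a; have := dotr_ge0 b; have := dotr_ge0 (a + b).
    by rewrite !dotrDl ![dotr _ (a + b)]dotrC !dotrDl [dotr a b]dotrC; lra.
  have := q (x - z) (grad f x - grad f z).
  rewrite [X in X <= _ -> _]dotrDl dotrNl; move: (dotr (_ + _) _) (dotr _ _) (dotr _ _) => a b c; lra.
- exact: le_trans (HMo _ Ox) (ler_norm _).
Qed.

Theorem gap_limit : (wint O r w < +oo)%E /\
  ((m%:R `^ r)%:E * qerr e O m)%E @[m --> \oo] --> ((fine (wint O r w)) `^ (1 + r))%:E.
Proof.
apply: abstract_limit => //.
- exact: gap_error_ge0.
- exact: measurable_gap_error.
- exact: weight_continuous.
- exact: weight_ge0.
- exact: gap_local_upper.
- exact: gap_local_lower.
- exact: gap_separation.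
- exact: gap_global_upper.
Qed.

End affine_pieces.

(** * Proof of the theorem *)

Section convex_functions.
Context {R : realType} {n : nat}.
Implicit Types (K : set 'rV[R]_n) (f : 'rV[R]_n -> R) (x y : 'rV[R]_n).

Lemma mxconvex_interior K : mxconvex K -> mxconvex K°.
Proof.
move=> cK x y t /nbhs_normP[d d0 Hd] /nbhs_normP[d' d'0 Hd'] t01.
apply/nbhs_normP; exists (Num.min d d'); first by rewrite lt_min d0.
move=> z; rewrite lt_min => /andP[z1 z2].
set v := z - _ in z1 z2.
have -> : z = t *: (x + v) + (1 - t) *: (y + v).
  by rewrite /v; apply/rowP => j; rewrite !mxE; ring.
by apply: cK => //; [apply: Hd|apply: Hd']; rewrite addrC addKr.
Qed.

(* Each new point is averaged with the barycenter of the previous ones; starting from a point of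
   positive weight avoids the case of a vanishing total weight. *)
Lemma jensen K f (I : Type) (s : seq I) (c : I -> R) (y : I -> 'rV[R]_n) x (T : R) :
  (forall x y (t : R), K x -> K y -> 0 < t < 1 ->
     K (t *: x + (1 - t) *: y) /\ f (t *: x + (1 - t) *: y) <= t * f x + (1 - t) * f y) ->
  (forall i, 0 <= c i) -> (forall i, K (y i)) -> K x -> 0 < T -> T + \sum_(i <- s) c i = 1 ->
  f (T *: x + \sum_(i <- s) c i *: y i) <= T * f x + \sum_(i <- s) c i * f (y i).
Proof.
move=> conv c0 Ky; elim: s x T => [|i s IH] x T Kx T0.
  by rewrite !big_nil !addr0 => ->; rewrite scale1r mul1r.
rewrite !big_cons !addrA => tot.
have [ci|ci] := eqVneq (c i) 0.
  by rewrite ci scale0r mul0r !addr0; apply: IH => //; rewrite -tot ci addr0.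
have ci0 : 0 < c i by rewrite lt_neqAle eq_sym ci c0.
have Tc : 0 < T + c i by rewrite addr_gt0.
pose t := T / (T + c i).
have t01 : 0 < t < 1 by rewrite divr_gt0//= ltr_pdivrMr// mul1r ltrDl.
have t1 : (T + c i) * (1 - t) = c i by rewrite /t; field; rewrite gt_eqF.
have tT : (T + c i) * t = T by rewrite /t; field; rewrite gt_eqF.
have [Kz fz] := conv x (y i) t Kx (Ky i) t01.
have := IH _ _ Kz Tc tot.
rewrite scalerDr !scalerA t1 tT => /le_trans; apply; rewrite lerD2r.
have -> : T * f x + c i * f (y i) = (T + c i) * (t * f x + (1 - t) * f (y i)).
  by rewrite [RHS]mulrDr [in RHS]mulrA tT [in RHS]mulrA t1.
by rewrite ler_pM2l.
Qed.

Lemma spanning_points K x0 : K x0 -> exists N (y : 'I_N -> 'rV[R]_n), (forall i, K (y i)) /\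
  forall x, K x -> (x - x0 <= \matrix_i (y i - x0))%MS.
Proof.
move=> Kx0.
pose P d := `[< exists N (y : 'I_N -> 'rV[R]_n), (forall i, K (y i)) /\
  \rank (\matrix_i (y i - x0)) = d >].
have P0 : exists d, P d.
  by eexists; apply/asboolP; exists 0%N, (fun _ => x0); split.
have Pn d : P d -> (d <= n)%N by move=> /asboolP[N [y [_ <-]]]; exact: rank_leq_col.
have [d /asboolP[N [y [Ky rE]]] dmax] := ex_maxnP P0 Pn.
exists N, y; split=> // x Kx.
pose y' (j : 'I_N.+1) := if unlift ord0 j is Some i then y i else x.
pose M := \matrix_i (y i - x0); pose M' := \matrix_i (y' i - x0).
have MM' : (M <= M')%MS.
  apply/row_subP => i; have -> : row i M = row (lift ord0 i) M' by rewrite !rowK /y' liftK.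
  exact: row_sub.
have rM : (\rank M' <= \rank M)%N.
  rewrite [X in (_ <= X)%N]rE; apply: dmax; apply/asboolP; exists N.+1, y'; split=> // j.
  by rewrite /y'; case: unliftP.
have M'M : (M' <= M)%MS by rewrite -(mxrank_leqif_sup MM') eqn_leq rM mxrankS.
apply: submx_trans M'M.
have -> : x - x0 = row ord0 M' by rewrite rowK /y' unlift_none.
exact: row_sub.
Qed.

(* The barycenter of the spanning points lies in the relative interior: it is a convex combination
   of any [x] in [K] (with a fixed weight [eps]) and of these points, with weights affine in [x]. *)
Lemma affine_minorant K f : mxbounded K ->
  (forall x y (t : R), K x -> K y -> 0 < t < 1 ->
     K (t *: x + (1 - t) *: y) /\ f (t *: x + (1 - t) *: y) <= t * f x + (1 - t) * f y) ->
  exists q : 'rV[R]_n * R, forall x, K x -> dotr q.1 x + q.2 <= f x.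
Proof.
move=> [M HM] conv.
have [[x0 Kx0]|K0] := pselect (K !=set0); last first.
  by exists (0, 0) => x Kx; case: K0; exists x.
have [N [y [Ky span]]] := spanning_points Kx0.
pose A := \matrix_i (y i - x0).
pose G := pinvmx A.
pose lam x : 'rV[R]_N := (x - x0) *m G.
have lamE x : K x -> x - x0 = \sum_i lam x 0 i *: (y i - x0).
  move=> Kx; rewrite -[LHS](mulmxKpV (span x Kx)) mulmx_sum_row.
  by apply: eq_bigr => i _; rewrite rowK.
have [L [L0 HL]] : exists L : R, 0 <= L /\ forall x, K x -> forall i, `|lam x 0 i| <= L.
  have MM0 : 0 <= `|M| + `|M| by rewrite addr_ge0.
  exists (\sum_i \sum_k ((`|M| + `|M|) * `|G k i|)); split.
    by apply: sumr_ge0 => ? _; apply: sumr_ge0 => ? _; rewrite mulr_ge0.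
  move=> x Kx i; rewrite /lam mxE (le_trans (ler_norm_sum _ _ _))//.
  apply: (@le_trans _ _ (\sum_k ((`|M| + `|M|) * `|G k i|))).
    apply: ler_sum => k _; rewrite normrM ler_wpM2r//.
    rewrite (le_trans (coord_le_norm _ _ _))// (le_trans (ler_normB _ _))//.
    by apply: lerD; exact: le_trans (HM _ _) (ler_norm _).
  rewrite [leRHS](bigD1 i)//= lerDl.
  by apply: sumr_ge0 => ? _; apply: sumr_ge0 => ? _; rewrite mulr_ge0.
pose N1 : R := N.+1%:R.
have N10 : 0 < N1 by rewrite ltr0n.
pose D : R := 1 + N%:R * L + L.
have NL0 : 0 <= N%:R * L by rewrite mulr_ge0.
have D0 : 0 < D by rewrite /D; lra.
(* Makes every weight [N1^-1 - eps * la j] nonnegative, since [la j <= D]. *)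
pose eps : R := (N1 * D)^-1.
have eps0 : 0 < eps by rewrite invr_gt0 mulr_gt0.
have epsD : eps * D = N1^-1 by rewrite /eps; field; rewrite !gt_eqF.
pose Y (j : 'I_N.+1) := if unlift ord0 j is Some i then y i else x0.
pose c := \sum_(j < N.+1) N1^-1 *: Y j.
pose F : 'cV[R]_N := \col_i (f (y i) - f x0).
(* At $x-x_0$ this form takes the combination, with coefficients [lam x], of the differences
   [f (y i) - f x0]: it is what makes the weighted sum of values in Jensen's inequality affine in
   [x]. *)
pose g : 'rV[R]_n := (G *m F)^T.
have gE x : dotr g (x - x0) = \sum_i lam x 0 i * (f (y i) - f x0).
  have -> : dotr g (x - x0) = ((x - x0) *m (G *m F)) 0 0.
    by rewrite mxE; apply: eq_bigr => k _; rewrite /g mxE mulrC.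
  by rewrite mulmxA mxE; apply: eq_bigr => i _; rewrite [F _ _]mxE.
pose sf := \sum_(j < N.+1) N1^-1 * f (Y j).
exists (g, f x0 - dotr g x0 + eps^-1 * (f c - sf)) => x Kx /=.
pose la (j : 'I_N.+1) := if unlift ord0 j is Some i then lam x 0 i else 1 - \sum_i lam x 0 i.
have suml : \sum_(j < N.+1) la j = 1.
  have laS i : la (lift ord0 i) = lam x 0 i by rewrite /la liftK.
  by rewrite big_ord_recl (eq_bigr _ (fun i _ => laS i)) /la unlift_none subrK.
have lb j : la j <= D.
  have abs : `|\sum_i lam x 0 i| <= N%:R * L.
    rewrite (le_trans (ler_norm_sum _ _ _))//.
    apply: (@le_trans _ _ (\sum_(i < N) L)); first by apply: ler_sum => i _; exact: HL.
    by rewrite sumr_const card_ord mulr_natl.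
  rewrite /la /D; case: unliftP => [i _|_].
    by have := HL x Kx i; rewrite ler_norml => /andP[_ h]; lra.
  by move: abs; rewrite ler_norml => /andP[h _]; lra.
have suma (V : lmodType R) (v : V) (w : 'I_N -> V) :
   \sum_(j < N.+1) la j *: (if unlift ord0 j is Some i then w i else v) =
   v + \sum_i lam x 0 i *: (w i - v).
  rewrite big_ord_recl /la unlift_none (eq_bigr (fun i => lam x 0 i *: w i)); last first.
    by move=> i _; rewrite liftK.
  under [in RHS]eq_bigr do rewrite scalerBr.
  by rewrite sumrB scalerBl scale1r -scaler_suml addrA addrAC -addrA.
have H := @jensen K f 'I_N.+1 (enum 'I_N.+1) (fun j => N1^-1 - eps * la j) Y x eps conv.
have {}H : f c <= eps * f x + \sum_(j < N.+1) (N1^-1 - eps * la j) * f (Y j).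
  have cE : c = eps *: x + \sum_(j < N.+1) (N1^-1 - eps * la j) *: Y j.
    under eq_bigr do rewrite scalerBl -scalerA.
    have sY : \sum_(j < N.+1) la j *: Y j = x0 + \sum_i lam x 0 i *: (y i - x0) by exact: suma.
    rewrite sumrB -[X in _ + (_ - X)]scaler_sumr sY -lamE// [x0 + _]addrC subrK.
    by rewrite addrCA subrr addr0.
  rewrite cE -!big_enum; apply: H => //.
  - by move=> j; rewrite subr_ge0 -epsD ler_pM2l.
  - by move=> j; rewrite /Y; case: unliftP.
  - rewrite big_enum/= sumrB -mulr_sumr suml mulr1 sumr_const card_ord addrC subrK.
    by rewrite -mulr_natl mulfV// gt_eqF.
have E : \sum_(j < N.+1) (N1^-1 - eps * la j) * f (Y j) = sf - eps * (f x0 + dotr g (x - x0)).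
  under eq_bigr do rewrite mulrBl -mulrA.
  rewrite sumrB -[X in _ - X = _]mulr_sumr gE; congr (_ - _ * _).
  rewrite -(suma R^o (f x0) (fun i => f (y i))); apply: eq_bigr => j _.
  by rewrite /Y; case: (unlift _ _).
rewrite E dotrBr in H.
have k : eps * (eps^-1 * (f c - sf)) = f c - sf by rewrite mulrA mulfV ?mul1r// gt_eqF.
rewrite -(ler_pM2l eps0); move: H k.
move: (eps^-1 * (f c - sf)) => z; move: (f c) (sf) (f x) (f x0) (dotr g x) (dotr g x0).
move=> a b d1 d2 d3 d4 H k.
by rewrite !mulrDr k; lra.
Qed.

End convex_functions.

(** * Identification of the infimum and of the limit for $u$ *)

Section main.
Context {R : realType} {n : nat} (p : R) (u : 'rV[R]_n -> \bar R) (omega : 'rV[R]_n * R -> R).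
Hypothesis n0 : (0 < n)%N.
Hypothesis p0 : 0 < p.
Hypothesis u_ninfty : forall x, (-oo < u x)%E.
Hypothesis convu : convex_ext u.
Hypothesis cdom : compact (dom u).
Local Notation f := (fun x => fine (u x)).
Hypothesis lipu : lip_on f (dom u)°.
Hypothesis c2u : C2plus_on f (dom u)°.
Hypothesis omega_cont : continuous omega.
Hypothesis omega_gt0 : forall z, 0 < omega z.
Local Notation mu := (@leb_mx R n).
Local Notation r := (2 * p / n%:R).
Local Notation K := (dom u).
Local Notation O := ((dom u)° : set 'rV[R]_n).
Local Notation om := (fun x => omega (x, fine (u x))).

Let nR0 : 0 < n%:R :> R. Proof. by rewrite ltr0n. Qed.
Let oO : open O. Proof. exact: open_interior. Qed.
Let mO : measurable O. Proof. exact: open_measurable_mx. Qed.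
Let OK : O `<=` K. Proof. exact: interior_subset. Qed.
Let bK : mxbounded K. Proof. exact: compact_mxbounded. Qed.

Let uE x : K x -> u x = (f x)%:E.
Proof. by move=> Kx; rewrite fineK// fin_numE; rewrite gt_eqF//= lt_eqF. Qed.

Let conv_f x y (t : R) : K x -> K y -> 0 < t < 1 ->
  K (t *: x + (1 - t) *: y) /\ f (t *: x + (1 - t) *: y) <= t * f x + (1 - t) * f y.
Proof.
move=> Kx Ky t01; have := convu x y t01; rewrite (uE Kx) (uE Ky) -!EFinM -EFinD => h.
have Kz : K (t *: x + (1 - t) *: y) by exact: le_lt_trans h (ltry _).
by split=> //; move: h; rewrite (uE Kz) lee_fin.
Qed.

Let convK : mxconvex K.
Proof. by move=> x y t Kx Ky t01; have [] := conv_f Kx Ky t01. Qed.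
Let convO : mxconvex O.
Proof. exact: mxconvex_interior. Qed.

Definition minorants : set ('rV[R]_n * R) :=
  [set q | forall x, K x -> ((dotr q.1 x + q.2)%:E <= u x)%E].
Local Notation A := minorants.
Local Notation e := (@gap_error R n p f om O A).

Let A_leK q x : A q -> K x -> dotr q.1 x + q.2 <= f x.
Proof. by move=> Aq Kx; have := Aq x Kx; rewrite (uE Kx) lee_fin. Qed.

Let A_le q x : A q -> O x -> dotr q.1 x + q.2 <= f x.
Proof. by move=> Aq /OK; exact: A_leK. Qed.

(** Convexity along the segment from [z] to [x], differentiated at [z]: this reaches the boundary of
    the domain without continuity of $u$ there. *)
Let A_tangent z : O z -> A (grad f z, f z - dotr (grad f z) z).
Proof.
move=> Oz x Kx /=; rewrite (uE Kx) lee_fin.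
have [C1f _] := C2_C1 c2u.1.
suff : dotr (grad f z) (x - z) <= f x - f z by rewrite dotrBr; lra.
apply: (direction_le oO C1f Oz) => t t0 t1.
have -> : z + t *: (x - z) = t *: x + (1 - t) *: z by apply/rowP => j; rewrite !mxE; ring.
have [_] := @conv_f x z t Kx (OK Oz) (ltac:(by rewrite t0)); lra.
Qed.

(** If the interior of the domain is empty there are no tangents, and a minorant has to come from
    [affine_minorant]. Without one the infimum in [tri] would be over the empty set. *)
Let A_nonempty : exists q, A q.
Proof.
have [q Hq] := affine_minorant bK conv_f.
by exists q => x Kx; rewrite (uE Kx) lee_fin Hq.
Qed.

Let omc : {in O, continuous om}.
Proof.
move=> x; rewrite inE => Ox; have [C1f _] := C2_C1 c2u.1.
have fc : {for x, continuous f} by exact: (C1_continuous oO C1f).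
apply: (@continuous_comp _ _ _ (fun y => (y, fine (u y))) omega x); last exact: omega_cont.
have cx : y @[y --> x] --> x by exact: cvg_id.
exact: (cvg_pair cx fc).
Qed.

Let om_gt0 x : O x -> 0 < om x. Proof. by move=> _; exact: omega_gt0. Qed.

(** The Lipschitz hypothesis bounds $u$ on the interior, so $\omega$ is evaluated inside a compact
    set. *)
Let om_bd : exists M : R, forall x, O x -> om x <= M.
Proof.
have [[x1 Ox1]|O0] := pselect (O !=set0); last by exists 0 => x Ox; case: O0; exists x.
have [L HL] := lipu; have [M HM] := bK.
pose B := `|f x1| + `|L| * (M + M).
have fB x : O x -> `|f x| <= B.
  move=> Ox; have -> : f x = f x1 + (f x - f x1) by rewrite addrC subrK.
  apply: (le_trans (ler_normD _ _)); rewrite lerD2l.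
  apply: (le_trans (HL _ _ Ox Ox1)); apply: (@le_trans _ _ (`|L| * `|x - x1|)).
    by rewrite ler_wpM2r// ler_norm.
  rewrite ler_wpM2l//; apply: (le_trans (ler_normB _ _)); apply: lerD; apply: HM; exact: OK.
have [z _ zm] : exists2 z, z \in K `*` `[- B, B]%classic & forall y, y \in K `*` `[- B, B]%classic -> omega y <= omega z.
  apply: compact_EVT_max.
  - exists (x1, f x1); split; first exact: OK.
    by rewrite /= in_itv/= -ler_norml fB.
  - by apply: compact_setX => //; exact: segment_compact.
  exact: continuous_subspaceT.
exists (omega z) => x Ox; apply: zm; rewrite inE; split; first exact: OK.
by rewrite /= in_itv/= -ler_norml fB.
Qed.

(** On the boundary of the domain [F] is arbitrary and possibly not measurable; [iint_inull]
    discards it because the domain is convex. *)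
Lemma iint_on_dom (F g : 'rV[R]_n -> \bar R) : (forall x, 0 <= F x)%E -> (forall x, O x -> F x = g x) ->
  (forall x, 0 <= g x)%E -> measurable_fun O g -> iint_on K F = (\int[mu]_(x in O) g x)%E.
Proof.
move=> F0 Fg g0 mg; rewrite -iint_onE//; apply: (iint_inull (convex_boundary_inull convK)).
- by move=> x; case: ifP.
- by move=> x; case: ifP.
move=> x Nx; case: asboolP => Kx; case: asboolP => Ox //.
- exact: Fg.
- by exfalso; apply: Nx.
- by exfalso; apply: Kx; exact: OK.
Qed.

(** The largest affine function has the smallest gap, and the gaps are nonnegative on [O], so that
    [p]-th powers preserve their order. *)
Lemma err_maxaff k (Q : 'I_k.+1 -> {q | A q}) x : O x ->
  err e [seq Q i | i <- enum 'I_k.+1] x =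
  ((f x - maxaff (fun i => (sval (Q i)).1) (fun i => (sval (Q i)).2) x) `^ p * om x)%:E.
Proof.
move=> Ox; have o0 := om_gt0 Ox; apply: err_eq.
  have [i Ei] : exists i, maxaff (fun i => (sval (Q i)).1) (fun i => (sval (Q i)).2) x =
     dotr (sval (Q i)).1 x + (sval (Q i)).2.
    rewrite /maxaff; elim/big_ind : _; first by exists ord0.
      by move=> _ _ [i ->] [j ->]; rewrite maxEle; case: ifP => _; [exists j|exists i].
    by move=> i _; exists i.
  exists (Q i); first by apply: List.in_map; apply: mem_In; rewrite mem_enum.
  by rewrite gap_errorE// Ei.
move=> q /List.in_map_iff[i [<- _]]; rewrite gap_errorE// ler_pM2r//.
have /bigmax_leP[mle1 mle2] : maxaff (fun i => (sval (Q i)).1) (fun i => (sval (Q i)).2) x <= f x.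
  by apply/bigmax_leP; split=> [|j _]; apply: A_le => //; exact: svalP.
apply: le_powR; first exact: ltW.
  by rewrite subr_ge0; apply/bigmax_leP.
rewrite lerD2l lerN2.
by apply: (bigmax_sup i).
Qed.

Let err0 (s : seq {q | A q}) x : (0 <= err e s x)%E.
Proof. by apply: err_ge0; exact: gap_error_ge0. Qed.

Let merr (s : seq {q | A q}) : measurable_fun setT (err e s).
Proof. by apply: measurable_err => q; exact: measurable_gap_error. Qed.

Lemma iint_maxaff k (Q : 'I_k.+1 -> {q | A q}) l :
  l = maxaff (fun i => (sval (Q i)).1) (fun i => (sval (Q i)).2) ->
  iint_on K (fun x => ((fine (u x) - l x) `^ p * omega (x, fine (u x)))%:E) =
  (\int[mu]_(x in O) err e [seq Q i | i <- enum 'I_k.+1] x)%E.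
Proof.
move=> ->; apply: iint_on_dom => //.
- by move=> x; rewrite lee_fin mulr_ge0 ?powR_ge0// ltW.
- by move=> x Ox; rewrite err_maxaff.
- exact: measurable_funTS.
Qed.

(** A nonempty list of minorants and a maximum of affine functions are the same data, since a
    maximum is a minorant exactly when all its terms are. *)
Lemma triE m : (0 < m)%N -> tri p u m omega = qerr e O m.
Proof.
move=> m0; apply/eqP; rewrite eq_le; apply/andP; split.
  apply: le_ereal_inf_tmp => _ [s sm ->].
  have [q0 Aq0] := A_nonempty; pose Q0 : {q | A q} := exist _ q0 Aq0.
  (* A maximum has at least one term, so the empty list is replaced by a single minorant, which is
     allowed as [0 < m] and can only lower the error. *)
  wlog s0 : s sm / (0 < size s)%N.
    move=> H; case: s sm => [_|q s sm]; last exact: H.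
    apply: (le_trans (H [:: Q0] _ _)) => //.
    apply: ge0_le_integral => //; try exact: measurable_funTS.
    by move=> x _; apply: err_sub.
  case E : (size s) s0 => [//|k] _.
  pose Q (i : 'I_k.+1) := nth Q0 s i.
  have sE : [seq Q i | i <- enum 'I_k.+1] = s.
    rewrite -[RHS](mkseq_nth Q0) E /mkseq -val_enum_ord -map_comp.
    by apply: eq_map.
  apply: ereal_inf_lbound.
  exists (maxaff (fun i => (sval (Q i)).1) (fun i => (sval (Q i)).2)); split; last first.
    by rewrite (iint_maxaff (Q := Q))// sE.
  exists k, (fun i => (sval (Q i)).1), (fun i => (sval (Q i)).2); split; first by rewrite -E.
  split=> // x Kx; rewrite (uE Kx) lee_fin.
  by apply/bigmax_leP; split=> [|j _]; apply: A_leK => //; exact: svalP.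
apply: le_ereal_inf_tmp => _ [l [[k [a [b [km [lE lu]]]]] ->]].
have AQ i : A (a i, b i).
  move=> x Kx /=; apply: le_trans (lu x Kx); rewrite lee_fin lE.
  by apply: (bigmax_sup i).
pose Q i : {q | A q} := exist _ (a i, b i) (AQ i).
rewrite (iint_maxaff (Q := Q))//.
by apply: ereal_inf_lbound; eexists; last reflexivity; rewrite size_map size_enum_ord.
Qed.

(** Covers infinite [y] too, where both sides are 0, so that it applies before anything is said
    about finiteness of the integral. *)
Lemma fine_EFinMl (c : R) (y : \bar R) : 0 <= c -> fine (c%:E * y) = c * fine y.
Proof.
move=> c0; case: y => [y||] //=; rewrite mulr0.
  by have [->|cn] := eqVneq c 0; rewrite ?mul0e// gt0_muley// lte_fin lt_neqAle eq_sym cn.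
by have [->|cn] := eqVneq c 0; rewrite ?mul0e// gt0_muleNy// lte_fin lt_neqAle eq_sym cn.
Qed.

Lemma limit_valueE : (fine (wint O r (weight p f om))) `^ (1 + r) =
  (zadorc n p / 2 `^ p) *
             fine (iint_on (dom u)
               (fun x => ((\det (hessian (fun y => fine (u y)) x)) `^ (p / (n%:R + 2 * p))
                          * omega (x, fine (u x)) `^ (n%:R / (n%:R + 2 * p)))%:E))
             `^ ((n%:R + 2 * p) / n%:R).
Proof.
have np : 0 < n%:R + 2 * p by rewrite addr_gt0// mulr_gt0.
have -> : (n%:R + 2 * p) / n%:R = 1 + r by field; rewrite gt_eqF.
have r1 : 0 < 1 + r by rewrite addr_gt0// divr_gt0// mulr_gt0.
have sE : (1 + r)^-1 = n%:R / (n%:R + 2 * p) by field; rewrite !gt_eqF.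
pose c := zadorc n p / 2 `^ p : R.
have c0 : 0 <= c by rewrite divr_ge0 ?powR_ge0//; exact: zadorc_ge0.
pose g x : \bar R := ((\det (hessian (fun y => fine (u y)) x)) `^ (p / (n%:R + 2 * p))
                          * omega (x, fine (u x)) `^ (n%:R / (n%:R + 2 * p)))%:E.
have g0 x : (0 <= g x)%E by rewrite lee_fin mulr_ge0 ?powR_ge0.
have mg : measurable_fun O g.
  apply/measurable_EFinP; apply: measurable_funM; apply: (measurableT_comp (measurable_powR _)).
    apply: measurable_fun_cont => // x; rewrite inE => Ox; apply: continuous_det => i j.
    under [X in {for _, continuous X}]eq_fun do rewrite mxE.
    by case: c2u.1 => _ [_ [_ [_ H4]]]; apply: H4; rewrite inE.
  exact: measurable_fun_cont.
have -> : wint O r (weight p f om) = ((c `^ (1 + r)^-1)%:E * \int[mu]_(x in O) g x)%E.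
  rewrite -ge0_integralZl_EFin//; last exact: powR_ge0.
  apply: eq_integral => x; rewrite inE => Ox; rewrite -EFinM; congr EFin.
  have o0 := ltW (om_gt0 Ox); have d0 := powR_ge0 (\det (hessian f x)) (p / n%:R).
  have -> : weight p f om x = c * (\det (hessian f x) `^ (p / n%:R) * om x).
    by rewrite /weight -/c mulrA.
  rewrite (powRM _ c0 (mulr_ge0 d0 o0)) (powRM _ d0 o0) -powRrM; congr (_ * (_ `^ _ * _ `^ _)) => //.
  by rewrite sE; field; rewrite !gt_eqF.
rewrite -/g (iint_on_dom g0 (g := g))// fine_EFinMl ?powR_ge0//.
have I0 : 0 <= fine (\int[mu]_(x in O) g x)%E by apply: fine_ge0; exact: integral_ge0.
by rewrite (powRM _ (powR_ge0 _ _) I0) (powRK_inv' r1 c0).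
Qed.

Theorem tri_limit :
  ((fun m : nat => ((m%:R `^ r)%:E * tri p u m omega)) @ \oo
        --> ((zadorc n p / 2 `^ p) *
             fine (iint_on (dom u)
               (fun x => ((\det (hessian (fun y => fine (u y)) x)) `^ (p / (n%:R + 2 * p))
                          * omega (x, fine (u x)) `^ (n%:R / (n%:R + 2 * p)))%:E))
             `^ ((n%:R + 2 * p) / n%:R))%:E)%E.
Proof.
have bO : mxbounded O by have [M HM] := bK; exists M => x /OK; exact: HM.
have [_] := @gap_limit R n p f om O A n0 p0 c2u convO bO lipu A_le A_tangent omc om_gt0 om_bd.
rewrite limit_valueE; apply: cvg_trans; apply: near_eq_cvg.
by exists 1%N => // m /= m1; rewrite triE.
Qed.

End main.

Theorem theorem1 (R : realType) (n : nat) (p : R) :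
  (0 < n)%N -> 0 < p ->
  exists delta : R,
    zador_constant n p delta /\
    forall (u : 'rV[R]_n -> \bar R) (omega : 'rV[R]_n * R -> R),
      (forall x, (-oo < u x)%E) ->
      convex_ext u ->
      compact (dom u) ->
      lip_on (fun x => fine (u x)) (interior (dom u)) ->
      C2plus_on (fun x => fine (u x)) (interior (dom u)) ->
      continuous omega ->
      (forall z, 0 < omega z) ->
      ((fun m : nat => ((m%:R `^ (2 * p / n%:R))%:E * tri p u m omega)) @ \oo
        --> ((delta / 2 `^ p) *
             fine (iint_on (dom u)
               (fun x => ((\det (hessian (fun y => fine (u y)) x)) `^ (p / (n%:R + 2 * p))
                          * omega (x, fine (u x)) `^ (n%:R / (n%:R + 2 * p)))%:E))
             `^ ((n%:R + 2 * p) / n%:R))%:E)%E.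
Proof.
move=> n0 p0; exists (zadorc n p); split; first exact: zador_constant_zadorc.
by move=> u omega u1 u2 u3 u4 u5 o1 o2; exact: tri_limit.
Qed.
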